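(* In the model of nominal rates and inflation described in the context, with market prices of risk $$\lambda^r_t=\frac{(a-\kappa)r_t+\kappa\bar r-ab}{\sigma_r},\qquad \lambda^I_t=\frac{h}{\sigma_I},\qquad \lambda^\pi_t=\frac{(k-\beta)\pi_t+\beta\bar\pi-kl}{\sigma_\pi}$$ for real constants $a,b,h,k,l$, let $p_t(T)=\mathsf{E}^Q_t\big[\exp\{-\int_t^T r_sds\}\big]$ be the price of the nominal zero-coupon bond and $q_t(T)=\mathsf{E}^Q_t\big[\exp\{-\int_t^T r_sds\}I_T\big]$ the price of the inflation bond with maturity $T>t$. Let the break-even inflation $i_t(T)$ be defined by $$\frac{q_t(T)}{I_t}=p_t(T)\exp\{(T-t)i_t(T)\}.$$ Then, with $\Delta=T-t$, $$i_t(T)=l-h+\frac{\Psi(k,\Delta)}{\Delta}(\pi_t-l)+\frac{\sigma_\pi^2}{2}\frac{\Upsilon(k,\Delta)}{\Delta}-\sigma_r\sigma_\pi\rho_{r\pi}\frac{\Lambda(a,k,\Delta)}{\Delta}.$$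
   Context: Under the real-world measure $P$, $dr_t=\kappa(\bar r-r_t)dt+\sigma_r dW^r_t$, $\frac{dI_t}{I_t}=\pi_tdt+\sigma_I dW^I_t$, $d\pi_t=\beta(\bar\pi-\pi_t)dt+\sigma_\pi dW^\pi_t$, with real $\kappa,\beta,\bar r,\bar\pi$, volatilities $\sigma_r,\sigma_I,\sigma_\pi>0$, and jointly Gaussian standard Brownian motions $W^r,W^I,W^\pi$, where $W^r$ and $W^\pi$ have correlation $\rho_{r\pi}$ and $W^I$ is independent of $(W^r,W^\pi)$. $Q$ is the (risk-neutral, equivalent) measure under which $(\bar W^r,\bar W^I,\bar W^\pi)$ defined by $d\bar W^r_t=dW^r_t+\lambda^r_tdt$, $d\bar W^I_t=dW^I_t+\lambda^I_tdt$, $d\bar W^\pi_t=dW^\pi_t+\lambda^\pi_tdt$ is a three-dimensional Brownian motion with the same correlation structure as $(W^r,W^I,W^\pi)$ has under $P$. $\mathsf{E}^Q_t$ denotes conditional expectation under $Q$ given the information at time $t$. Auxiliary functions (for real $\kappa,\alpha$ and $t\ge0$): $\Psi(\kappa,t)=\int_0^t e^{-\kappa u}du$, i.e. $t$ if $\kappa=0$ and $\frac1\kappa(1-e^{-\kappa t})$ if $\kappa\ne0$. $\Upsilon(\kappa,t)=\frac{t^3}{3}$ if $\kappa=0$, and $\frac1{2\kappa^3}(-3+2\kappa t+4e^{-\kappa t}-e^{-2\kappa t})$ if $\kappa\ne0$. $\Lambda(\kappa,\alpha,t)=\frac{t^3}{3}$ if $\kappa=\alpha=0$; $\frac1{2\alpha^3}(-2+t^2\alpha^2+2e^{-\alpha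 t}+2\alpha te^{-\alpha t})$ if $\kappa=0,\alpha\neq0$; $\frac1{2\kappa^3}(-2+t^2\kappa^2+2e^{-\kappa t}+2\kappa te^{-\kappa t})$ if $\kappa\ne0,\alpha=0$; $\frac1{\alpha\kappa}(\Psi(\alpha+\kappa,t)-\Psi(\alpha,t)-\Psi(\kappa,t)+t)$ if $\kappa\neq0,\alpha\neq0$. *)

(* Defs.v *)
From HB Require Import structures.
From mathcomp Require Import all_boot all_order all_algebra.
From mathcomp Require Import all_classical all_reals all_analysis.

Set Implicit Arguments.
Unset Strict Implicit.
Unset Printing Implicit Defensive.

Import Order.TTheory GRing.Theory Num.Theory.
Import numFieldNormedType.Exports.

Local Open Scope classical_set_scope.
Local Open Scope ring_scope.

Section auxiliary_functions.
Context {R : realType}.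
Implicit Types kappa alpha t : R.

Definition Psi kappa t : R :=
  if kappa == 0 then t else kappa^-1 * (1 - expR (- (kappa * t))).

Definition Upsilon kappa t : R :=
  if kappa == 0 then t ^+ 3 / 3
  else (2 * kappa ^+ 3)^-1 *
       (- 3 + 2 * kappa * t + 4 * expR (- (kappa * t))
        - expR (- (2 * kappa * t))).

Definition Lambda kappa alpha t : R :=
  if kappa == 0 then
    if alpha == 0 then t ^+ 3 / 3
    else (2 * alpha ^+ 3)^-1 *
         (- 2 + t ^+ 2 * alpha ^+ 2 + 2 * expR (- (alpha * t))
          + 2 * alpha * t * expR (- (alpha * t)))
  else
    if alpha == 0 then
      (2 * kappa ^+ 3)^-1 *
      (- 2 + t ^+ 2 * kappa ^+ 2 + 2 * expR (- (kappa * t))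
       + 2 * kappa * t * expR (- (kappa * t)))
    else (alpha * kappa)^-1 *
         (Psi (alpha + kappa) t - Psi alpha t - Psi kappa t + t).

End auxiliary_functions.

(* Processes are functions [X : R -> Omega -> R] considered at the times of a
   trading horizon [0, tau]; values at other times are irrelevant. *)
Section processes.
Context {d : measure_display} {Omega : measurableType d} {R : realType}.
Implicit Types (P Q : probability Omega R) (F : R -> set (set Omega)).
Implicit Types (tau t rho : R) (X Y W H J : R -> Omega -> R).

Definition filtration tau F :=
  (forall t : R, 0 <= t <= tau ->
     sigma_algebra setT (F t) /\ F t `<=` measurable) /\
  (forall s t : R, 0 <= s -> s <= t -> t <= tau -> F s `<=` F t).

Definition measurable_wrt (G : set (set Omega)) (Z : Omega -> R) :=
  forall B : set R, measurable B -> G (Z @^-1` B).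

Definition adapted tau F X :=
  forall t : R, 0 <= t <= tau -> measurable_wrt (F t) (X t).

Definition continuous_paths tau X :=
  forall w, {within `[0, tau], continuous (fun t => X t w)}.

(* [int_0^t X_s ds], path by path *)
Definition time_integral X t (w : Omega) : R :=
  \int[lebesgue_measure]_(s in `[0, t]) X s w.

(* Z has law N(0, v). The case v = 0 is separate because [normal_prob m 0] is
   not the Dirac mass at m. *)
Definition centered_gaussian P (Z : Omega -> R) (v : R) :=
  0 <= v /\
  forall B : set R, measurable B ->
    P (Z @^-1` B) =
      if v == 0 then \d_(0 : R) B else normal_prob 0 (Num.sqrt v) B.

(* (Wr, WI, Wpi) is a Gaussian three-dimensional Brownian motion on [0, tau]
   with respect to (F_t): standard components, correlation rho between Wr and
   Wpi, and WI uncorrelated with (Wr, Wpi). Joint normality of the increments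
   is expressed by the normality of all linear combinations, so the absence of
   cross terms with uI in the variance says that WI is independent of
   (Wr, Wpi). *)
Definition brownian_motion3 P tau F rho (Wr WI Wpi : R -> Omega -> R) :=
  [/\ [/\ adapted tau F Wr, adapted tau F WI & adapted tau F Wpi],
      {ae P, forall w, [/\ Wr 0 w = 0, WI 0 w = 0 & Wpi 0 w = 0]},
      {ae P, forall w, [/\ {within `[0, tau], continuous (fun t => Wr t w)},
                           {within `[0, tau], continuous (fun t => WI t w)} &
                           {within `[0, tau], continuous (fun t => Wpi t w)}]},
      (forall s t : R, 0 <= s -> s < t -> t <= tau ->
         forall (A : set Omega) (B : set (R * R * R)), F s A -> measurable B ->
         let dW w := (Wr t w - Wr s w, WI t w - WI s w, Wpi t w - Wpi s w) in
         P (A `&` dW @^-1` B) = (P A * P (dW @^-1` B))%E) &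
      (forall s t : R, 0 <= s -> s < t -> t <= tau ->
         forall ur uI upi : R,
         centered_gaussian P
           (fun w => ur * (Wr t w - Wr s w) + uI * (WI t w - WI s w)
                     + upi * (Wpi t w - Wpi s w))
           ((t - s) *
            (ur ^+ 2 + uI ^+ 2 + upi ^+ 2 + 2 * rho * ur * upi)))].

(* For a list of points s_1 < ... < s_n = t, the sum over j of
   H_(s_j) (W_(s_(j+1)) - W_(s_j)), with s_0 = 0. *)
Definition left_sum H W (s : seq R) (w : Omega) : R :=
  \sum_(j < size s) H (nth 0 (0 :: s) j) w *
    (W (nth 0 (0 :: s) j.+1) w - W (nth 0 (0 :: s) j) w).

Definition mesh (s : seq R) : R :=
  \big[Num.max/0]_(j < size s) (nth 0 (0 :: s) j.+1 - nth 0 (0 :: s) j).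

Definition cvg_in_probability P (Z : nat -> Omega -> R) (Z0 : Omega -> R) :=
  forall eps : R, 0 < eps ->
    (fun n => P [set w | eps <= `|Z n w - Z0 w|]) @ \oo --> 0%E.

(* Z = int_0^t H dW (Ito). For an adapted integrand with continuous paths, the
   stochastic integral is the limit in probability of the left-endpoint sums
   along partitions of [0, t] whose mesh tends to 0. *)
Definition is_ito_integral P H W t (Z : Omega -> R) :=
  forall s : nat -> seq R,
    (forall n, itv_partition 0 t (s n)) ->
    (fun n => mesh (s n)) @ \oo --> (0 : R) ->
    cvg_in_probability P (fun n => left_sum H W (s n)) Z.

(* dX_t = speed (level - X_t) dt + sigma dW_t; the noise is additive, so its
   stochastic integral is sigma W. *)
Definition mean_reverting_sde P tau (speed level sigma : R) W X :=
  forall t : R, 0 <= t <= tau ->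
    {ae P, forall w,
       X t w = X 0 w + time_integral (fun s w => speed * (level - X s w)) t w
               + sigma * W t w}.

(* dX_t / X_t = mu_t dt + sigma dW_t *)
Definition geometric_sde P tau F (mu : R -> Omega -> R) (sigma : R) W X :=
  exists J : R -> Omega -> R,
    adapted tau F J /\
    forall t : R, 0 <= t <= tau ->
      is_ito_integral P (fun s w => sigma * X s w) W t (J t) /\
      {ae P, forall w,
         X t w = X 0 w + time_integral (fun s w => X s w * mu s w) t w
                 + J t w}.

(* dWbar_t = dW_t + lambda_t dt *)
Definition drifted W (lambda : R -> Omega -> R) : R -> Omega -> R :=
  fun t w => W t w + time_integral lambda t w.

(* Y is a version of E^Q[Z | G] for a payoff Z that is nonnegative almost
   surely; the integrals being extended real valued, no integrability of Z has
   to be presupposed. *)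
Definition is_cond_exp Q (G : set (set Omega)) (Z Y : Omega -> R) :=
  measurable_wrt G Y /\
  forall A, G A ->
    (\int[Q]_(w in A) (Y w)%:E = \int[Q]_(w in A) (Z w)%:E)%E.

(* exp(- int_t^T r_s ds) *)
Definition discount (r : R -> Omega -> R) (t T : R) (w : Omega) : R :=
  expR (- (\int[lebesgue_measure]_(s in `[t, T]) r s w)).

End processes.

(* Main.v *)
(* Under Q the rates r and pi are again mean reverting, with parameters (a, b)
   and (k, l), and I_T / I_t = exp(int_t^T pi ds + sigma_I (W^I_T - W^I_t)
   - sigma_I^2 Delta / 2). Hence both payoffs have the form Y exp(K + G), where
   Y and K are known at time t and G is the limit of the Gaussian sums
   sum_j c(s_j) (Wbar_(s_(j+1)) - Wbar_(s_j)), with coefficients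
   -sigma_r Psi(a, T - s), sigma_I and sigma_pi Psi(k, T - s). Their conditional
   expectation is Y exp(K + Var G / 2), and in the ratio of the two prices only
   int Psi(k, .)^2 = Upsilon(k, .) and int Psi(a, .) Psi(k, .) = Lambda(a, k, .)
   survive.

   The formula for I replaces Ito's formula by an L^2 comparison: up to small
   errors, I exp(- int pi) / I_0 and the exponential martingale of sigma_I W^I
   both satisfy the Euler scheme of dX = sigma_I X dW^I, and a discrete Gronwall
   inequality bounds their distance. *)

(* The stochastic integral in the equation of the index is given only as a limit in probability:
   neither a rate nor an isometry comes with it, and [I] is not known to be square integrable. The
   L^2 comparison is therefore made for a scheme whose error terms are clamped, hence square
   integrable. This scheme coincides with the discounted index on events whose probability tends to
   1, where the continuity of the paths keeps the errors below the clamping level.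

   The equations of the rates are never solved. Summation by parts against the weight Psi(a, T - s)
   shows, path by path, that the integral of the rate over [t, T] is, up to terms known at time t, a
   limit of explicit sums of increments of the drifted Brownian motion. Nor is the law of the limit
   determined: exponential moments of the sums are computed exactly, one increment at a time, and
   pass to the limit because second moments stay bounded.

   The index is treated under P, where W^I is Brownian; its formula is carried to Q as an almost
   sure identity, and the prices are computed under Q. *)
Require Import Defs.
From HB Require Import structures.
From mathcomp Require Import all_boot all_order all_algebra.
From mathcomp Require Import all_classical all_reals all_analysis.
From mathcomp Require Import measurable_realfun.
From mathcomp Require Import ring lra.
Import Order.TTheory GRing.Theory Num.Theory.
Import numFieldNormedType.Exports.
Local Open Scope classical_set_scope.
Local Open Scope ring_scope.

Set Implicit Arguments.
Unset Strict Implicit.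
Unset Printing Implicit Defensive.

(** * Independence and Gaussian expectations *)

Section measure_basics.
Context {d : measure_display} {Omega : measurableType d} {R : realType}.

Definition indep_of (P : set Omega -> \bar R) (G : set (set Omega)) (X : Omega -> R) :=
  forall (A : set Omega) (B : set R), G A -> measurable B ->
    P (A `&` X @^-1` B) = (P A * P (X @^-1` B))%E.

Lemma measurable_wrtP (G : set (set Omega)) (Z : Omega -> R) :
  sigma_algebra setT G ->
  measurable_wrt G Z <-> measurable_fun [set: g_sigma_algebraType G] Z.
Proof.
move=> sG; split=> [mZ _ B mB|mZ B mB].
  by rewrite setTI; apply: sub_sigma_algebra; exact: mZ.
by have := mZ measurableT B mB; rewrite setTI measurable_g_measurableTypeE.
Qed.

Lemma sub_measurable_fun (G : set (set Omega)) (Z : Omega -> R) :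
  sigma_algebra setT G -> G `<=` measurable ->
  measurable_wrt G Z -> measurable_fun setT Z.
Proof. by move=> sG Gm mZ _ B mB; rewrite setTI; apply: Gm; exact: mZ. Qed.

(* The image of P by (U, V) is the product of its marginals, to which
   Tonelli's theorem applies. *)
Lemma indep_pair_ge0_integralM d1 d2 (T1 : measurableType d1)
    (T2 : measurableType d2) (P : probability Omega R)
    (U : {mfun Omega >-> T1}) (V : {mfun Omega >-> T2}) (f : T1 -> R) (g : T2 -> R) :
  (forall A B, measurable A -> measurable B ->
     P (U @^-1` A `&` V @^-1` B) = (P (U @^-1` A) * P (V @^-1` B))%E) ->
  measurable_fun setT f -> measurable_fun setT g ->
  (forall x, 0 <= f x) -> (forall x, 0 <= g x) ->
  (\int[P]_w (f (U w) * g (V w))%:E =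
   (\int[P]_w (f (U w))%:E) * (\int[P]_w (g (V w))%:E))%E.
Proof.
move=> iUV mf mg f0 g0.
have mUV : measurable_fun [set: Omega] (fun w => (U w, V w)).
  by apply/measurable_fun_pairP; split; exact: measurable_funPT.
pose UV : {mfun Omega >-> (T1 * T2)%type} := HB.pack (fun w => (U w, V w))
  (isMeasurableFun.Build _ _ _ _ _ mUV).
pose F (z : T1 * T2) : \bar R := (f z.1 * g z.2)%:E.
have mF : measurable_fun [set: (T1 * T2)%type] F.
  apply/measurable_EFinP; apply: measurable_funM.
    exact: (measurableT_comp mf).
  exact: (measurableT_comp mg).
have F0 z : (0 <= F z)%E by rewrite lee_fin mulr_ge0.
have prodE : forall A, measurable A ->
    (distribution P U \x distribution P V)%E A = distribution P UV A.
  by apply: product_measure_unique => A B mA mB; exact: iUV.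
transitivity (\int[distribution P UV]_z F z)%E.
  by rewrite ge0_integral_distribution.
rewrite (@eq_measure_integral _ _ _ _ (distribution P U \x distribution P V)%E); last first.
  by move=> A mA _; apply/esym; exact: prodE.
rewrite fubini_tonelli1// /fubini_F/=.
under eq_integral => x _.
  rewrite /F/=; under eq_integral do rewrite EFinM.
  rewrite ge0_integralZl_EFin//=; last 2 first.
    by move=> y _; rewrite lee_fin.
  exact/measurable_EFinP.
  over.
rewrite ge0_integralZr//=; last 3 first.
- exact/measurable_EFinP.
- by move=> x _; rewrite lee_fin.
- by apply: integral_ge0 => x _; rewrite lee_fin.
congr (_ * _)%E.
- by rewrite ge0_integral_distribution//=; exact/measurable_EFinP.
- by rewrite ge0_integral_distribution//=; exact/measurable_EFinP.
Qed.

Lemma indep_ge0_integralM (P : probability Omega R) (G : set (set Omega))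
    (X Y : Omega -> R) (f : R -> R) :
  sigma_algebra setT G -> G `<=` measurable ->
  measurable_fun setT X -> indep_of P G X ->
  measurable_wrt G Y -> measurable_fun setT f ->
  (forall w, 0 <= Y w) -> (forall x, 0 <= f x) ->
  (\int[P]_w (Y w * f (X w))%:E =
   (\int[P]_w (Y w)%:E) * (\int[P]_w (f (X w))%:E))%E.
Proof.
move=> sG Gm mX iX mY mf Y0 f0.
have mid : measurable_fun [set: Omega] (id : Omega -> g_sigma_algebraType G).
  by move=> _ B; rewrite measurable_g_measurableTypeE// setTI; exact: Gm.
pose U : {mfun Omega >-> g_sigma_algebraType G} :=
  HB.pack (id : Omega -> g_sigma_algebraType G)
    (isMeasurableFun.Build _ _ _ _ _ mid).
pose V : {mfun Omega >-> R} := HB.pack X (isMeasurableFun.Build _ _ _ _ _ mX).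
apply: (@indep_pair_ge0_integralM _ _ _ _ P U V Y f) => //.
- move=> A B mA mB; apply: iX => //.
  have GA : <<s G >> A by [].
  by move: GA; rewrite sigma_algebra_id.
- exact/measurable_wrtP.
Qed.

End measure_basics.

Section density.
Local Open Scope ereal_scope.
Context d (T : measurableType d) (R : realType).
Import HBNNSimple.

(** By monotone convergence along simple approximations of [f] from below, both sides reduce to
    simple functions; on an indicator the claim is the hypothesis on [nu]. *)
Lemma ge0_integral_density (mu nu : {measure set T -> \bar R}) (g : T -> R)
    (f : T -> \bar R) :
  measurable_fun setT g -> (forall x, 0 <= g x)%R ->
  (forall A, measurable A -> nu A = \int[mu]_(x in A) (g x)%:E) ->
  measurable_fun setT f -> (forall x, 0 <= f x) ->
  \int[nu]_x f x = \int[mu]_x (f x * (g x)%:E).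
Proof.
move=> mg g0 nuE mf f0.
pose h := nnsfun_approx measurableT mf.
have -> : \int[nu]_x f x = lim (\int[nu]_x (EFin \o h n) x @[n --> \oo]).
  have fE x : f x = lim ((EFin \o h n) x @[n --> \oo]).
    by apply/esym/cvg_lim => //; exact: cvg_nnsfun_approx.
  under eq_integral => x _ do rewrite fE.
  apply: monotone_convergence => //.
  - by move=> n; exact/measurable_EFinP.
  - by move=> n x _ //=; rewrite lee_fin.
  - by move=> x _ a b ab; rewrite lee_fin; exact/lefP/nd_nnsfun_approx.
have -> : \int[mu]_x (f x * (g x)%:E) =
    lim (\int[mu]_x ((EFin \o h n) x * (g x)%:E) @[n --> \oo]).
  have fg x : f x * (g x)%:E = lim ((EFin \o h n) x * (g x)%:E @[n --> \oo]).
    by apply/esym/cvg_lim => //; apply: cvgeZr => //; exact: cvg_nnsfun_approx.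
  under eq_integral => x _ do rewrite fg.
  apply: monotone_convergence => //.
  - by move=> n; apply/emeasurable_funM; exact/measurable_EFinP.
  - by move=> n x _ /=; rewrite mule_ge0 ?lee_fin.
  - by move=> x _ a b ab/=; rewrite lee_wpmul2r ?lee_fin//; exact/lefP/nd_nnsfun_approx.
suff suf n : \int[mu]_x ((EFin \o h n) x * (g x)%:E) =
    \int[nu]_x (EFin \o h n) x.
  by under eq_fun do rewrite -suf.
transitivity (\int[nu]_x
   (\sum_(y \in range (h n)) (y * \1_(h n @^-1` [set y]) x)%:E)); last first.
  by apply: eq_integral => t tE; rewrite /= fimfunE -fsumEFin.
have indich m r : measurable_fun [set: T] (fun x => (r * \1_(h m @^-1` [set r]) x)%:E).
  by apply: (measurable_comp measurableT) => //; exact: measurable_funM.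
rewrite ge0_integral_fsum//; last by move=> m y Ey; exact: nnfun_muleindic_ge0.
transitivity (\int[mu]_x (\sum_(y \in range (h n))
    (y * \1_(h n @^-1` [set y]) x)%:E * (g x)%:E)).
  under [RHS]eq_integral => x xE.
    rewrite -ge0_mule_fsuml => [|y]; last exact: nnfun_muleindic_ge0.
    rewrite fsumEFin // -(fimfunE _ x); over.
  by [].
rewrite ge0_integral_fsum//; last 2 first.
  - by move=> y; apply: emeasurable_funM => //; exact/measurable_EFinP.
  - by move=> m y Ey; apply: mule_ge0; [exact: nnfun_muleindic_ge0|rewrite lee_fin].
apply: eq_fsbigr => r rhn.
under [RHS]eq_integral do rewrite EFinM.
rewrite integralZl_indic_nnsfun => //.
under eq_integral do rewrite EFinM -muleA.
(* A nonnegative simple function never takes a negative value, so that level set is empty. *)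
have [r0|r0] := leP 0%R r; last first.
  rewrite preimage_nnfun0// integral_indic// set0I measure0 mule0.
  by under eq_integral do rewrite indic0 mul0e mule0; rewrite integral0.
rewrite ge0_integralZl//; last 2 first.
- by apply: emeasurable_funM => //; exact/measurable_EFinP.
- by move=> x _; rewrite mule_ge0// lee_fin.
congr (_ * _).
rewrite integral_indic// setIT nuE//.
rewrite [RHS]integral_mkcond; apply: eq_integral => x _.
by rewrite patchE indicE; case: ifPn => _; rewrite ?mul1e ?mul0e.
Qed.

End density.

Section gaussian.
Context {d : measure_display} {Omega : measurableType d} {R : realType}.

Lemma gaussian_ge0_integral (P : probability Omega R) (Z : Omega -> R) (v : R)
    (f : R -> R) :
  measurable_fun setT Z -> centered_gaussian P Z v ->
  measurable_fun setT f -> (forall x, 0 <= f x) ->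
  (\int[P]_w (f (Z w))%:E =
   if (v == 0)%R then (f 0%R)%:E
   else \int[lebesgue_measure]_x (f x * normal_pdf 0%R (Num.sqrt v) x)%:E)%E.
Proof.
move=> mZ [v0 hZ] mf f0.
have mZ' : @measurable_fun _ _ Omega (measurableTypeR R) setT Z by exact: mZ.
have mEf : @measurable_fun _ _ (measurableTypeR R) _ setT (EFin \o f).
  exact/measurable_EFinP.
have Ef0 x : (0 <= (EFin \o f) x)%E by rewrite lee_fin.
pose Z' : {mfun Omega >-> measurableTypeR R} :=
  HB.pack (Z : Omega -> measurableTypeR R) (isMeasurableFun.Build _ _ _ _ _ mZ').
transitivity (\int[distribution P Z']_x (f x)%:E)%E.
  by rewrite ge0_integral_distribution.
have [v_eq0|v_neq0] := eqVneq v 0.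
  transitivity (\int[\d_(0%R : measurableTypeR R)]_x (f x)%:E)%E.
    apply: eq_measure_integral => A mA _.
    by apply: etrans (hZ A mA) _; rewrite v_eq0 eqxx.
  by rewrite integral_dirac// diracT mul1e.
transitivity (\int[normal_prob 0%R (Num.sqrt v)]_x (f x)%:E)%E.
  apply: eq_measure_integral.
  by move=> A mA _; apply: etrans (hZ A mA) _; rewrite (negbTE v_neq0).
rewrite (@ge0_integral_density _ _ _ lebesgue_measure _
  (normal_pdf 0 (Num.sqrt v)))//.
- exact: measurable_normal_pdf.
- exact: normal_pdf_ge0.
Qed.

(** Completing the square: exp(u x) times the density of N(0, v) is exp(u^2 v / 2) times the density
    of N(u v, v), whose total mass is 1. *)
Lemma gaussian_expR (P : probability Omega R) (Z : Omega -> R) (u v : R) :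
  measurable_fun setT Z -> centered_gaussian P Z v ->
  (\int[P]_w (expR (u * Z w))%:E = (expR (u ^+ 2 * v / 2))%:E)%E.
Proof.
move=> mZ gZ; have v0 := gZ.1.
rewrite (@gaussian_ge0_integral P Z v (fun x => expR (u * x)))//; last first.
  by apply: measurableT_comp => //; exact: measurable_funM.
have [->|v_neq0] := eqVneq v 0; first by rewrite !mulr0 mul0r.
have v_gt0 : 0 < v by rewrite lt_def v_neq0.
have s0 : Num.sqrt v != 0 by rewrite sqrtr_eq0 -ltNge.
under eq_integral => x _.
  rewrite (_ : _ * _ = expR (u ^+ 2 * v / 2) * normal_pdf (u * v) (Num.sqrt v) x); last first.
    rewrite !normal_pdfE// mulrCA [RHS]mulrCA; congr (_ * _).
    rewrite /normal_fun -!expRD sqr_sqrtr//; congr expR.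
    by field; lra.
  rewrite EFinM; over.
rewrite ge0_integralZl_EFin//= ?integral_normal_pdf ?mule1//.
- by move=> x _; rewrite lee_fin; exact: normal_pdf_ge0.
- by apply/measurable_EFinP; exact: measurable_normal_pdf.
Qed.

End gaussian.

(** * Square integrable variables and orthogonality to the past *)

Section square_integrable.
Context {d : measure_display} {Omega : measurableType d} {R : realType}.
Variable P : probability Omega R.
Implicit Types f g X Y Z : Omega -> R.

Definition L1 f := P.-integrable setT (EFin \o f).

Definition sqint f := measurable_fun setT f /\ L1 (fun w => f w ^+ 2).

Lemma L1_meas f : L1 f -> measurable_fun setT f.
Proof. by move=> /(@measurable_int _ _ _ _)/measurable_EFinP. Qed.

Lemma L1_le f g : measurable_fun setT f -> L1 g ->
  (forall w, `|f w| <= `|g w|) -> L1 f.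
Proof.
move=> mf L1g fg; apply: le_integrable L1g => //.
- exact/measurable_EFinP.
- by move=> w _; rewrite /= lee_fin.
Qed.

Lemma L1D f g : L1 f -> L1 g -> L1 (fun w => f w + g w).
Proof. by move=> L1f L1g; exact: (integrableD measurableT L1f L1g). Qed.

Lemma L1Z c f : L1 f -> L1 (fun w => c * f w).
Proof. by move=> L1f; exact: (integrableZl measurableT c L1f). Qed.

Lemma L1B f g : L1 f -> L1 g -> L1 (fun w => f w - g w).
Proof. by move=> L1f L1g; exact: (integrableB measurableT L1f L1g). Qed.

Lemma L1_cst c : L1 (fun=> c).
Proof. exact: finite_measure_integrable_cst. Qed.

Lemma L1_ge0 f : measurable_fun setT f -> (forall w, 0 <= f w) ->
  (\int[P]_w (f w)%:E < +oo)%E -> L1 f.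
Proof.
move=> mf f0 fy; apply/integrableP; split; first exact/measurable_EFinP.
by under eq_integral => w _ do rewrite /= ger0_norm//.
Qed.

Lemma L1_EFin f : L1 f -> (\int[P]_w (f w)%:E = (\int[P]_w f w)%R%:E)%E.
Proof. by move=> L1f; rewrite /Rintegral fineK//; exact: integrable_fin_num. Qed.

Lemma sqint_L1M f g : sqint f -> sqint g -> L1 (fun w => f w * g w).
Proof.
move=> [mf f2] [mg g2]; apply: (@L1_le _ (fun w => f w ^+ 2 + g w ^+ 2)).
- exact: measurable_funM.
- exact: L1D.
- move=> w; rewrite [leRHS]ger0_norm ?addr_ge0 ?sqr_ge0// normrM.
  rewrite -[in leRHS](real_normK (num_real (f w))) -[in leRHS](real_normK (num_real (g w))).
  have := sqr_ge0 (`|f w| - `|g w|); have := normr_ge0 (f w); have := normr_ge0 (g w).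
  nra.
Qed.

Lemma sqintD f g : sqint f -> sqint g -> sqint (fun w => f w + g w).
Proof.
move=> sf sg; have [[mf f2] [mg g2]] := (sf, sg).
split; first exact: measurable_funD.
rewrite [X in L1 X](_ : _ = (fun w => (f w ^+ 2 + g w ^+ 2) + 2 * (f w * g w))); last first.
  by apply/funext => w; ring.
by apply: L1D; [exact: L1D|apply: L1Z; exact: sqint_L1M].
Qed.

Lemma sqintZ c f : sqint f -> sqint (fun w => c * f w).
Proof.
move=> [mf f2]; split; first exact: measurable_funM.
rewrite [X in L1 X](_ : _ = (fun w => c ^+ 2 * f w ^+ 2)); first exact: L1Z.
by apply/funext => w; rewrite exprMn.
Qed.

Lemma sqintB f g : sqint f -> sqint g -> sqint (fun w => f w - g w).
Proof.
move=> sf /(sqintZ (-1)) sg.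
rewrite [X in sqint X](_ : _ = (fun w => f w + (-1) * g w)); first exact: sqintD.
by apply/funext => w; rewrite mulN1r.
Qed.

Lemma sqint_bounded c f : measurable_fun setT f -> (forall w, `|f w| <= c) -> sqint f.
Proof.
move=> mf fc; split => //; apply: (@L1_le _ (fun=> c ^+ 2)).
- exact: measurable_funX.
- exact: L1_cst.
- move=> w; rewrite !normrX lerXn2r ?nnegrE//.
  exact: le_trans (fc w) (ler_norm _).
Qed.

Lemma sqint_L1 f : sqint f -> L1 f.
Proof.
move=> sf; rewrite [X in L1 X](_ : _ = (fun w => f w * 1)).
  by apply: sqint_L1M => //; apply: (@sqint_bounded 1) => // w; rewrite normr1.
by apply/funext => w; rewrite mulr1.
Qed.

Definition meansq f : R := \int[P]_w (f w ^+ 2).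

Lemma meansq_ge0 f : 0 <= meansq f.
Proof. by apply: Rintegral_ge0 => w _; exact: sqr_ge0. Qed.

Lemma meansq_bounded c f : measurable_fun setT f -> (forall w, `|f w| <= c) ->
  meansq f <= c ^+ 2.
Proof.
move=> mf fc; have [_ L1f] := sqint_bounded mf fc.
apply: (@le_trans _ _ (\int[P]_w (c ^+ 2))).
  apply: le_Rintegral => //; first exact: L1_cst.
  move=> w _; rewrite -(real_normK (num_real (f w))) lerXn2r ?nnegrE//.
  exact: le_trans (fc w).
by rewrite Rintegral_cst// [X in fine X]probability_setT mulr1.
Qed.

(** The difference of the two sides is the mean of (e f - g)^2 / e. With [e] the length of a time
    step, the main term is only multiplied by 1 + e, a factor that stays bounded when iterated over
    all steps. *)
Lemma meansqD_weighted e f g : 0 < e -> sqint f -> sqint g ->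
  meansq (fun w => f w + g w) <= (1 + e) * meansq f + (1 + e^-1) * meansq g.
Proof.
move=> e0 sf sg; rewrite /meansq -!RintegralZl//; [|exact: sg.2|exact: sf.2].
rewrite -RintegralD//; [|exact: L1Z sf.2|exact: L1Z sg.2].
apply: le_Rintegral => //.
- exact: (sqintD sf sg).2.
- exact: (L1D (L1Z _ sf.2) (L1Z _ sg.2)).
move=> w _; rewrite -subr_ge0.
rewrite (_ : _ - _ = (e * f w - g w) ^+ 2 / e); first by rewrite divr_ge0 ?sqr_ge0 ?ltW.
by field; exact: lt0r_neq0.
Qed.

Lemma meansqD3 f g h : sqint f -> sqint g -> sqint h ->
  meansq (fun w => f w + g w + h w) <= 3 * (meansq f + meansq g + meansq h).
Proof.
move=> sf sg sh; have [f2 g2 h2] := And3 sf.2 sg.2 sh.2.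
rewrite /meansq -!RintegralD//; [|exact: L1D f2 g2].
rewrite -RintegralZl//; last exact: (L1D (L1D f2 g2) h2).
apply: le_Rintegral => //.
- exact: (sqintD (sqintD sf sg) sh).2.
- exact: (L1Z _ (L1D (L1D f2 g2) h2)).
move=> w _; have := sqr_ge0 (f w - g w); have := sqr_ge0 (f w - h w).
have := sqr_ge0 (g w - h w); nra.
Qed.

Lemma measurable_ge_abs e f : measurable_fun setT f ->
  measurable [set w | e <= `|f w|].
Proof.
move=> mf; have mnf : measurable_fun setT (fun w => `|f w|).
  exact: measurableT_comp.
rewrite (_ : [set _ | _] = setT `&` (fun w => `|f w|) @^-1` `[e, +oo[%classic).
  exact: mnf.
by apply/seteqP; split => w /=; rewrite in_itv/= andbT; [split|case].
Qed.

Lemma chebyshev_meansq e f : 0 < e -> sqint f ->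
  (P [set w | (e <= `|f w|)%R] <= (e^-2 * meansq f)%:E)%E.
Proof.
move=> e0 [mf f2].
have mA : measurable [set w | e <= `|f w|].
  exact: measurable_ge_abs.
rewrite EFinM /meansq -L1_EFin//.
have me : 0 <= e ^- 2 by rewrite invr_ge0 exprn_ge0 ?ltW.
have mf2 : measurable_fun setT (fun w => (f w ^+ 2)%:E).
  by apply/measurable_EFinP; exact: measurable_funX.
rewrite -ge0_integralZl_EFin//; last by move=> w _; rewrite lee_fin sqr_ge0.
rewrite -[P _]mul1e -[(1 * _)%E](integral_cst P mA 1).
apply: (@le_trans _ _ (\int[P]_(w in [set w | (e <= `|f w|)%R]) ((e ^- 2)%:E * (f w ^+ 2)%:E))%E).
  apply: ge0_le_integral => //.
  - by apply: measurable_funTS; apply/measurable_EFinP; apply: measurable_funM => //; exact: measurable_funX.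
  - move=> w /= ew; rewrite -EFinM lee_fin mulrC ler_pdivlMr ?exprn_gt0// mul1r.
    rewrite -(real_normK (num_real (f w))) lerXn2r ?nnegrE//.
    by rewrite ltW.
apply: ge0_subset_integral => //.
- by apply/measurable_EFinP; apply: measurable_funM => //; exact: measurable_funX.
- by move=> w _; rewrite -EFinM lee_fin mulr_ge0 ?sqr_ge0// invr_ge0 exprn_ge0 ?ltW.
Qed.

End square_integrable.

Section martingale_differences.
Context {d : measure_display} {Omega : measurableType d} {R : realType}.
Variable P : probability Omega R.
Implicit Types f g X Y Z N : Omega -> R.
Implicit Types G : set (set Omega).

Section independence.
Variables (G : set (set Omega)) (X : Omega -> R).
Hypotheses (sG : sigma_algebra setT G) (Gm : G `<=` measurable).
Hypotheses (mX : measurable_fun setT X) (iX : indep_of P G X).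

Lemma indep_ge0_L1M Y (f : R -> R) :
  measurable_wrt G Y -> measurable_fun setT f ->
  (forall w, 0 <= Y w) -> (forall x, 0 <= f x) ->
  L1 P Y -> L1 P (f \o X) ->
  L1 P (fun w => Y w * f (X w)) /\
  \int[P]_w (Y w * f (X w)) = \int[P]_w Y w * \int[P]_w f (X w).
Proof.
move=> mY mf Y0 f0 LY Lf.
have := indep_ge0_integralM sG Gm mX iX mY mf Y0 f0.
rewrite (L1_EFin LY) (L1_EFin Lf) -EFinM => EM; split; last by rewrite /Rintegral EM.
apply: L1_ge0.
- apply: measurable_funM; first exact: sub_measurable_fun mY.
  exact: measurableT_comp mf mX.
- by move=> w; rewrite mulr_ge0.
- by rewrite EM ltry.
Qed.

(** Positive and negative parts of both factors reduce this to the nonnegative case; the four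
    products are recombined by linearity. *)
Lemma indep_L1M Y (f : R -> R) :
  measurable_wrt G Y -> measurable_fun setT f ->
  L1 P Y -> L1 P (f \o X) ->
  \int[P]_w (Y w * f (X w)) = \int[P]_w Y w * \int[P]_w f (X w).
Proof.
move=> mY mf LY Lf.
pose Yp w := Num.max (Y w) 0; pose Yn w := Num.max (- Y w) 0.
pose fp x := Num.max (f x) 0; pose fn x := Num.max (- f x) 0.
have YE w : Y w = Yp w - Yn w.
  by rewrite /Yp /Yn /Num.max; case: ifPn; case: ifPn; rewrite ?oppr_lt0 -?leNgt; lra.
have fE x : f x = fp x - fn x.
  by rewrite /fp /fn /Num.max; case: ifPn; case: ifPn; rewrite ?oppr_lt0 -?leNgt; lra.
have mYG : measurable_fun [set: g_sigma_algebraType G] Y by apply/measurable_wrtP.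
have mYp : measurable_wrt G Yp by apply/measurable_wrtP => //; exact: measurable_maxr.
have mYn : measurable_wrt G Yn.
  by apply/measurable_wrtP => //; apply: measurable_maxr => //; exact: measurableT_comp.
have mfp : measurable_fun setT fp by exact: measurable_maxr.
have mfn : measurable_fun setT fn by apply: measurable_maxr => //; exact: measurableT_comp.
have max_le (x : R) : `|Num.max x 0| <= `|x|.
  by rewrite /Num.max; case: ifPn => _; rewrite ?normr0.
have LYp : L1 P Yp.
  by apply: (L1_le (sub_measurable_fun sG Gm mYp) LY) => w; exact: max_le.
have LYn : L1 P Yn.
  apply: (L1_le (sub_measurable_fun sG Gm mYn) LY) => w.
  by rewrite -[leRHS]normrN; exact: max_le.
have Lfp : L1 P (fp \o X).
  by apply: (L1_le (measurableT_comp mfp mX) Lf) => w; exact: max_le.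
have Lfn : L1 P (fn \o X).
  apply: (L1_le (measurableT_comp mfn mX) Lf) => w.
  by rewrite -[leRHS]normrN; exact: max_le.
have max_ge0 (x : R) : 0 <= Num.max x 0 by rewrite le_max lexx orbT.
have [L1pp Epp] := indep_ge0_L1M mYp mfp (fun w => max_ge0 _) (fun x => max_ge0 _) LYp Lfp.
have [L1pn Epn] := indep_ge0_L1M mYp mfn (fun w => max_ge0 _) (fun x => max_ge0 _) LYp Lfn.
have [L1np Enp] := indep_ge0_L1M mYn mfp (fun w => max_ge0 _) (fun x => max_ge0 _) LYn Lfp.
have [L1nn Enn] := indep_ge0_L1M mYn mfn (fun w => max_ge0 _) (fun x => max_ge0 _) LYn Lfn.
transitivity (\int[P]_w ((Yp w * fp (X w) - Yp w * fn (X w)) -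
                         (Yn w * fp (X w) - Yn w * fn (X w)))).
  by apply: eq_Rintegral => w _; rewrite YE fE; ring.
rewrite RintegralB//; [|exact: L1B L1pp L1pn|exact: L1B L1np L1nn].
rewrite !RintegralB// Epp Epn Enp Enn.
rewrite (_ : \int[P]_w Y w = \int[P]_w Yp w - \int[P]_w Yn w); last first.
  by rewrite -RintegralB//; apply: eq_Rintegral => w _; rewrite YE.
rewrite (_ : \int[P]_w f (X w) = \int[P]_w fp (X w) - \int[P]_w fn (X w)); last first.
  by rewrite -RintegralB//; apply: eq_Rintegral => w _; rewrite fE.
by ring.
Qed.

End independence.

(* Orthogonality to all square integrable G-measurable variables, i.e.
   E[N | G] = 0. *)
Definition orthog G N := sqint P N /\
  forall Y, measurable_wrt G Y -> sqint P Y -> \int[P]_w (Y w * N w) = 0.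

Lemma orthogD G N N' : orthog G N -> orthog G N' -> orthog G (fun w => N w + N' w).
Proof.
move=> [sN oN] [sN' oN']; split; first exact: sqintD.
move=> Y mY sY; rewrite -[RHS]addr0 -{1}(oN Y)// -{1}(oN' Y)//.
rewrite -RintegralD//; [|exact: sqint_L1M|exact: sqint_L1M].
by apply: eq_Rintegral => w _; rewrite mulrDr.
Qed.

Lemma orthogS G G' N : G `<=` G' -> orthog G' N -> orthog G N.
Proof. by move=> GG' [sN oN]; split=> // Y mY; apply: oN => B mB; exact/GG'/mY. Qed.

(** Pythagoras: the cross term pairs [N] with a square integrable variable known to [G]. *)
Lemma orthog_meansqD G Y N : measurable_wrt G Y -> sqint P Y -> orthog G N ->
  meansq P (fun w => Y w + N w) = meansq P Y + meansq P N.
Proof.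
move=> mY sY [sN oN]; have LYN := sqint_L1M sY sN.
transitivity (\int[P]_w ((Y w ^+ 2 + N w ^+ 2) + 2 * (Y w * N w))).
  by apply: eq_Rintegral => w _; ring.
rewrite RintegralD//; [|exact: L1D sY.2 sN.2|exact: L1Z].
by rewrite RintegralZl// oN// mulr0 addr0 RintegralD//; [exact: sY.2|exact: sN.2].
Qed.

Lemma indep_sqintM G X Y (f : R -> R) :
  sigma_algebra setT G -> G `<=` measurable ->
  measurable_fun setT X -> indep_of P G X ->
  measurable_wrt G Y -> measurable_fun setT f ->
  sqint P Y -> sqint P (f \o X) ->
  sqint P (fun w => Y w * f (X w)) /\
  meansq P (fun w => Y w * f (X w)) = meansq P Y * meansq P (f \o X).
Proof.
move=> sG Gm mX iX mY mf sY sf.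
have [] := @indep_ge0_L1M G X sG Gm mX iX (fun w => Y w ^+ 2) (fun x => f x ^+ 2).
- have mYG : measurable_fun [set: g_sigma_algebraType G] Y by apply/measurable_wrtP.
  by apply/measurable_wrtP => //; exact: measurable_funX.
- exact: measurable_funX.
- by move=> w; exact: sqr_ge0.
- by move=> x; exact: sqr_ge0.
- exact: sY.2.
- exact: sf.2.
move=> LL EE; split.
- split.
    apply: measurable_funM; first exact: sY.1.
    exact: measurableT_comp mf mX.
  rewrite [X in L1 P X](_ : _ = (fun w => Y w ^+ 2 * f (X w) ^+ 2))//.
  by apply/funext => w; rewrite exprMn.
- by rewrite /meansq -EE; apply: eq_Rintegral => w _; rewrite exprMn.
Qed.

(** A test variable [Z] enters only through the product of [Z] and [Y], which is integrable and
    known to [G]; independence then leaves the vanishing mean as a factor. *)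
Lemma indep_orthog G X Y (f : R -> R) :
  sigma_algebra setT G -> G `<=` measurable ->
  measurable_fun setT X -> indep_of P G X ->
  measurable_wrt G Y -> measurable_fun setT f ->
  sqint P Y -> sqint P (f \o X) -> \int[P]_w f (X w) = 0 ->
  orthog G (fun w => Y w * f (X w)).
Proof.
move=> sG Gm mX iX mY mf sY sf f0.
split; first by apply: (indep_sqintM sG Gm mX iX mY mf sY sf).1.
move=> Z mZ sZ.
under eq_Rintegral do rewrite mulrA.
rewrite (@indep_L1M G X sG Gm mX iX (fun w => Z w * Y w) f)//.
- by rewrite f0 mulr0.
- apply/measurable_wrtP => //; apply: measurable_funM; exact/measurable_wrtP.
- exact: sqint_L1M.
- exact: sqint_L1.
Qed.

End martingale_differences.

(** * Moments of Gaussian increments from exponential moments *)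

Section exponential_bounds.
Context {R : realType}.
Implicit Types x y z : R.

Lemma eqr_le x y : x = y -> x <= y.
Proof. by move=> ->. Qed.

Lemma expR_norm_le x : expR `|x| <= expR x + expR (- x).
Proof.
have := expR_gt0 x; have := expR_gt0 (- x).
by have [x0|x0] := ler0P x; lra.
Qed.

(** From y <= exp y at y = |x| / n, raised to the power n. Bounds on moments of Gaussian variables
    thereby follow from [gaussian_expR] alone. *)
Lemma norm_expn_le n x : `|x| ^+ n <= n%:R ^+ n * (expR x + expR (- x)).
Proof.
apply: le_trans (ler_wpM2l _ (expR_norm_le x)); last by rewrite exprn_ge0.
case: n => [|n]; first by rewrite !expr0 mul1r -[leLHS]expR0 ler_expR.
have n0 : 0 < n.+1%:R :> R by rewrite ltr0n.
rewrite (_ : `|x| = n.+1%:R * (`|x| / n.+1%:R)); last first.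
  by rewrite mulrCA divff ?mulr1// gt_eqF.
rewrite exprMn ler_wpM2l// ?exprn_ge0//.
rewrite expRM_natl lerXn2r ?nnegrE ?divr_ge0 ?expR_ge0//.
by apply: le_trans (expR_ge1Dx _); rewrite lerDr.
Qed.

(** The tangent inequality at z and at -z gives 0 <= exp z - 1 - z <= z (exp z - 1). Applied once
    more, it bounds the right side by z^2 exp z for z >= 0 and by z^2 for z < 0. *)
Lemma norm_expR_sub_le z : `|expR z - 1 - z| <= z ^+ 2 * expR `|z|.
Proof.
have h1 := expR_ge1Dx z; have h2 := expR_ge1Dx (- z).
have e0 := expR_gt0 z.
have h3 : expR z - z * expR z <= 1.
  have := ler_wpM2l (ltW e0) h2.
  by rewrite expRN mulfV ?gt_eqF//; lra.
have e1 : 1 <= expR `|z| by rewrite -[leLHS]expR0 ler_expR.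
rewrite ger0_norm; last lra.
have [z0|z0] := lerP 0 z.
  have h4 : z * (expR z - 1) <= z * (z * expR z) by apply: ler_wpM2l => //; lra.
  by rewrite (ger0_norm z0) expr2 -mulrA; lra.
have : z * (expR z - 1) <= z ^+ 2 by nra.
move=> h4; apply: (@le_trans _ _ (z ^+ 2)); first nra.
by rewrite ler_peMr ?sqr_ge0.
Qed.

End exponential_bounds.

Section gaussian_increment.
Context {d : measure_display} {Omega : measurableType d} {R : realType}.
Variable P : probability Omega R.
Implicit Types X : Omega -> R.

(* The symmetry makes the mean vanish without computing the first moment of
   [normal_prob]. *)
Definition sym_gaussian X (v : R) := [/\ measurable_fun setT X,
  centered_gaussian P X v & centered_gaussian P (fun w => - X w) v].

Variables (X : Omega -> R) (v : R).
Hypothesis gX : sym_gaussian X v.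

Let mX : measurable_fun setT X. Proof. by case: gX. Qed.

Lemma gaussian_L1_expR u : L1 P (fun w => expR (u * X w)).
Proof.
have [_ cX _] := gX.
apply: L1_ge0 => [|w|]; [|exact: expR_ge0|by rewrite (gaussian_expR u mX cX) ltry].
by apply: measurableT_comp => //; exact: measurable_funM.
Qed.

Lemma gaussian_mean_expR u : \int[P]_w expR (u * X w) = expR (u ^+ 2 * v / 2).
Proof. by have [_ cX _] := gX; rewrite /Rintegral (gaussian_expR u mX cX). Qed.

Lemma gaussian_sqint_expR u : sqint P (fun w => expR (u * X w)).
Proof.
split; first exact: L1_meas (gaussian_L1_expR u).
rewrite [Y in L1 P Y](_ : _ = (fun w => expR (2 * u * X w))).
  exact: gaussian_L1_expR.
by apply/funext => w; rewrite -expRM_natl mulrA.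
Qed.

Hypothesis v0 : 0 < v.
Let s := Num.sqrt v.
Let s0 : 0 < s. Proof. by rewrite sqrtr_gt0. Qed.
Let ssq : s ^+ 2 = v. Proof. by rewrite sqr_sqrtr// ltW. Qed.

Lemma gaussian_sqint : sqint P X.
Proof.
split => //; apply: (@L1_le _ _ _ _ _ (fun w => 2 ^+ 2 * (expR (1 * X w) + expR (- 1 * X w)))).
- exact: measurable_funX.
- by apply: L1Z; apply: L1D; exact: gaussian_L1_expR.
- move=> w; rewrite [leRHS]ger0_norm ?mulr_ge0 ?addr_ge0 ?expR_ge0//.
  by rewrite normrX mul1r mulN1r; exact: norm_expn_le.
Qed.

Lemma gaussian_mean : \int[P]_w X w = 0.
Proof.
have [_ cX cNX] := gX.
have mNX : measurable_fun setT (fun w => - X w) by exact: measurableT_comp.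
pose f (x : R) := Num.max x 0.
have mf : measurable_fun setT f by exact: measurable_maxr.
have f0 x : 0 <= f x by rewrite le_max lexx orbT.
have EE : \int[P]_w f (X w) = \int[P]_w f (- X w).
  rewrite /Rintegral (gaussian_ge0_integral mX cX mf f0).
  by rewrite (gaussian_ge0_integral mNX cNX mf f0).
have LX := sqint_L1 gaussian_sqint.
have fle x : `|f x| <= `|x|.
  by rewrite /f /Num.max; case: ifPn => _; rewrite ?normr0.
have L1a : L1 P (fun w => f (X w)) by apply: (L1_le _ LX) => //; exact: measurableT_comp.
have L1b : L1 P (fun w => f (- X w)).
  apply: (L1_le _ LX) => //; first exact: measurableT_comp.
  by move=> w; rewrite -[leRHS]normrN.
transitivity (\int[P]_w (f (X w) - f (- X w))).
  apply: eq_Rintegral => w _; rewrite /f /Num.max.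
  by case: ifPn; case: ifPn; rewrite ?oppr_lt0 -?leNgt; lra.
by rewrite RintegralB// EE subrr.
Qed.

(** Scaling by the standard deviation s in [norm_expn_le] gives x^2 <= 4 v (exp(x / s) + exp(-x /
    s)), and each exponential has mean exp(1/2). Only the order v matters later, so this constant
    stands in for the exact variance. *)
Lemma gaussian_meansq_le : meansq P X <= 8 * expR 2^-1 * v.
Proof.
apply: (@le_trans _ _ (\int[P]_w (4 * v * (expR (s^-1 * X w) + expR (- s^-1 * X w))))).
  apply: le_Rintegral => //; first exact: gaussian_sqint.2.
    by apply: L1Z; apply: L1D; exact: gaussian_L1_expR.
  move=> w _; have := norm_expn_le 2 (s^-1 * X w).
  rewrite normrM exprMn !real_normK ?num_real// mulNr exprVn ssq.
  rewrite mulrC ler_pdivrMr// => h.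
  rewrite (_ : 4 * v * _ = 2 ^+ 2 * (expR (s^-1 * X w) + expR (- (s^-1 * X w))) * v)//.
  by ring.
rewrite RintegralZl//; last by apply: L1D; exact: gaussian_L1_expR.
rewrite RintegralD//; [|exact: gaussian_L1_expR|exact: gaussian_L1_expR].
rewrite !gaussian_mean_expR sqrrN exprVn ssq mulVf ?gt_eqF// mul1r.
by apply: eqr_le; ring.
Qed.

Variables (sigma V : R).
Hypothesis vV : v <= V.

Definition expmart x := expR (sigma * x - sigma ^+ 2 * v / 2).

Lemma expmartE x : expmart x = expR (- (sigma ^+ 2 * v / 2)) * expR (sigma * x).
Proof. by rewrite /expmart addrC expRD. Qed.

Lemma expmart_sqint : sqint P (expmart \o X).
Proof.
rewrite [Y in sqint P Y](_ : _ = (fun w => expR (- (sigma ^+ 2 * v / 2)) * expR (sigma * X w))).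
  exact/sqintZ/gaussian_sqint_expR.
by apply/funext => w; rewrite /= expmartE.
Qed.

Lemma expmart_mean : \int[P]_w expmart (X w) = 1.
Proof.
under eq_Rintegral do rewrite expmartE.
rewrite RintegralZl//; last exact: gaussian_L1_expR.
by rewrite gaussian_mean_expR -expRD addNr expR0.
Qed.

Lemma expmart_meansq : meansq P (expmart \o X) = expR (sigma ^+ 2 * v).
Proof.
rewrite /meansq; transitivity (\int[P]_w (expR (- (sigma ^+ 2 * v)) * expR (2 * sigma * X w))).
  by apply: eq_Rintegral => w _; rewrite /= /expmart -expRM_natl -expRD; congr expR; field.
rewrite RintegralZl//; last exact: gaussian_L1_expR.
by rewrite gaussian_mean_expR -expRD; congr expR; field.
Qed.

(** The part of the exponential factor beyond the Euler factor 1 + sigma x. It is centred with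
    second moment of order v^2, so that over t / v steps the accumulated mean square is only of
    order v. *)
Definition expmart_rem x := expmart x - 1 - sigma * x.

Lemma expmart_rem_sqint : sqint P (expmart_rem \o X).
Proof.
apply: sqintB; last exact/sqintZ/gaussian_sqint.
apply: sqintB; first exact: expmart_sqint.
by apply: (@sqint_bounded _ _ _ _ 1) => // w; rewrite normr1.
Qed.

Lemma expmart_rem_mean : \int[P]_w expmart_rem (X w) = 0.
Proof.
have L1y := sqint_L1 expmart_sqint; have LX := sqint_L1 gaussian_sqint.
rewrite RintegralB//; [|exact: L1B L1y (L1_cst P 1)|exact: L1Z].
rewrite RintegralB//; [|exact: L1_cst].
rewrite expmart_mean RintegralZl// gaussian_mean mulr0 subr0.
by rewrite Rintegral_cst// [Y in fine Y]probability_setT mul1r subrr.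
Qed.

(* 514 = 2 * 4 ^ 4 + 2, from (z ^ 2 + c) ^ 2 <= 2 z ^ 4 + 2 c ^ 2 and
   [norm_expn_le] for n = 4. *)
Lemma expmart_rem_le x : expmart_rem x ^+ 2 <=
  514 * sigma ^+ 4 * v ^+ 2 *
  ((expR (s^-1 * x) + expR (- (s^-1 * x))) *
   (expR (2 * sigma * x) + expR (- (2 * sigma * x)))).
Proof.
set z := sigma * x; set c := sigma ^+ 2 * v / 2.
have c0 : 0 <= c by rewrite /c divr_ge0// mulr_ge0 ?sqr_ge0// ltW.
have ec1 : expR (- c) <= 1 by rewrite -[leRHS]expR0 ler_expR oppr_le0.
have ec2 := expR_ge1Dx (- c).
have ez : expR z <= expR `|z| by rewrite ler_expR ler_norm.
have ez0 := expR_gt0 z.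
have h1 := norm_expR_sub_le z.
have eta_le : `|expmart_rem x| <= (z ^+ 2 + c) * expR `|z|.
  rewrite /expmart_rem /expmart -/z -/c expRD.
  (* A Taylor remainder at z plus the effect of the compensator c; the latter is at most c exp |z|,
     since 1 - exp(-c) <= c. *)
  rewrite (_ : _ - _ - _ = (expR z - 1 - z) - expR z * (1 - expR (- c))); last by ring.
  apply: le_trans (ler_normB _ _) _; rewrite mulrDl lerD//.
  rewrite normrM (ger0_norm (ltW ez0)) ger0_norm; last lra.
  have hc : 1 - expR (- c) <= c by lra.
  have hc0 : 0 <= 1 - expR (- c) by lra.
  by rewrite mulrC ler_pM// ltW.
rewrite -(real_normK (num_real (expmart_rem x))).
apply: (@le_trans _ _ (((z ^+ 2 + c) * expR `|z|) ^+ 2)).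
  by rewrite lerXn2r ?nnegrE// mulr_ge0 ?expR_ge0// addr_ge0// sqr_ge0.
rewrite exprMn.
set A := expR (s^-1 * x) + _; set B := expR (2 * sigma * x) + _.
have A0 : 0 < A by rewrite addr_gt0 ?expR_gt0.
have eB : expR `|z| ^+ 2 <= B.
  rewrite -expRM_natl (_ : 2 * `|z| = `|2 * sigma * x|); last first.
    by rewrite -[in RHS]mulrA -/z [RHS]normrM ger0_norm.
  exact: expR_norm_le.
have z4 : z ^+ 4 <= 256 * sigma ^+ 4 * v ^+ 2 * A.
  have := norm_expn_le 4 (s^-1 * x); rewrite -/A.
  have e4 (y : R) : `|y| ^+ 4 = y ^+ 4.
    by rewrite (_ : 4 = 2 * 2)%N// !exprM real_normK ?num_real.
  rewrite e4 exprMn exprVn (_ : s ^+ 4 = v ^+ 2); last by rewrite -ssq -exprM.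
  rewrite mulrC ler_pdivrMr ?exprn_gt0// => h.
  rewrite /z exprMn.
  have s4 : 0 <= sigma ^+ 4 by rewrite (_ : 4 = 2 * 2)%N// exprM sqr_ge0.
  apply: le_trans (ler_wpM2l s4 h) _; apply: eqr_le; ring.
have A1 : 1 <= A.
  have := expR_norm_le (s^-1 * x); rewrite -/A; apply: le_trans.
  by rewrite -[leLHS]expR0 ler_expR.
have cA : c ^+ 2 <= sigma ^+ 4 * v ^+ 2 * A.
  rewrite (_ : c ^+ 2 = (sigma ^+ 2 * v) ^+ 2 / 4); last by rewrite /c; field.
  rewrite (_ : sigma ^+ 4 * v ^+ 2 = (sigma ^+ 2 * v) ^+ 2); last by ring.
  have := sqr_ge0 (sigma ^+ 2 * v); nra.
rewrite (_ : _ * (A * B) = (514 * sigma ^+ 4 * v ^+ 2 * A) * B); last by ring.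
apply: ler_pM; rewrite ?sqr_ge0//.
have := sqr_ge0 (z ^+ 2 - c).
rewrite (_ : z ^+ 4 = z ^+ 2 ^+ 2) in z4; last by rewrite -exprM.
nra.
Qed.

(** Expanding the product in [expmart_rem_le] gives four exponentials exp(u X) with u s = +-1 +- 2
    sigma s, and (u s)^2 / 2 <= 1 + 4 sigma^2 v for each; hence 2056 = 4 times 514. Replacing v by
    the bound [V] makes the constant the same for all steps. *)
Lemma expmart_rem_meansq :
  meansq P (expmart_rem \o X) <= 2056 * sigma ^+ 4 * expR (1 + 4 * sigma ^+ 2 * V) * v ^+ 2.
Proof.
have V0 : 0 < V by exact: lt_le_trans vV.
pose F u w := expR (u * X w).
have LF u : L1 P (F u) := gaussian_L1_expR u.
apply: (@le_trans _ _ (\int[P]_w (514 * sigma ^+ 4 * v ^+ 2 *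
  ((F (s^-1 + 2 * sigma) w + F (s^-1 - 2 * sigma) w) +
   (F (- s^-1 + 2 * sigma) w + F (- s^-1 - 2 * sigma) w))))).
  apply: le_Rintegral => //; first exact: expmart_rem_sqint.2.
    by apply: L1Z; apply: L1D; exact: L1D.
  move=> w _; apply: le_trans (expmart_rem_le _) _.
  have FE a b : F (a + b) w = expR (a * X w) * expR (b * X w) by rewrite /F mulrDl expRD.
  by apply: eqr_le; rewrite !FE -!mulNr; ring.
rewrite RintegralZl//; last by apply: L1D; exact: L1D.
rewrite !RintegralD//; try by [exact: L1D|exact: LF].
rewrite !gaussian_mean_expR.
have bnd e : e ^+ 2 = 1 -> forall u, u = e * s^-1 + 2 * sigma \/ u = e * s^-1 - 2 * sigma ->
    expR (u ^+ 2 * v / 2) <= expR (1 + 4 * sigma ^+ 2 * V).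
  move=> e1 u hu; rewrite ler_expR.
  have -> : u ^+ 2 * v / 2 = (u * s) ^+ 2 / 2 by rewrite exprMn ssq.
  apply: (@le_trans _ _ (1 + 4 * sigma ^+ 2 * v)); last first.
    by rewrite lerD2l ler_wpM2l// mulr_ge0// sqr_ge0.
  have ss : s^-1 * s = 1 by rewrite mulVf// gt_eqF.
  case: hu => ->; rewrite ?mulrDl ?mulrBl -mulrA ss mulr1 -ssq.
    by have := sqr_ge0 (e - 2 * sigma * s); nra.
  by have := sqr_ge0 (e + 2 * sigma * s); nra.
have e1 : (1 : R) ^+ 2 = 1 by rewrite expr1n.
have eN1 : (-1 : R) ^+ 2 = 1 by rewrite sqrrN expr1n.
have b1 := bnd 1 e1 (s^-1 + 2 * sigma) (or_introl _).
have b2 := bnd 1 e1 (s^-1 - 2 * sigma) (or_intror _).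
have b3 := bnd (-1) eN1 (- s^-1 + 2 * sigma) (or_introl _).
have b4 := bnd (-1) eN1 (- s^-1 - 2 * sigma) (or_intror _).
have {}b1 := b1 ltac:(by rewrite mul1r).
have {}b2 := b2 ltac:(by rewrite mul1r).
have {}b3 := b3 ltac:(by rewrite mulN1r).
have {}b4 := b4 ltac:(by rewrite mulN1r).
set E := expR (1 + _) in b1 b2 b3 b4 *.
have s4 : 0 <= 514 * sigma ^+ 4 * v ^+ 2.
  rewrite mulr_ge0 ?sqr_ge0// mulr_ge0//.
  by rewrite (_ : 4 = 2 * 2)%N// exprM sqr_ge0.
rewrite (_ : 2056 * _ * _ * _ = 514 * sigma ^+ 4 * v ^+ 2 * (E + E + (E + E))); last by ring.
by rewrite ler_wpM2l// !lerD.
Qed.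

End gaussian_increment.

(** * Riemann and Stieltjes sums of continuous paths *)

Section paths.
Context {R : realType}.
Local Notation mu := (@lebesgue_measure R).
Implicit Types (a b x y z c e : R) (f g : R -> R).

Definition cont_on a b f := {within `[a, b], continuous f}.

Lemma cont_onS a b x y f : a <= x -> y <= b -> cont_on a b f -> cont_on x y f.
Proof.
move=> ax yb; apply: continuous_subspaceW => z /=; rewrite !in_itv/= => /andP[xz zy].
by rewrite (le_trans ax xz) (le_trans zy yb).
Qed.

Lemma cont_onD a b f g : cont_on a b f -> cont_on a b g -> cont_on a b (fun s => f s + g s).
Proof. by move=> cf cg x; apply: cvgD; [exact: cf|exact: cg]. Qed.

Lemma cont_onM a b f g : cont_on a b f -> cont_on a b g -> cont_on a b (fun s => f s * g s).
Proof. by move=> cf cg x; apply: cvgM; [exact: cf|exact: cg]. Qed.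

Lemma cont_on_cst a b c : cont_on a b (fun=> c).
Proof. by move=> x; exact: cvg_cst. Qed.

Arguments cont_on_cst : clear implicits.

Lemma cont_on_continuous a b f : continuous f -> cont_on a b f.
Proof. exact: continuous_subspaceT. Qed.

(** Compactness of the segment in the form of near coverings. The radius is halved so that x' close
    to x, and y close to x', are both within the modulus of continuity at x. *)
Lemma cont_on_unif a b f e : cont_on a b f -> 0 < e ->
  exists2 dlt, 0 < dlt &
  forall x y, x \in `[a, b] -> y \in `[a, b] -> `|x - y| < dlt -> `|f x - f y| < e.
Proof.
move=> /subspace_continuousP cf e0.
have /compact_near_coveringP/near_covering_withinP := @segment_compact R a b.
move=> /(_ R (0^'+) (fun i x => forall y, y \in `[a, b] -> `|x - y| < i -> `|f x - f y| < e)).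
have h : forall x, `[a, b]%classic x -> \forall x' \near x & i \near 0^'+,
    `[a, b]%classic x' -> forall y, y \in `[a, b] -> `|x' - y| < i -> `|f x' - f y| < e.
  move=> x abx; have /cvgrPdist_lt/(_ (e / 2)) := cf x abx.
  rewrite divr_gt0// => /(_ isT); rewrite near_withinE => -[dlt /= dlt0 hd].
  exists (ball x (dlt / 2), [set i | i < dlt / 2]).
    split => /=; first by exists (dlt / 2) => //=; rewrite divr_gt0.
    by apply: nbhs_right_lt; rewrite divr_gt0.
  move=> [x' i] [/= xx' idlt] abx' y aby x'y.
  have xx'2 : `|x - x'| < dlt / 2 by [].
  have h1 : `|f x - f x'| < e / 2.
    by apply: hd => //=; apply: (lt_trans xx'2); rewrite ltr_pdivrMr// ltr_pMr// ltr1n.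
  have h2 : `|f x - f y| < e / 2.
    apply: hd => //=; rewrite (_ : x - y = (x - x') + (x' - y)); last by ring.
    apply: le_lt_trans (ler_normD _ _) _; rewrite [ltRHS]splitr ltrD//.
    exact: lt_trans x'y idlt.
  rewrite (_ : f x' - f y = (f x' - f x) + (f x - f y)); last by ring.
  apply: le_lt_trans (ler_normD _ _) _; rewrite [ltRHS]splitr ltrD//.
  by rewrite distrC.
move=> /(_ _ h) hh.
have : \forall i \near 0^'+, 0 < i /\ (`[a, b]%classic `<=` (fun x => forall y, y \in `[a, b] -> `|x - y| < i -> `|f x - f y| < e)).
  by apply: filterI => //; exact: nbhs_right_gt.
move=> /filter_ex[i [i0 hi]].
by exists i => // x y xab yab; exact: hi.
Qed.

Lemma cont_on_bounded a b f : cont_on a b f ->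
  exists2 M, 0 < M & forall x, x \in `[a, b] -> `|f x| <= M.
Proof.
move=> cf; have [ab|ab] := leP a b; last first.
  by exists 1 => // x; rewrite in_itv/= => /andP[ax /(le_trans ax)]; rewrite leNgt ab.
have [c cab cM] := EVT_max ab cf; have [c' c'ab cm] := EVT_min ab cf.
exists (`|f c| + `|f c'| + 1); first by rewrite ltr_wpDl// addr_ge0.
move=> x xab; have h1 := cM x xab; have h2 := cm x xab.
have h3 := ler_norm (f c); have h4 := ler_norm (- f c'); rewrite normrN in h4.
have h5 := normr_ge0 (f c); have h6 := normr_ge0 (f c').
by rewrite ler_norml; apply/andP; split; lra.
Qed.

Lemma cont_on_integrable a b f x y : a <= x -> y <= b -> cont_on a b f ->
  mu.-integrable `[x, y] (EFin \o f).
Proof.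
move=> ax yb cf; apply: continuous_compact_integrable; first exact: segment_compact.
exact: cont_onS cf.
Qed.

Definition itg f x y := \int[mu]_(s in `[x, y]) f s.

Lemma itg_split a b f x y z : cont_on a b f -> a <= x -> x <= y -> y <= z -> z <= b ->
  itg f x z = itg f x y + itg f y z.
Proof.
move=> cf ax xy yz zb.
have h := cont_on_integrable ax zb cf.
have h2 : mu.-integrable `]y, z] (EFin \o f).
  apply: (integrableS _ _ _ (cont_on_integrable ax zb cf)) => //.
  by apply: subset_itvr; rewrite bnd_simp.
rewrite /itg -(@Rintegral_itv_obnd_cbnd _ y (BRight z))//.
rewrite -(@Rintegral_itvB _ _ (BLeft x) (BRight z) y)//; first by rewrite addrC subrK.
Qed.

Lemma itgxx f x : itg f x x = 0.
Proof. by rewrite /itg set_itv1 Rintegral_set1. Qed.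

Lemma itg_cst c x y : x <= y -> itg (fun=> c) x y = c * (y - x).
Proof.
move=> xy; rewrite /itg Rintegral_cst//= lebesgue_measure_itv/= lte_fin.
have [//|] := ltP x y.
by move=> yx; rewrite (@le_anti _ _ x y) ?xy// subrr.
Qed.

Lemma itgD a b f g x y : cont_on a b f -> cont_on a b g -> a <= x -> y <= b ->
  itg (fun s => f s + g s) x y = itg f x y + itg g x y.
Proof. by move=> cf cg ax yb; rewrite /itg RintegralD//; exact: (cont_on_integrable ax yb). Qed.

Lemma itgZ a b c f x y : cont_on a b f -> a <= x -> y <= b ->
  itg (fun s => c * f s) x y = c * itg f x y.
Proof. by move=> cf ax yb; rewrite /itg RintegralZl//; exact: (cont_on_integrable ax yb). Qed.

Lemma eq_itg f g x y : (forall s, x <= s <= y -> f s = g s) -> itg f x y = itg g x y.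
Proof.
move=> fg; apply: eq_Rintegral => s; rewrite inE/= in_itv/=; exact: fg.
Qed.

Lemma itg_norm_le a b f e x y : cont_on a b f -> a <= x -> x <= y -> y <= b ->
  (forall s, x <= s <= y -> `|f s| <= e) -> `|itg f x y| <= e * (y - x).
Proof.
move=> cf ax xy yb fe; have h := cont_on_integrable ax yb cf.
apply: le_trans (le_normr_Rintegral _ h) _ => //.
rewrite -itg_cst//; apply: le_Rintegral => //.
- by have := integrable_norm h; rewrite /comp.
- have hc := cont_on_integrable ax yb (cont_on_cst a b e). exact: hc.
Qed.

Lemma itg_approx a b f c e x y : cont_on a b f -> a <= x -> x <= y -> y <= b ->
  (forall s, x <= s <= y -> `|f s - c| <= e) -> `|itg f x y - c * (y - x)| <= e * (y - x).
Proof.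
move=> cf ax xy yb fe.
have cfc : cont_on a b (fun s => f s + (- c)) by apply: cont_onD => //; exact: cont_on_cst.
rewrite (_ : _ - _ = itg (fun s => f s + (- c)) x y); last first.
  by rewrite (itgD cf (cont_on_cst a b (- c)))// itg_cst// mulNr.
exact: itg_norm_le cfc ax xy yb fe.
Qed.

(** There are [n.+1] cells, so that the step is meaningful for every [n]. *)
Definition grid a b n i : R := a + i%:R * ((b - a) / n.+1%:R).

Lemma grid0 a b n : grid a b n 0 = a.
Proof. by rewrite /grid mul0r addr0. Qed.

Lemma grid_last a b n : grid a b n n.+1 = b.
Proof. by rewrite /grid mulrCA divff ?pnatr_eq0// mulr1 addrC subrK. Qed.

Lemma gridS a b n i : grid a b n i.+1 - grid a b n i = (b - a) / n.+1%:R.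
Proof. by rewrite /grid -natr1; ring. Qed.

Lemma grid_le a b n i j : a <= b -> (i <= j)%N -> grid a b n i <= grid a b n j.
Proof.
by move=> ab ij; rewrite lerD2l ler_wpM2r ?ler_nat// divr_ge0// subr_ge0.
Qed.

Lemma grid_lt a b n i j : a < b -> (i < j)%N -> grid a b n i < grid a b n j.
Proof.
by move=> ab ij; rewrite ltrD2l ltr_pM2r ?ltr_nat// divr_gt0// subr_gt0.
Qed.

Lemma grid_ge a b n i : a <= b -> a <= grid a b n i.
Proof. by move=> ab; rewrite -[leLHS](grid0 a b n); exact: grid_le. Qed.

Lemma grid_leb a b n i : a <= b -> (i <= n.+1)%N -> grid a b n i <= b.
Proof. by move=> ab ij; rewrite -[leRHS](grid_last a b n); exact: grid_le. Qed.

Lemma itg_grid a b f n k : cont_on a b f -> a <= b -> (k <= n.+1)%N ->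
  itg f a (grid a b n k) = \sum_(i < k) itg f (grid a b n i) (grid a b n i.+1).
Proof.
move=> cf ab; elim: k => [|k ih] kn; first by rewrite big_ord0 grid0 itgxx.
rewrite big_ord_recr /= -ih 1?ltnW//; apply: (itg_split cf) => //.
- exact: grid_ge.
- exact: grid_le.
- exact: grid_leb.
Qed.

(** With a = 0 this also serves as the fact that b / (n + 1) tends to 0. *)
Lemma mesh_small a b dlt : 0 < dlt -> \forall n \near \oo, (b - a) / n.+1%:R < dlt.
Proof.
move=> d0; exists (Num.trunc (`|b - a| / dlt)) => // n /= hn.
rewrite ltr_pdivrMr ?ltr0n//; apply: le_lt_trans (ler_norm _) _.
rewrite mulrC -ltr_pdivrMr//.
apply: lt_le_trans (_ : (Num.trunc (`|b - a| / dlt)).+1%:R <= _); last by rewrite ler_nat.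
by rewrite truncnS_gt.
Qed.

(** On each cell, replacing f by its value at the tag costs at most the oscillation of f times the
    bound of g times the length. The tags are arbitrary because summation by parts produces one sum
    with left tags and one with right tags. *)
Lemma stieltjes_sum_cvg a b f g (xi : nat -> nat -> R) :
  a <= b -> cont_on a b f -> cont_on a b g ->
  (forall n i, (i <= n)%N -> grid a b n i <= xi n i <= grid a b n i.+1) ->
  (fun n => \sum_(i < n.+1) f (xi n i) * itg g (grid a b n i) (grid a b n i.+1)) @ \oo
    --> itg (fun s => f s * g s) a b.
Proof.
move=> ab cf cg hxi; apply/cvgrPdist_le => /= e e0.
have [M M0 gM] := cont_on_bounded cg.
(* The summand 1 keeps the denominator positive when a = b. *)
have e'0 : 0 < e / (M * (b - a + 1)) by rewrite divr_gt0// mulr_gt0// ltr_wpDl// subr_ge0.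
have [dlt d0 hd] := cont_on_unif cf e'0.
apply: filterS (mesh_small a b d0) => n hn.
rewrite -{1}(grid_last a b n) (itg_grid (cont_onM cf cg))// -sumrB.
have inab i s : (i < n.+1)%N -> grid a b n i <= s <= grid a b n i.+1 -> s \in `[a, b].
  move=> iN /andP[h1 h2]; rewrite in_itv/=; apply/andP; split.
    exact: le_trans (grid_ge _ _ ab) h1.
  exact: le_trans h2 (grid_leb ab iN).
apply: le_trans (ler_norm_sum _ _ _) _.
apply: (@le_trans _ _ (\sum_(i < n.+1) (e / (M * (b - a + 1))) * M * ((b - a) / n.+1%:R))).
  apply: ler_sum => i _.
  have hi := hxi n i (ltn_ord i : (i <= n)%N).
  set x := grid a b n i; set y := grid a b n i.+1.
  have ax : a <= x by exact: grid_ge.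
  have yb : y <= b by exact: grid_leb.
  have xy : x <= y by exact: grid_le.
  rewrite -(itgZ _ cg)// (_ : _ - _ = itg (fun s => f s * g s + (- f (xi n i)) * g s) x y); last first.
    rewrite (itgD (cont_onM cf cg) (cont_onM (cont_on_cst a b (- f (xi n i))) cg))//.
    by rewrite !(itgZ _ cg)// mulNr.
  rewrite -(gridS a b n i); apply: (itg_norm_le (a := a) (b := b)) => //.
    by apply: cont_onD; [exact: cont_onM|exact: (cont_onM (cont_on_cst _ _ _) cg)].
  move=> s hs; rewrite mulNr -mulrBl normrM.
  have sab := inab i s (ltn_ord i) hs; have xab := inab i _ (ltn_ord i) hi.
  apply: ler_pM => //; last exact: gM.
  apply/ltW/hd => //; apply: le_lt_trans hn.
  rewrite -(gridS a b n i) -/x -/y ler_norml; rewrite -/x -/y in hi.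
  by move: hs hi => /andP[? ?] /andP[? ?]; apply/andP; split; lra.
have n0 : n.+1%:R != 0 :> R by rewrite pnatr_eq0.
have ba : b - a + 1 != 0 by rewrite gt_eqF// ltr_wpDl// subr_ge0.
rewrite sumr_const card_ord -[leLHS]mulr_natr.
rewrite (_ : _ * _ = e * ((b - a) / (b - a + 1))); last first.
  move: n0; set N := n.+1%:R => n0; field.
  by rewrite ba addrC natr1 n0 gt_eqF.
apply: ler_piMr; first exact: ltW.
rewrite ler_pdivrMr ?mul1r ?lerDl ?ltr_wpDl ?subr_ge0//.
Qed.

Lemma riemann_sum_cvg a b f : a <= b -> cont_on a b f ->
  (fun n => \sum_(i < n.+1) f (grid a b n i) * ((b - a) / n.+1%:R)) @ \oo --> itg f a b.
Proof.
move=> ab cf.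
rewrite (_ : itg f a b = itg (fun s => f s * 1) a b); last by apply: eq_itg => s _; rewrite mulr1.
have := stieltjes_sum_cvg (xi := grid a b) ab cf (cont_on_cst a b 1) _.
rewrite (_ : (fun n => _) = (fun n => \sum_(i < n.+1) f (grid a b n i) * ((b - a) / n.+1%:R))).
  by apply => n i ni; rewrite lexx/=; exact: grid_le.
apply/funext => n; apply: eq_bigr => i _; rewrite itg_cst ?mul1r ?gridS//.
exact: grid_le.
Qed.

Lemma itg_FTC2 F f a b : a <= b -> (forall x, is_derive x 1 F (f x)) ->
  continuous f -> itg f a b = F b - F a.
Proof.
move=> ab dF cf; move: ab; rewrite le_eqVlt => /predU1P[->|ab]; first by rewrite itgxx subrr.
have cF : continuous F.
  move=> x; apply/differentiable_continuous/derivable1_diffP.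
  by have := dF x; move=> [].
rewrite /itg /Rintegral (@continuous_FTC2 _ f F a b)//.
- exact: cont_on_continuous.
- split.
  + by move=> x _; have := dF x; move=> [].
  + exact/cvg_at_right_filter/cF.
  + exact/cvg_at_left_filter/cF.
- by move=> x _; rewrite derive1E; have := dF x; move=> [].
Qed.

End paths.

(** * The geometric equation of the index *)

Section filtered.
Context {d : measure_display} {Omega : measurableType d} {R : realType}.
Variables (P : probability Omega R) (tau : R) (F : R -> set (set Omega)).
Hypothesis hF : filtration tau F.
Implicit Types (s t : R) (X Y Z : Omega -> R).

Lemma filtration_sigma s : 0 <= s <= tau -> sigma_algebra setT (F s).
Proof. by move=> hs; have [/(_ s hs)[]] := hF. Qed.

Lemma filtration_meas s : 0 <= s <= tau -> F s `<=` measurable.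
Proof. by move=> hs; have [/(_ s hs)[]] := hF. Qed.

Lemma filtration_mono s t : 0 <= s -> s <= t -> t <= tau -> F s `<=` F t.
Proof. by have [_] := hF; apply. Qed.

Lemma meas_wrt_le s t X : 0 <= s -> s <= t -> t <= tau ->
  measurable_wrt (F s) X -> measurable_wrt (F t) X.
Proof. by move=> s0 st tT mX B mB; apply: (filtration_mono s0 st tT); exact: mX. Qed.

Lemma meas_wrt_meas s X : 0 <= s <= tau -> measurable_wrt (F s) X -> measurable_fun setT X.
Proof. by move=> hs; exact: sub_measurable_fun (filtration_sigma hs) (filtration_meas hs). Qed.

Section fixed_time.
Variable s : R.
Hypothesis hs : 0 <= s <= tau.
Let sG := filtration_sigma hs.

Lemma meas_wrtD X Y : measurable_wrt (F s) X -> measurable_wrt (F s) Y ->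
  measurable_wrt (F s) (fun w => X w + Y w).
Proof.
move=> /(measurable_wrtP _ sG) mX /(measurable_wrtP _ sG) mY.
by apply/(measurable_wrtP _ sG); exact: measurable_funD.
Qed.

Lemma meas_wrtB X Y : measurable_wrt (F s) X -> measurable_wrt (F s) Y ->
  measurable_wrt (F s) (fun w => X w - Y w).
Proof.
move=> /(measurable_wrtP _ sG) mX /(measurable_wrtP _ sG) mY.
by apply/(measurable_wrtP _ sG); exact: measurable_funB.
Qed.

Lemma meas_wrtM X Y : measurable_wrt (F s) X -> measurable_wrt (F s) Y ->
  measurable_wrt (F s) (fun w => X w * Y w).
Proof.
move=> /(measurable_wrtP _ sG) mX /(measurable_wrtP _ sG) mY.
by apply/(measurable_wrtP _ sG); exact: measurable_funM.
Qed.

Lemma meas_wrt_cst (c : R) : measurable_wrt (F s) (fun=> c).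
Proof. by apply/(measurable_wrtP _ sG); exact: measurable_cst. Qed.

Lemma meas_wrt_comp (f : R -> R) X : measurable_fun setT f ->
  measurable_wrt (F s) X -> measurable_wrt (F s) (fun w => f (X w)).
Proof.
move=> mf /(measurable_wrtP _ sG) mX.
by apply/(measurable_wrtP _ sG); exact: measurableT_comp mf mX.
Qed.

Lemma meas_wrt_sum n (f : nat -> Omega -> R) :
  (forall i, (i < n)%N -> measurable_wrt (F s) (f i)) ->
  measurable_wrt (F s) (fun w => \sum_(i < n) f i w).
Proof.
elim: n => [_|n ih h].
  by under eq_fun do rewrite big_ord0; exact: meas_wrt_cst.
under eq_fun do rewrite big_ord_recr/=.
by apply: meas_wrtD; [apply: ih => i iN; exact/h/ltnW|exact: h].
Qed.

End fixed_time.

Variable W : R -> Omega -> R.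
Hypothesis W_ad : adapted tau F W.

Definition gaussian_increments := forall s t, 0 <= s -> s < t -> t <= tau ->
  indep_of P (F s) (fun w => W t w - W s w) /\
  sym_gaussian P (fun w => W t w - W s w) (t - s).

Hypothesis W_inc : gaussian_increments.

Definition msqC : R := 8 * expR 2^-1.

Lemma msqC_ge0 : 0 <= msqC.
Proof. by rewrite mulr_ge0// expR_ge0. Qed.

Section one_step.
Variables (s t : R) (s0 : 0 <= s) (st : s < t) (tT : t <= tau).
Let hs : 0 <= s <= tau. Proof. by rewrite s0 ltW// (lt_le_trans st). Qed.
Let ht : 0 <= t <= tau. Proof. by rewrite (le_trans s0 (ltW st)). Qed.
Let dt0 : 0 < t - s. Proof. by rewrite subr_gt0. Qed.
Let dW w := W t w - W s w.

Lemma incr_meas_wrt : measurable_wrt (F t) dW.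
Proof.
apply: meas_wrtB => //; first exact: W_ad.
by apply: (meas_wrt_le s0 (ltW st) tT); exact: W_ad.
Qed.

Let indW := (W_inc s0 st tT).1.
Let gauW := (W_inc s0 st tT).2.
Let mdW : measurable_fun setT dW. Proof. by case: gauW. Qed.
Let sG := filtration_sigma hs.
Let Gm := filtration_meas hs.

Lemma incr_orthog Y : measurable_wrt (F s) Y -> sqint P Y ->
  orthog P (F s) (fun w => Y w * dW w).
Proof.
move=> mY sY; apply: (indep_orthog (f := id) sG Gm mdW indW mY _ sY).
- exact: measurable_id.
- exact: (gaussian_sqint gauW).
- exact: (gaussian_mean gauW).
Qed.

Lemma incr_meansq Y : measurable_wrt (F s) Y -> sqint P Y ->
  meansq P (fun w => Y w * dW w) <= meansq P Y * (msqC * (t - s)).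
Proof.
move=> mY sY; have sdW := gaussian_sqint gauW.
have [_ ->] := indep_sqintM (f := id) sG Gm mdW indW mY (@measurable_id _ _ _) sY sdW.
rewrite ler_wpM2l ?meansq_ge0//.
exact: (gaussian_meansq_le gauW dt0).
Qed.

Variables (sigma V : R).
Hypothesis dtV : t - s <= V.

Let eta := expmart_rem (t - s) sigma.
Let ymart := expmart (t - s) sigma.

Definition remC := 2056 * sigma ^+ 4 * expR (1 + 4 * sigma ^+ 2 * V).

Let meta : measurable_fun setT eta.
Proof.
apply: measurable_funB; last exact: measurable_funM.
apply: measurable_funB => //; apply: measurableT_comp => //.
by apply: measurable_funB => //; exact: measurable_funM.
Qed.

Lemma rem_orthog Y : measurable_wrt (F s) Y -> sqint P Y ->
  orthog P (F s) (fun w => Y w * eta (dW w)) /\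
  meansq P (fun w => Y w * eta (dW w)) <= meansq P Y * (remC * (t - s) ^+ 2).
Proof.
move=> mY sY; have srem := expmart_rem_sqint gauW sigma.
split.
  apply: (indep_orthog sG Gm mdW indW mY meta sY srem).
  exact: (expmart_rem_mean gauW).
have [_ ->] := indep_sqintM sG Gm mdW indW mY meta sY srem.
rewrite ler_wpM2l ?meansq_ge0//.
exact: (expmart_rem_meansq gauW dt0 sigma dtV).
Qed.

Lemma ymart_step Y : measurable_wrt (F s) Y -> sqint P Y ->
  sqint P (fun w => Y w * ymart (dW w)) /\
  meansq P (fun w => Y w * ymart (dW w)) = meansq P Y * expR (sigma ^+ 2 * (t - s)).
Proof.
move=> mY sY.
have my : measurable_fun setT ymart.
  apply: measurableT_comp => //.
  by apply: measurable_funB => //; exact: measurable_funM.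
have := indep_sqintM sG Gm mdW indW mY my sY (expmart_sqint gauW sigma).
by rewrite (expmart_meansq gauW).
Qed.

Variable dlt : R.
Hypothesis dlt0 : 0 <= dlt.

(* One step of the comparison: D stands for the difference between the
   perturbed Euler scheme and the exponential martingale E. *)
Lemma euler_step (D E M Th : Omega -> R) :
  measurable_wrt (F s) D -> sqint P D -> measurable_wrt (F s) E -> sqint P E ->
  orthog P (F s) M -> meansq P M <= dlt ^+ 2 * (msqC * (t - s)) ->
  measurable_fun setT Th -> (forall w, `|Th w| <= dlt * (t - s)) ->
  let D' w := D w + (sigma * D w * dW w + (-1 * E w) * eta (dW w) + M w) + Th w in
  sqint P D' /\
  meansq P D' <= (1 + (t - s)) * (meansq P D + 3 * (sigma ^+ 2 * meansq P D * (msqC * (t - s))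
       + meansq P E * (remC * (t - s) ^+ 2) + dlt ^+ 2 * (msqC * (t - s))))
     + (1 + (t - s)^-1) * (dlt * (t - s)) ^+ 2.
Proof.
move=> mD sD mE sE oM M2 mTh Thb D'.
have msD : measurable_wrt (F s) (fun w => sigma * D w).
  by apply: meas_wrtM => //; exact: meas_wrt_cst.
have mNE : measurable_wrt (F s) (fun w => -1 * E w).
  by apply: meas_wrtM => //; exact: meas_wrt_cst.
have ssD := sqintZ sigma sD; have sNE := sqintZ (-1) sE.
have oD := incr_orthog msD ssD.
have [hoR m2] := rem_orthog mNE sNE.
have oN := orthogD (orthogD oD hoR) oM.
have sTh := sqint_bounded P mTh Thb.
have sDN := sqintD sD oN.1.
split; first exact: sqintD sDN sTh.
(* The weight is the step length t - s. The price is a factor 1 + 1 / (t - s) on [Th], which is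
   harmless as the mean square of [Th] is of order (t - s)^2. *)
apply: le_trans (meansqD_weighted dt0 sDN sTh) _.
apply: lerD; last first.
  apply: ler_wpM2l; first by rewrite addr_ge0 ?invr_ge0 ?(ltW dt0).
  exact: meansq_bounded.
apply: ler_wpM2l; first by rewrite addr_ge0 ?(ltW dt0).
(* Since the noise is orthogonal to the past, it adds a mean square of order t - s without a cross
   term, which would be of order sqrt(t - s). *)
rewrite [leLHS](orthog_meansqD mD sD oN) lerD2l.
apply: le_trans (meansqD3 oD.1 hoR.1 oM.1) _.
have msqZ c Y : sqint P Y -> meansq P (fun w => c * Y w) = c ^+ 2 * meansq P Y.
  move=> sY; rewrite /meansq; under eq_Rintegral do rewrite exprMn.
  by rewrite RintegralZl//; exact: sY.2.
rewrite ler_wpM2l// lerD// lerD//.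
- by rewrite -msqZ//; exact: incr_meansq.
- by apply: le_trans m2 _; rewrite msqZ// sqrrN expr1n mul1r.
Qed.

End one_step.

(** Ito's isometry as an inequality for step processes: each new term is orthogonal to everything
    known at its starting time, hence to the sum of the earlier ones. *)
Lemma simple_integral_orthog (u : nat -> R) (m : nat) (dlt : R) (c : nat -> Omega -> R) :
  0 <= dlt -> 0 <= u 0 -> (forall i, (i < m)%N -> u i < u i.+1) -> u m <= tau ->
  (forall i, (i < m)%N -> measurable_wrt (F (u i)) (c i)) ->
  (forall i w, `|c i w| <= dlt) ->
  let S w := \sum_(i < m) c i w * (W (u i.+1) w - W (u i) w) in
  [/\ measurable_wrt (F (u m)) S, orthog P (F (u 0)) S &
      meansq P S <= dlt ^+ 2 * (msqC * (u m - u 0))].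
Proof.
move=> dlt0 u0; elim: m => [|m ih] lu um mc cb.
  rewrite /=; under eq_fun do rewrite big_ord0.
  have u0h : 0 <= u 0 <= tau by rewrite u0.
  have s0 : sqint P (fun=> 0) by apply: (@sqint_bounded _ _ _ _ 0) => // w; rewrite normr0.
  split.
  - exact: meas_wrt_cst.
  - split => // Y mY sY; under eq_Rintegral do rewrite mulr0.
    by rewrite Rintegral_cst// mul0r.
  - apply: (@le_trans _ _ 0); last by rewrite subrr !mulr0.
    rewrite /meansq; under eq_Rintegral do rewrite expr0n/=.
    by rewrite Rintegral_cst// mul0r.
have lum : u m < u m.+1 by exact: lu.
have umtau : u m <= tau by apply: le_trans um; exact: ltW.
have [mS oS S2] := ih (fun i im => lu i (ltnW im)) umtau (fun i im => mc i (ltnW im)) cb.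
have u0m : u 0 <= u m.
  have hh k : (k <= m)%N -> u 0 <= u k.
    elim: k => // k ihk km; apply: le_trans (ihk (ltnW km)) _.
    by apply/ltW/lu/ltnW.
  exact: hh.
have um0 : 0 <= u m by exact: le_trans u0m.
have umh : 0 <= u m <= tau by rewrite um0.
have umSh : 0 <= u m.+1 <= tau by rewrite (le_trans um0 (ltW lum)).
have mcm := mc m (ltnSn m).
have scm : sqint P (c m) by apply: (sqint_bounded P _ (cb m)); exact: meas_wrt_meas mcm.
have oN := incr_orthog um0 lum um mcm scm.
have N2 := incr_meansq um0 lum um mcm scm.
move=> /=; under eq_fun do rewrite big_ord_recr/=.
split.
- apply: meas_wrtD => //.
    exact: meas_wrt_le (ltW lum) um mS.
  apply: meas_wrtM => //; last exact: incr_meas_wrt.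
  exact: meas_wrt_le (ltW lum) um mcm.
- apply: orthogD => //.
  by apply: (orthogS _ oN); exact: filtration_mono.
- rewrite [leLHS](orthog_meansqD mS oS.1 oN).
  rewrite (_ : _ * (_ * _) = dlt ^+ 2 * (msqC * (u m - u 0)) + dlt ^+ 2 * (msqC * (u m.+1 - u m))); last by ring.
  apply: lerD => //; apply: le_trans N2 _.
  apply: ler_wpM2r; first by rewrite mulr_ge0 ?msqC_ge0// subr_ge0 ltW.
  apply: (meansq_bounded P _ (cb m)); exact: meas_wrt_meas mcm.
Qed.

End filtered.

Section clamp.
Context {R : realType}.
Implicit Types x dlt : R.

Definition clampr dlt x : R := Num.max (- dlt) (Num.min x dlt).

Lemma clampr_norm dlt x : 0 <= dlt -> `|clampr dlt x| <= dlt.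
Proof.
move=> d0; rewrite /clampr ler_norml le_max lexx/= ge_max ge_min lexx orbT andbT.
lra.
Qed.

Lemma clampr_id dlt x : `|x| <= dlt -> clampr dlt x = x.
Proof.
by rewrite ler_norml /clampr => /andP[h1 h2]; rewrite (min_l h2) (max_r h1).
Qed.

Lemma measurable_clampr dlt : measurable_fun setT (clampr dlt).
Proof. by apply: measurable_maxr => //; exact: measurable_minr. Qed.

(** Induction with exp(K j D) as a majorant of (1 + K D)^j; being at least 1, it also absorbs the
    inhomogeneous term. *)
Lemma gronwall (a : nat -> R) (K rho D : R) (N : nat) :
  0 <= K -> 0 <= rho -> 0 <= D -> a 0 = 0 ->
  (forall j, (j < N)%N -> a j.+1 <= (1 + K * D) * a j + D * rho) ->
  forall j, (j <= N)%N -> a j <= j%:R * D * rho * expR (K * (j%:R * D)).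
Proof.
move=> K0 rho0 D0 a0 ha; elim=> [_|j ih jN]; first by rewrite a0 !mul0r.
apply: le_trans (ha j jN) _.
have KD : 0 <= K * D by exact: mulr_ge0.
have e1 : 1 + K * D <= expR (K * D) by exact: expR_ge1Dx.
have e2 : 1 <= expR (K * (j.+1%:R * D)).
  by rewrite -[leLHS]expR0 ler_expR !mulr_ge0.
have eS : expR (K * (j.+1%:R * D)) = expR (K * D) * expR (K * (j%:R * D)).
  by rewrite -expRD -natr1; congr expR; ring.
rewrite (_ : j.+1%:R * D * rho = j%:R * D * rho + D * rho); last by rewrite -natr1; ring.
rewrite [leRHS]mulrDl lerD//; last by rewrite ler_peMr// mulr_ge0.
apply: (@le_trans _ _ ((1 + K * D) * (j%:R * D * rho * expR (K * (j%:R * D))))).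
  by apply: ler_wpM2l; [rewrite addr_ge0|exact/ih/ltnW].
rewrite eS mulrCA; apply: ler_wpM2l; first by rewrite !mulr_ge0.
by apply: ler_wpM2r => //; exact: expR_ge0.
Qed.

End clamp.

(** * A clamped Euler scheme compared with the exponential martingale *)

Section euler_scheme.
Context {d : measure_display} {Omega : measurableType d} {R : realType}.
Variables (P : probability Omega R) (tau : R) (F : R -> set (set Omega)).
Hypothesis hF : filtration tau F.
Variables (W I pi : R -> Omega -> R) (sigma t : R).
Hypotheses (W_ad : adapted tau F W) (I_ad : adapted tau F I) (pi_ad : adapted tau F pi).
Hypothesis W_inc : gaussian_increments P tau F W.
Hypotheses (t0 : 0 < t) (ttau : t <= tau).

Let mwM := fun s hs X Y => @meas_wrtM _ _ _ tau F hF s hs X Y.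
Let mwB := fun s hs X Y => @meas_wrtB _ _ _ tau F hF s hs X Y.
Let mwD := fun s hs X Y => @meas_wrtD _ _ _ tau F hF s hs X Y.
Let mw_cst := fun s hs c => @meas_wrt_cst _ _ _ tau F hF s hs c.

Section scheme.
Variables (n m : nat) (dlt : R).

(** Point i of the subdivision of the j-th coarse cell. It depends on j and i only through one
    global index, so that the row j = 0, continued beyond [m.+1], runs through all fine points. *)
Definition finegrid (j i : nat) : R := (j * m.+1 + i)%:R * (t / (n.+1 * m.+1)%:R).

Local Notation s := (grid 0 t n).
Local Notation u := finegrid.
Local Notation Delta := (t / n.+1%:R).
Local Notation dW j w := (W (s j.+1) w - W (s j) w).

Lemma finegrid0 j : u j 0 = s j.
Proof.
rewrite /finegrid /grid addn0 subr0 add0r !natrM.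
have n0 : n.+1%:R != 0 :> R by rewrite pnatr_eq0.
have m0 : m.+1%:R != 0 :> R by rewrite pnatr_eq0.
by field; rewrite ![1 + _]addrC !natr1 n0 m0.
Qed.

Lemma finegrid_last j : u j m.+1 = s j.+1.
Proof. by rewrite -finegrid0 /finegrid addn0 mulSn addnC. Qed.

Lemma finegrid_lt j i k : (i < k)%N -> u j i < u j k.
Proof.
move=> ik; rewrite /finegrid ltr_pM2r ?ltr_nat ?ltn_add2l//.
by rewrite divr_gt0// ltr0n muln_gt0.
Qed.

Lemma finegrid_le j i k : (i <= k)%N -> u j i <= u j k.
Proof. by rewrite leq_eqVlt => /predU1P[->//|/finegrid_lt/ltW]. Qed.

Lemma coarse_in j : (j <= n.+1)%N -> 0 <= s j <= tau.
Proof.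
move=> jn; rewrite grid_ge ?(ltW t0)//=.
by apply: le_trans ttau; rewrite grid_leb// ltW.
Qed.

Lemma coarse_lt j : s j < s j.+1.
Proof. exact: grid_lt. Qed.

Lemma coarse_step j : s j.+1 - s j = Delta.
Proof. by rewrite gridS subr0. Qed.

Lemma fine_in j i : (j < n.+1)%N -> (i <= m.+1)%N -> [/\ s j <= u j i, u j i <= s j.+1 & 0 <= u j i <= tau].
Proof.
move=> jn im; have h1 : s j <= u j i by rewrite -finegrid0 finegrid_le.
have h2 : u j i <= s j.+1 by rewrite -finegrid_last finegrid_le.
split => //; have /andP[h3 _] := coarse_in (ltnW jn); have /andP[_ h4] := coarse_in jn.
by rewrite (le_trans h3 h1) (le_trans h2 h4).
Qed.

(* disc j is close to exp(- int_0^(s j) pi) / I_0, so that discI nearly solves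
   dX = sigma X dW with X_0 = 1. *)
Definition disc (j : nat) (w : Omega) : R :=
  expR (- (\sum_(i < j) pi (s i) w * Delta) - ln (I 0 w)).

Definition discI (j : nat) (w : Omega) : R := I (s j) w * disc j w.

(* Clamping makes every term below square integrable; with probability close to
   1 it has no effect. *)
Definition fine_coef (j i : nat) (w : Omega) : R :=
  clampr dlt (sigma * disc j.+1 w * (I (u j i) w - I (s j) w)).

(** Discounted left sum of sigma I dW over a coarse cell minus its one-term approximation. Its size
    is of order dlt sqrt(Delta), too large for an error bounded by dlt Delta along each path; it is
    kept apart because it is orthogonal to the past. *)
Definition fine_sum (j : nat) (w : Omega) : R :=
  \sum_(i < m.+1) fine_coef j i w * (W (u j i.+1) w - W (u j i) w).

(** What remains of the one-step error once the martingale part is removed; this part is bounded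
    path by path. *)
Definition defect (j : nat) (w : Omega) : R :=
  discI j.+1 w - discI j w * (1 + sigma * dW j w) - fine_sum j w.

Fixpoint perturbed_euler (j : nat) (w : Omega) : R :=
  if j is j'.+1 then
    perturbed_euler j' w * (1 + sigma * dW j' w) + fine_sum j' w
    + clampr (dlt * Delta) (defect j' w)
  else 1.

Definition discrete_exp (j : nat) (w : Omega) : R :=
  \prod_(i < j) expmart Delta sigma (dW i w).

(** [defect] already subtracts the clamped [fine_sum], so only the clamp on the defect has to be
    inactive. The initial value is 1 because [disc] contains the factor 1 / I_0. *)
Lemma perturbed_eulerE j w : 0 < I 0 w ->
  (forall i, (i < j)%N -> `|defect i w| <= dlt * Delta) ->
  perturbed_euler j w = discI j w.
Proof.
move=> I0; elim: j => [_|j ih hj] /=.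
  by rewrite /discI /disc big_ord0 oppr0 add0r expRN lnK ?posrE// grid0 mulfV ?gt_eqF.
rewrite ih; last by move=> i ij; apply: hj; exact: ltnW.
rewrite clampr_id; last exact: hj.
by rewrite /defect; ring.
Qed.

(** The left-endpoint sum in [disc j.+1] stops at the value of [pi] at s_j: it is known one step
    early and may multiply increments that start at s_j. *)
Lemma disc_meas_wrt j : (j <= n)%N -> measurable_wrt (F (s j)) (disc j.+1).
Proof.
move=> jn; have hj := coarse_in (leqW jn); have /andP[sj0 sjt] := hj.
have tau0 : 0 <= (0 : R) <= tau by rewrite lexx (le_trans sj0).
have mpi : measurable_wrt (F (s j)) (fun w => \sum_(i < j.+1) pi (s i) w * Delta).
  apply: (meas_wrt_sum hF hj (f := fun i w => pi (s i) w * Delta)) => i ij.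
  have hi := coarse_in (leq_trans (ij : (i <= j)%N) (leqW jn)).
  apply: mwM => //; last exact: mw_cst.
  apply: (meas_wrt_le hF _ _ sjt (pi_ad hi)); first by case/andP: hi.
  by apply: grid_le => //; exact: ltW.
have mI0 : measurable_wrt (F (s j)) (I 0).
  exact: (meas_wrt_le hF (lexx 0) sj0 sjt (I_ad tau0)).
apply: (meas_wrt_comp hF hj (@measurable_expR R)).
apply: mwB => //.
- by apply: (meas_wrt_comp (f := -%R) hF hj _ mpi); exact: oppr_measurable.
- by apply: (meas_wrt_comp hF hj _ mI0); exact: measurable_ln.
Qed.

Hypothesis dlt0 : 0 <= dlt.

Lemma fine_coef_meas_wrt j i : (j <= n)%N -> (i <= m.+1)%N ->
  measurable_wrt (F (u j i)) (fine_coef j i).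
Proof.
move=> jn im; have [h1 h2 h3] := fine_in (jn : (j < n.+1)%N) im.
have /andP[h30 h31] := h3; have /andP[sj0 sjt] := coarse_in (leqW jn).
apply: (meas_wrt_comp hF h3 (measurable_clampr dlt)).
apply: mwM => //.
- apply: mwM => //; first exact: mw_cst.
  exact: (meas_wrt_le hF sj0 h1 h31 (disc_meas_wrt jn)).
- apply: mwB => //; first exact: I_ad.
  apply: (meas_wrt_le hF sj0 h1 h31); apply: I_ad; exact: coarse_in (leqW jn).
Qed.

Lemma fine_sum_orthog j : (j <= n)%N ->
  [/\ measurable_wrt (F (s j.+1)) (fine_sum j), orthog P (F (s j)) (fine_sum j) &
      meansq P (fine_sum j) <= dlt ^+ 2 * (msqC * Delta)].
Proof.
move=> jn; have [_ _ h0] := fine_in (jn : (j < n.+1)%N) (leq0n _).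
have [_ _ hm] := fine_in (jn : (j < n.+1)%N) (leqnn _).
have := @simple_integral_orthog _ _ _ P tau F hF W W_ad W_inc (u j) m.+1 dlt (fine_coef j) dlt0.
rewrite finegrid0 finegrid_last coarse_step; apply.
- by rewrite -finegrid0; case/andP: h0.
- by move=> i im; exact: finegrid_lt.
- by rewrite -finegrid_last; case/andP: hm.
- by move=> i im; apply: fine_coef_meas_wrt => //; exact: ltnW.
- by move=> i w; exact: clampr_norm.
Qed.

Lemma discI_meas_wrt j : (j <= n.+1)%N -> measurable_wrt (F (s j)) (discI j).
Proof.
case: j => [_|j jn].
  have h0 : 0 <= grid 0 t n 0 <= tau by exact: coarse_in.
  apply: mwM => //; first exact: I_ad.
  have mI0 : measurable_wrt (F (s 0)) (I 0) by rewrite -[X in I X](grid0 0 t n); exact: I_ad.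
  rewrite /disc; under eq_fun do rewrite big_ord0.
  apply: (meas_wrt_comp hF h0 (@measurable_expR R)).
  apply: mwB => //; first exact: mw_cst.
  by apply: (meas_wrt_comp hF h0 _ mI0); exact: measurable_ln.
have hj := coarse_in jn; have /andP[_ hjt] := hj.
have /andP[sj0 _] := coarse_in (ltnW jn).
apply: mwM => //; first exact: I_ad.
exact: (meas_wrt_le hF sj0 (ltW (coarse_lt j)) hjt (disc_meas_wrt jn)).
Qed.

Lemma dW_meas_wrt j : (j <= n)%N -> measurable_wrt (F (s j.+1)) (fun w => dW j w).
Proof.
move=> jn; have /andP[sj0 _] := coarse_in (leqW jn).
have /andP[_ hjt] := coarse_in (jn : (j.+1 <= n.+1)%N).
exact: (incr_meas_wrt hF W_ad sj0 (coarse_lt j) hjt).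
Qed.

Lemma defect_meas_wrt j : (j <= n)%N -> measurable_wrt (F (s j.+1)) (defect j).
Proof.
move=> jn; have hj := coarse_in (jn : (j.+1 <= n.+1)%N).
have /andP[_ hjt] := hj; have /andP[sj0 _] := coarse_in (leqW jn).
have [mS _ _] := fine_sum_orthog jn.
apply: mwB => //; apply: mwB => //; first exact: discI_meas_wrt.
apply: mwM => //.
  by apply: (meas_wrt_le hF sj0 (ltW (coarse_lt j)) hjt); apply: discI_meas_wrt; exact: leqW.
apply: mwD => //; first exact: mw_cst.
apply: mwM => //; first exact: mw_cst.
exact: dW_meas_wrt.
Qed.

Lemma discrete_exp_sqint j : (j <= n.+1)%N ->
  [/\ measurable_wrt (F (s j)) (discrete_exp j), sqint P (discrete_exp j) &
      meansq P (discrete_exp j) = expR (sigma ^+ 2 * Delta) ^+ j].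
Proof.
elim: j => [_|j ih jn].
  have -> : discrete_exp 0 = fun=> 1 by apply/funext => w; rewrite /discrete_exp big_ord0.
  have h0 : 0 <= grid 0 t n 0 <= tau by exact: coarse_in.
  split.
  - exact: mw_cst.
  - by apply: (@sqint_bounded _ _ _ _ 1) => // w; rewrite normr1.
  - rewrite /meansq; under eq_Rintegral do rewrite expr1n.
    by rewrite Rintegral_cst// [X in fine X]probability_setT mulr1 expr0.
have [mE sE E2] := ih (ltnW jn).
have -> : discrete_exp j.+1 = fun w => discrete_exp j w * expmart Delta sigma (dW j w).
  by apply/funext => w; rewrite /discrete_exp big_ord_recr.
have /andP[sj0 _] := coarse_in (ltnW jn); have hj := coarse_in jn.
have /andP[_ hjt] := hj.
have [s1 s2] := ymart_step hF W_inc sj0 (coarse_lt j) hjt sigma mE sE.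
rewrite coarse_step in s1 s2; split.
- apply: mwM => //; first exact: (meas_wrt_le hF sj0 (ltW (coarse_lt j)) hjt).
  apply: (meas_wrt_comp hF hj _ (dW_meas_wrt (jn : (j <= n)%N))).
  apply: measurableT_comp => //.
  by apply: measurable_funB => //; exact: measurable_funM.
- exact: s1.
- by rewrite [LHS]s2 E2 [RHS]exprSr.
Qed.

(** Growth rate and error per unit of time in the recursion given by [euler_step], with 1 + Delta
    bounded by 1 + t. The error has a part proportional to the step and a part proportional to
    dlt^2, which are made small separately. *)
Definition euler_rate : R := 1 + 3 * (sigma ^+ 2 * msqC) * (1 + t).

Definition euler_err (D : R) : R := (1 + t) *
  (3 * (expR (sigma ^+ 2 * t) * (remC sigma t * D)) + 3 * (dlt ^+ 2 * msqC) + dlt ^+ 2).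

Lemma remC_ge0 : 0 <= remC sigma t.
Proof.
have s4 : 0 <= sigma ^+ 4 by rewrite (exprM sigma 2 2) sqr_ge0.
exact: (mulr_ge0 (mulr_ge0 (ler0n _ _) s4) (expR_ge0 _)).
Qed.

Lemma Delta_gt0 : 0 < Delta. Proof. by rewrite divr_gt0// ltr0n. Qed.

Lemma Delta_le : Delta <= t.
Proof. by rewrite ler_pdivrMr ?ltr0n// ler_peMr ?(ltW t0)// ler1n. Qed.

Lemma discrete_exp_meansq_le j : (j <= n.+1)%N ->
  meansq P (discrete_exp j) <= expR (sigma ^+ 2 * t).
Proof.
move=> jn; have [_ _ ->] := discrete_exp_sqint jn.
rewrite -expRM_natl ler_expR mulrCA; apply: ler_wpM2l; first exact: sqr_ge0.
by have := grid_leb (ltW t0) jn; rewrite /grid subr0 add0r.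
Qed.

Lemma perturbed_euler_close j : (j <= n.+1)%N ->
  let E w := perturbed_euler j w - discrete_exp j w in
  [/\ measurable_wrt (F (s j)) (perturbed_euler j), sqint P E &
   meansq P E <= j%:R * Delta * euler_err Delta * expR (euler_rate * (j%:R * Delta))].
Proof.
pose E i w := perturbed_euler i w - discrete_exp i w.
have C0 : 0 <= msqC :> R := msqC_ge0.
have D0 := Delta_gt0; have Dt := Delta_le; have r0 := remC_ge0.
have tt := ltW t0.
have step i : (i <= n)%N -> measurable_wrt (F (s i)) (perturbed_euler i) -> sqint P (E i) ->
    [/\ measurable_wrt (F (s i.+1)) (perturbed_euler i.+1), sqint P (E i.+1) &
      meansq P (E i.+1) <= (1 + euler_rate * Delta) * meansq P (E i) + Delta * euler_err Delta].
  move=> iN mv sE.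
  have h1 := coarse_in (leqW iN); have h2 := coarse_in (iN : (i.+1 <= n.+1)%N).
  have /andP[si0 _] := h1; have /andP[_ sit] := h2.
  have [mS oS S2] := fine_sum_orthog iN.
  have [mX sX _] := discrete_exp_sqint (leqW iN).
  have mdef := defect_meas_wrt iN.
  have mTh := meas_wrt_comp hF h2 (measurable_clampr (dlt * Delta)) mdef.
  have dD0 : 0 <= dlt * Delta by rewrite mulr_ge0// ltW.
  have mE : measurable_wrt (F (s i)) (E i) by exact: mwB.
  have dW_le : s i.+1 - s i <= t by rewrite coarse_step.
  have S2' : meansq P (fine_sum i) <= dlt ^+ 2 * (msqC * (s i.+1 - s i)).
    by rewrite coarse_step.
  have Thb w : `|clampr (dlt * Delta) (defect i w)| <= dlt * (s i.+1 - s i).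
    by rewrite coarse_step clampr_norm.
  have [sE' E2'] := euler_step hF W_inc si0 (coarse_lt i) sit sigma dW_le
    mE sE mX sX oS S2' (meas_wrt_meas hF h2 mTh) Thb.
  rewrite coarse_step in sE' E2'.
  (* Writing [expmart] as 1 + sigma dW + [expmart_rem] puts the difference of the two recursions in
     the form treated by [euler_step]. *)
  have EE : (fun w => E i w + (sigma * E i w * dW i w + (-1 * discrete_exp i w) *
      expmart_rem Delta sigma (dW i w) + fine_sum i w) + clampr (dlt * Delta) (defect i w)) = E i.+1.
    apply/funext => w; rewrite /E /= /discrete_exp big_ord_recr /= -/(discrete_exp i w).
    by rewrite /expmart_rem; ring.
  have {}sE' : sqint P (E i.+1) by rewrite -EE; exact: sE'.
  split => //.
    apply: mwD => //; apply: mwD => //.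
    apply: mwM => //; first exact: (meas_wrt_le hF si0 (ltW (coarse_lt i)) sit).
    apply: mwD => //; first exact: mw_cst.
    apply: mwM => //; first exact: mw_cst.
    exact: dW_meas_wrt.
  rewrite -[in leLHS]EE; apply: le_trans E2' _.
  have A0 := meansq_ge0 P (E i).
  have B0 := discrete_exp_meansq_le (leqW iN).
  move: A0 B0; set A := meansq P (E i); set B := meansq P (discrete_exp i).
  rewrite /euler_rate /euler_err; set BB := expR (sigma ^+ 2 * t).
  move=> A0 B0.
  rewrite (_ : (1 + Delta^-1) * (dlt * Delta) ^+ 2 = dlt ^+ 2 * Delta * (1 + Delta)); last first.
    by have := lt0r_neq0 D0; generalize Delta => z z0; field.
  set C := msqC in C0 *; set r := remC sigma t in r0 *.
  have D1 : 0 <= 1 + Delta by rewrite addr_ge0// ltW.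
  have sg := sqr_ge0 sigma; have dl := sqr_ge0 dlt.
  have k1 : (1 + Delta) * (3 * (sigma ^+ 2 * C) * Delta * A) <=
            (1 + t) * (3 * (sigma ^+ 2 * C) * Delta * A).
    have sC : 0 <= 3 * (sigma ^+ 2 * C) := mulr_ge0 (ler0n _ _) (mulr_ge0 sg C0).
    by apply: (ler_wpM2r (mulr_ge0 (mulr_ge0 sC (ltW D0)) A0)); rewrite lerD2l.
  have k2 : (1 + Delta) * (3 * (B * (r * Delta ^+ 2)) + 3 * (dlt ^+ 2 * C) * Delta + dlt ^+ 2 * Delta) <=
      (1 + t) * (3 * (BB * (r * Delta ^+ 2)) + 3 * (dlt ^+ 2 * C) * Delta + dlt ^+ 2 * Delta).
    have BD : B * (r * Delta ^+ 2) <= BB * (r * Delta ^+ 2).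
      by apply: ler_wpM2r => //; rewrite mulr_ge0// sqr_ge0.
    have B00 : 0 <= B * (r * Delta ^+ 2).
      by rewrite mulr_ge0 ?meansq_ge0// mulr_ge0// sqr_ge0.
    apply: ler_pM => //.
    - apply: addr_ge0; last exact: (mulr_ge0 dl (ltW D0)).
      apply: addr_ge0; first exact: (mulr_ge0 (ler0n _ _) B00).
      exact: (mulr_ge0 (mulr_ge0 (ler0n _ _) (mulr_ge0 dl C0)) (ltW D0)).
    - by rewrite lerD2l.
    - by rewrite !lerD2r ler_wpM2l.
  rewrite -subr_ge0 in k1; rewrite -subr_ge0 in k2; rewrite -subr_ge0.
  move: (addr_ge0 k1 k2); congr (is_true (0 <= _)).
  generalize Delta => z; ring.
(* [gronwall] concerns real numbers only, so measurability and integrability of all steps are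
   settled first. *)
have main i : (i <= n.+1)%N ->
    measurable_wrt (F (s i)) (perturbed_euler i) /\ sqint P (E i).
  elim: i => [_|i ih iN].
    have h0 : 0 <= grid 0 t n 0 <= tau by exact: coarse_in.
    split; first exact: (mw_cst h0 1).
    have -> : E 0 = fun=> 0.
      by apply/funext => w; rewrite /E /discrete_exp big_ord0 subrr.
    by apply: (@sqint_bounded _ _ _ _ 0) => // w; rewrite normr0.
  have [m1 s1] := ih (ltnW iN).
  by have [] := step i iN m1 s1.
move=> jn; have [mj sj] := main j jn; split=> //.
apply: (@gronwall _ (fun i => meansq P (E i)) _ _ _ n.+1) => //.
- by rewrite addr_ge0// mulr_ge0 ?addr_ge0// mulr_ge0// mulr_ge0// sqr_ge0.
- rewrite /euler_err mulr_ge0 ?addr_ge0// ?sqr_ge0//.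
    by rewrite mulr_ge0// mulr_ge0 ?expR_ge0// mulr_ge0// ltW.
  by rewrite mulr_ge0// mulr_ge0// sqr_ge0.
- exact: ltW.
- have -> : E 0 = fun=> 0.
    by apply/funext => w; rewrite /E /discrete_exp big_ord0 subrr.
  rewrite /meansq; under eq_Rintegral do rewrite expr0n/=.
  by rewrite Rintegral_cst// mul0r.
- move=> i iN; have [m1 s1] := main i (ltnW iN).
  by have [] := step i iN m1 s1.
Qed.

End scheme.
End euler_scheme.

(** * Almost sure limits and limits in probability *)

Section convergence_in_probability.
Context {d : measure_display} {Omega : measurableType d} {R : realType}.
Variable P : probability Omega R.

(** The tail unions decrease to the limit superior of the sets, which is null; continuity from above
    concludes. *)
Lemma eventually_notin_cvg0 (S : nat -> set Omega) :
  (forall n, measurable (S n)) ->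
  {ae P, forall w, \forall n \near \oo, ~ S n w} -> P (S n) @[n --> \oo] --> 0%E.
Proof.
move=> mS aeS; pose T n := \bigcup_(k >= n) S k.
have mT n : measurable (T n) by exact: bigcup_measurable.
have ndT : nonincreasing_seq T.
  by move=> k l kl; apply/subsetPset => w [i /= li Si]; exists i => //=; exact: leq_trans li.
have PT : P (T n) @[n --> \oo] --> 0%E.
  have cap0 : P (\bigcap_n T n) = 0.
    have [N [mN N0 hN]] := aeS.
    apply/eqP; rewrite -measure_le0 -N0; apply: le_measure; rewrite ?inE//.
      exact: bigcapT_measurable.
    move=> w hw; apply: hN => /= -[k _ hk].
    by have [l /= kl Sl] := hw k I; exact: (hk l kl).
  rewrite -cap0; apply: nonincreasing_cvg_mu => //.
  - exact: le_lt_trans (probability_le1 P (mT 0)) (ltry _).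
  - exact: bigcapT_measurable.
apply: (@squeeze_cvge _ _ _ _ (fun=> 0%E) _ (fun n => P (T n))) => //.
- apply: nearW => n; rewrite measure_ge0/=; apply: le_measure; rewrite ?inE//.
  by move=> w Sw; exists n => //=.
- exact: cvg_cst.
Qed.

(** Where |X - Y| >= 2 e, one of |Z_n - X| and |Z_n - Y| is at least e, and the probabilities of
    both events tend to 0. *)
Lemma cvg_proba_eq (Z : nat -> Omega -> R) (X Y : Omega -> R) :
  (forall n, measurable_fun setT (Z n)) -> measurable_fun setT X -> measurable_fun setT Y ->
  {ae P, forall w, Z n w @[n --> \oo] --> X w} -> cvg_in_probability P Z Y ->
  {ae P, forall w, X w = Y w}.
Proof.
move=> mZ mX mY aeX pY.
have ptw e : 0 < e -> P [set w | 2 * e <= `|X w - Y w|] = 0.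
  move=> e0.
  have mA : measurable [set w | 2 * e <= `|X w - Y w|].
    exact/measurable_ge_abs/measurable_funB.
  have mB n : measurable [set w | e <= `|Z n w - Y w|].
    exact/measurable_ge_abs/measurable_funB.
  have mC n : measurable [set w | e <= `|Z n w - X w|].
    exact/measurable_ge_abs/measurable_funB.
  have hC : P [set w | e <= `|Z n w - X w|] @[n --> \oo] --> 0%E.
    apply: eventually_notin_cvg0 => //.
    apply: filterS aeX => w /cvgrPdist_lt/(_ _ e0); apply: filterS => n /= h.
    by apply/negP; rewrite -ltNge distrC.
  have hB := pY e e0.
  have hBC := cvgeD (fin_num_adde_defr _ (isT : (0%:E : \bar R) \is a fin_num)) hB hC.
  rewrite adde0 in hBC.
  apply/eqP; rewrite -measure_le0. apply: (cvge_to_ge (hBC _)).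
  apply: nearW => n.
  apply: (@le_trans _ _ (P ([set w | e <= `|Z n w - Y w|] `|` [set w | e <= `|Z n w - X w|]))); last first.
    exact: measureU2.
  apply: le_measure; rewrite ?inE//; first exact: measurableU.
  move=> w /= h; have [h1|h1] := leP e `|Z n w - Y w|; [by left|right].
  have := ler_normB (Z n w - Y w) (Z n w - X w).
  rewrite (_ : _ - _ - _ = X w - Y w); last by ring.
  by move=> h2; lra.
have aek k : {ae P, forall w, ~ (2 * k.+1%:R^-1 <= `|X w - Y w|)}.
  exists [set w | 2 * k.+1%:R^-1 <= `|X w - Y w|]; split.
  - exact/measurable_ge_abs/measurable_funB.
  - by apply: ptw; rewrite invr_gt0 ltr0n.
  - by move=> w /= /contrapT.
apply: filterS (ae_foralln aek) => w hw; apply/eqP; rewrite -subr_eq0; apply/eqP.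
apply: contrapT => /eqP; rewrite -normr_gt0 => n0.
have := mesh_small 0 2 n0 => -[N _ /(_ N (leqnn N))]; rewrite subr0 => hN.
by apply: (hw N); exact: ltW.
Qed.

End convergence_in_probability.

(** * Bound on the defect along a single path *)

Section path_defect.
Context {d : measure_display} {Omega : measurableType d} {R : realType}.
Variables (W I pi J : R -> Omega -> R) (sigma t : R) (w : Omega).
Hypothesis t0 : 0 < t.
Hypotheses (cI : cont_on 0 t (I ^~ w)) (cpi : cont_on 0 t (pi ^~ w))
  (cW : cont_on 0 t (W ^~ w)) (I0 : 0 < I 0 w).
Hypothesis IJ : forall n j, (j <= n.+1)%N -> I (grid 0 t n j) w =
  I 0 w + itg (fun s => I s w * pi s w) 0 (grid 0 t n j) + J (grid 0 t n j) w.

(* J is the stochastic integral of sigma I, known only as a limit in probability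
   of left sums: hence the fine grid inside each coarse interval. *)
Definition ito_gap n m j : R :=
  J (grid 0 t n j.+1) w - J (grid 0 t n j) w -
  \sum_(k < m.+1) sigma * I (finegrid t n m j k) w *
     (W (finegrid t n m j k.+1) w - W (finegrid t n m j k) w).

(** Used with x the drift pi Delta and y the noise sigma dW of one step: the bound is the step [e]
    times a quantity that vanishes with the step and the noise. *)
Lemma mul_expR_sub_le (x y e M : R) : 0 <= e -> e <= 1 -> `|x| <= M * e -> `|y| <= 1 -> 0 <= M ->
  `|(expR x - 1) * (1 + y) - x| <= e * (2 * M ^+ 2 * expR M * e + M * `|y|).
Proof.
move=> e0 e1 xM y1 M0.
rewrite (_ : _ - _ = (expR x - 1 - x) * (1 + y) + x * y); last by ring.
apply: le_trans (ler_normD _ _) _; rewrite [leRHS]mulrDr; apply: lerD; last first.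
  by rewrite normrM mulrA [e * M]mulrC ler_wpM2r.
rewrite normrM.
have h1 := norm_expR_sub_le x.
have h2 : `|1 + y| <= 2.
  by apply: le_trans (ler_normD _ _) _; rewrite normr1 -[2]/(1 + 1) lerD2l.
have h3 : expR `|x| <= expR M.
  by rewrite ler_expR (le_trans xM)// ler_piMr.
have h4 : x ^+ 2 <= (M * e) ^+ 2.
  by rewrite -(real_normK (num_real x)) lerXn2r ?nnegrE// mulr_ge0.
apply: le_trans (ler_pM (normr_ge0 _) (normr_ge0 _) h1 h2) _.
rewrite (_ : e * _ = ((M * e) ^+ 2 * expR M) * 2); last by ring.
by rewrite ler_wpM2r// ler_pM// ?sqr_ge0 ?expR_ge0.
Qed.

(** Uniform continuity of I, I pi and W makes each source of error at most a fraction of dlt Delta.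
    The fine sum enters only through the gap, so the threshold on n is uniform in m. Bounding the
    gap by the square of the step, which is eventually below every multiple of the step, lets m be
    chosen before dlt. *)
Lemma path_defect (dlt : R) : 0 < dlt -> \forall n \near \oo, forall m,
  (forall j, (j <= n)%N -> `|ito_gap n m j| < (t / n.+1%:R) ^+ 2) ->
  forall j, (j <= n)%N -> `|defect W I pi sigma t n m dlt j w| <= dlt * (t / n.+1%:R).
Proof.
move=> d0; have tt := ltW t0.
have [Mi Mi0 hMi] := cont_on_bounded cI.
have [Mp Mp0 hMp] := cont_on_bounded cpi.
(* A bound on every [disc] along this path, for all n at once. Below, the summands 1 in the
   denominators cover the case sigma = 0. *)
pose Dm := expR (Mp * t - ln (I 0 w)).
have Dm0 : 0 < Dm by exact: expR_gt0.
have sD0 : 0 < `|sigma| * Dm + 1 by rewrite ltr_wpDl// mulr_ge0// ltW.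
have e1 : 0 < dlt / (`|sigma| * Dm + 1) by rewrite divr_gt0.
have [g1 g10 hg1] := cont_on_unif cI e1.
have cIp : cont_on 0 t (fun s => I s w * pi s w) by exact: cont_onM.
have e2 : 0 < dlt / (4 * Dm) by rewrite divr_gt0// mulr_gt0.
have [g2 g20 hg2] := cont_on_unif cIp e2.
have K30 : 0 < Mi * (2 * Mp ^+ 2 * expR Mp).
  by rewrite mulr_gt0// mulr_gt0 ?expR_gt0// mulr_gt0// exprn_gt0.
pose g3 := dlt / (8 * Dm) / (Mi * (2 * Mp ^+ 2 * expR Mp)).
have g30 : 0 < g3 by rewrite !divr_gt0// mulr_gt0.
have sp0 : 0 < `|sigma| * Mi * Mp + `|sigma| + 1.
  by rewrite ltr_wpDl// addr_ge0// !mulr_ge0// ltW.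
pose e4 := Num.min (dlt / (8 * Dm)) 1 / (`|sigma| * Mi * Mp + `|sigma| + 1).
have e40 : 0 < e4.
  by rewrite divr_gt0// lt_min ltr01 andbT divr_gt0// mulr_gt0.
have [g4 g40 hg4] := cont_on_unif cW e40.
have g50 : 0 < dlt / (2 * Dm) by rewrite divr_gt0// mulr_gt0.
have ms (g : R) : 0 < g -> \forall n \near \oo, t / n.+1%:R < g.
  by move=> g0; have := mesh_small 0 t g0; rewrite subr0.
near=> n => m gap j jn.
have b0 : t / n.+1%:R < 1 by near: n; exact: ms.
have b1 : t / n.+1%:R < g1 by near: n; exact: ms.
have b2 : t / n.+1%:R < g2 by near: n; exact: ms.
have b3 : t / n.+1%:R < g3 by near: n; exact: ms.
have b4 : t / n.+1%:R < g4 by near: n; exact: ms.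
have b5 : t / n.+1%:R < dlt / (2 * Dm) by near: n; exact: ms.
have D0 : 0 < t / n.+1%:R by rewrite divr_gt0// ltr0n.
have {gap} := gap j jn.
rewrite /defect /fine_sum /discI /ito_gap.
set s0 := grid 0 t n j; set s1 := grid 0 t n j.+1.
have inab i : (i <= n.+1)%N -> grid 0 t n i \in `[0, t].
  by move=> iN; rewrite in_itv/= grid_ge// grid_leb.
have s0in : s0 \in `[0, t] by apply: inab; exact: leqW.
have s1in : s1 \in `[0, t] by exact: inab.
have s01 : s0 < s1 by exact: grid_lt.
have sD : s1 - s0 = t / n.+1%:R by rewrite gridS subr0.
have discS : disc I pi t n j w = disc I pi t n j.+1 w * expR (pi s0 w * (t / n.+1%:R)).
  by rewrite /disc -expRD big_ord_recr/= -/s0; congr expR; ring.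
have hS : `|\sum_(i < j.+1) pi (grid 0 t n i) w * (t / n.+1%:R)| <= Mp * t.
  apply: le_trans (ler_norm_sum _ _ _) _.
  apply: (@le_trans _ _ (\sum_(i < j.+1) Mp * (t / n.+1%:R))).
    apply: ler_sum => i _; rewrite normrM (ger0_norm (ltW D0)) ler_wpM2r ?(ltW D0)//.
    by apply: hMp; apply: inab; apply: leq_trans (leqW jn); exact: (ltn_ord i : (i <= j)%N).
  rewrite sumr_const card_ord -[leLHS]mulr_natr -mulrA ler_wpM2l ?(ltW Mp0)//.
  have : s1 <= t by move: s1in; rewrite in_itv/= => /andP[].
  by rewrite /s1 /grid subr0 add0r mulrC.
have DS : disc I pi t n j.+1 w <= Dm.
  rewrite ler_expR lerD2r; move: hS; rewrite ler_norml => /andP[hS1 _].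
  by rewrite lerNl.
have DS0 : 0 < disc I pi t n j.+1 w by exact: expR_gt0.
rewrite discS; set D := disc I pi t n j.+1 w in DS DS0 *; set De := t / n.+1%:R in D0 b0 b1 b2 b3 b4 b5 sD *.
have fin k : (k <= m.+1)%N -> s0 <= finegrid t n m j k <= s1.
  move=> km; rewrite /s0 /s1 -(finegrid0 t n m j) -(finegrid_last t n m j).
  by rewrite !finegrid_le.
have finin k : (k <= m.+1)%N -> finegrid t n m j k \in `[0, t].
  move=> /fin/andP[h1 h2]; move: s0in s1in; rewrite !in_itv/= => /andP[h3 h4] /andP[h5 h6].
  by rewrite (le_trans h3 h1) (le_trans h2 h6).
(* All fine points lie in one coarse cell, so for large n the increments of I are too small for the
   clamp to act. *)
have clampE k : (k < m.+1)%N -> fine_coef I pi sigma t n m dlt j k w =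
    sigma * D * (I (finegrid t n m j k) w - I s0 w).
  move=> km; rewrite /fine_coef -/D -/s0; apply: clampr_id.
  rewrite !normrM (gtr0_norm DS0).
  apply: (@le_trans _ _ ((`|sigma| * Dm + 1) * (dlt / (`|sigma| * Dm + 1)))); last first.
    by rewrite mulrC divfK// gt_eqF.
  apply: ler_pM => //; first by rewrite mulr_ge0// ltW.
    by rewrite ler_wpDr// ler_wpM2l.
  apply/ltW; apply: hg1 => //; first by apply: finin; exact: ltnW.
  have /andP[h1 h2] := fin k (ltnW km).
  by rewrite ger0_norm ?subr_ge0//; lra.
set gp := (X in `|X| < _) => gap.
have tele : \sum_(k < m.+1) (W (finegrid t n m j k.+1) w - W (finegrid t n m j k) w) = W s1 w - W s0 w.
  rewrite -(big_mkord xpredT (fun k => W (finegrid t n m j k.+1) w - W (finegrid t n m j k) w)).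
  by rewrite telescope_sumr// finegrid_last finegrid0.
have sumE : \sum_(k < m.+1) fine_coef I pi sigma t n m dlt j k w *
    (W (finegrid t n m j k.+1) w - W (finegrid t n m j k) w) =
    D * (\sum_(k < m.+1) sigma * I (finegrid t n m j k) w *
     (W (finegrid t n m j k.+1) w - W (finegrid t n m j k) w)) - sigma * D * I s0 w * (W s1 w - W s0 w).
  rewrite -tele !mulr_sumr -sumrB; apply: eq_bigr => k _.
  by rewrite clampE//; ring.
rewrite sumE.
have Iinc : I s1 w - I s0 w = itg (fun s => I s w * pi s w) s0 s1 + (J s1 w - J s0 w).
  rewrite (IJ (jn : (j.+1 <= n.+1)%N)) (IJ (leqW jn)) -/s0 -/s1.
  have /andP[h1 _] : 0 <= s0 <= t by move: s0in; rewrite in_itv.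
  have /andP[_ h2] : 0 <= s1 <= t by move: s1in; rewrite in_itv.
  by rewrite (itg_split cIp (lexx 0) h1 (ltW s01) h2); ring.
set x := pi s0 w * De; set y := sigma * (W s1 w - W s0 w).
(* Three errors: freezing the drift at the left endpoint, replacing the factor exp(x) by its
   linearization, and the gap of the Ito sums. *)
have -> : I s1 w * D - I s0 w * (D * expR x) * (1 + y) -
   (D * (\sum_(k < m.+1) sigma * I (finegrid t n m j k) w *
     (W (finegrid t n m j k.+1) w - W (finegrid t n m j k) w)) - sigma * D * I s0 w * (W s1 w - W s0 w)) =
   D * ((itg (fun s => I s w * pi s w) s0 s1 - I s0 w * pi s0 w * (s1 - s0))
        - I s0 w * ((expR x - 1) * (1 + y) - x) + gp).
  rewrite (_ : I s1 w = I s0 w + (I s1 w - I s0 w)); last by ring.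
  by rewrite Iinc /gp sD /x /y; ring.
rewrite normrM (gtr0_norm DS0).
(* The budget for the three errors is a quarter, a quarter and a half of dlt De. *)
apply: (@le_trans _ _ (Dm * (dlt / (4 * Dm) * De + dlt / (4 * Dm) * De + dlt / (2 * Dm) * De))); last first.
  apply: eqr_le; field; exact: lt0r_neq0.
apply: ler_pM => //; first exact: ltW.
apply: le_trans (ler_normD _ _) _; apply: lerD; last first.
  by apply: (le_trans (ltW gap)); rewrite expr2 ler_wpM2r ?(ltW D0)// ltW.
apply: le_trans (ler_normB _ _) _; apply: lerD.
  rewrite -sD; have /andP[h1 _] : 0 <= s0 <= t by move: s0in; rewrite in_itv.
  have /andP[_ h2] : 0 <= s1 <= t by move: s1in; rewrite in_itv.
  apply: (itg_approx cIp h1 (ltW s01) h2) => s /andP[hs1 hs2].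
  apply/ltW; apply: hg2 => //; last by rewrite ger0_norm ?subr_ge0//; lra.
  by rewrite in_itv/= (le_trans h1 hs1) (le_trans hs2 h2).
have yW : `|W s1 w - W s0 w| < e4.
  by apply: hg4 => //; rewrite gtr0_norm ?subr_gt0// sD.
have yE : `|y| = `|sigma| * `|W s1 w - W s0 w| by rewrite normrM.
have e4S : e4 * (`|sigma| * Mi * Mp + `|sigma| + 1) = Num.min (dlt / (8 * Dm)) 1.
  by rewrite /e4 divfK// gt_eqF.
have mn1 : Num.min (dlt / (8 * Dm)) 1 <= 1 by rewrite ge_min lexx orbT.
have mn2 : Num.min (dlt / (8 * Dm)) 1 <= dlt / (8 * Dm) by rewrite ge_min lexx.
have aa0 : 0 <= `|sigma| * Mi * Mp by rewrite !mulr_ge0// ltW.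
have sW : `|sigma| * `|W s1 w - W s0 w| <= `|sigma| * e4 by rewrite ler_wpM2l// ltW.
have y1 : `|y| <= 1.
  rewrite yE; apply: le_trans sW _; apply: le_trans mn1; rewrite -e4S mulrC.
  by rewrite ler_wpM2l ?(ltW e40)// addrAC lerDr addr_ge0.
have xM : `|x| <= Mp * De.
  by rewrite normrM (gtr0_norm D0) ler_wpM2r ?(ltW D0)//; exact: hMp.
have hx := mul_expR_sub_le (ltW D0) (ltW b0) xM y1 (ltW Mp0).
rewrite normrM.
apply: le_trans (ler_pM (normr_ge0 _) (normr_ge0 _) (hMi _ s0in) hx) _.
rewrite mulrCA [leRHS]mulrC; apply: ler_wpM2l; first exact: ltW.
rewrite mulrDr (_ : dlt / (4 * Dm) = dlt / (8 * Dm) + dlt / (8 * Dm)); last first.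
  field; exact: lt0r_neq0.
apply: lerD.
  rewrite mulrA -ler_pdivlMl// mulrC; exact: ltW.
rewrite yE; apply: le_trans mn2; rewrite -e4S.
have : Mi * (Mp * (`|sigma| * `|W s1 w - W s0 w|)) <= Mi * (Mp * (`|sigma| * e4)).
  by rewrite ler_wpM2l ?(ltW Mi0)// ler_wpM2l ?(ltW Mp0).
move=> h; apply: le_trans h _.
rewrite (_ : Mi * _ = e4 * (`|sigma| * Mi * Mp)); last by ring.
by rewrite ler_wpM2l ?(ltW e40)// -addrA lerDl addr_ge0.
Unshelve. all: by end_near.
Qed.

End path_defect.

Section vanishing_probability.
Context {d : measure_display} {Omega : measurableType d} {R : realType}.
Variable P : probability Omega R.
Implicit Types (S : nat -> set Omega).

Definition vanishing S := (forall n, measurable (S n)) /\ P (S n) @[n --> \oo] --> 0%E.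

Lemma ecvg0P (f : nat -> \bar R) : (forall n, (0 <= f n)%E) ->
  f @ \oo --> 0%E <-> (forall e : R, 0 < e -> \forall n \near \oo, (f n <= e%:E)%E).
Proof.
move=> f0; split=> [/fine_cvgP[fin /cvgrPdist_le cf] e e0|h].
  apply: filterS2 fin (cf e e0) => n fn; rewrite sub0r normrN /= => h.
  rewrite -(fineK fn) lee_fin; apply: le_trans h; exact: ler_norm.
apply/fine_cvgP; split.
  apply: filterS (h 1 ltr01) => n hn; rewrite ge0_fin_numE//.
  exact: le_lt_trans hn (ltry _).
apply/cvgrPdist_le => e e0; apply: filterS (h e e0) => n hn /=.
have fn : f n \is a fin_num by rewrite ge0_fin_numE//; exact: le_lt_trans hn (ltry _).
by rewrite sub0r normrN ger0_norm ?fine_ge0// -lee_fin fineK.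
Qed.

Lemma vanishingP S : (forall n, measurable (S n)) ->
  P (S n) @[n --> \oo] --> 0%E <->
  (forall e : R, 0 < e -> \forall n \near \oo, (P (S n) <= e%:E)%E).
Proof. by move=> mS; apply: ecvg0P => n; exact: measure_ge0. Qed.

Lemma vanishingU S S' : vanishing S -> vanishing S' -> vanishing (fun n => S n `|` S' n).
Proof.
move=> [mS cS] [mS' cS']; split; first by move=> n; exact: measurableU.
apply/vanishingP => [n|e e0]; first exact: measurableU.
have e2 : 0 < e / 2 by rewrite divr_gt0.
have /(_ _ e2) h1 := (vanishingP mS).1 cS; have /(_ _ e2) h2 := (vanishingP mS').1 cS'.
apply: filterS2 h1 h2 => n h1 h2.
apply: le_trans (measureU2 _ (mS n) (mS' n)) _.
by rewrite [e]splitr EFinD leeD.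
Qed.

Lemma vanishing_sub S S' : (forall n, measurable (S n)) -> vanishing S' ->
  (forall n, S n `<=` S' n) -> vanishing S.
Proof.
move=> mS [mS' cS'] SS'; split => //; apply/vanishingP => // e e0.
have /(_ _ e0) := (vanishingP mS').1 cS'; apply: filterS => n; apply: le_trans.
by apply: le_measure; rewrite ?inE.
Qed.

Lemma vanishing_bigU (N : nat) (A : nat -> nat -> set Omega) :
  (forall j, (j < N)%N -> vanishing (A j)) ->
  vanishing (fun n => [set w | exists2 j, (j < N)%N & A j n w]).
Proof.
elim: N => [_|N ih hA].
  rewrite (_ : (fun n => _) = (fun=> set0)).
    by split => // ; rewrite measure0; exact: cvg_cst.
  by apply/funext => n; apply/seteqP; split => w //= -[].
rewrite (_ : (fun n => _) = (fun n => [set w | exists2 j, (j < N)%N & A j n w] `|` A N n)).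
  by apply: vanishingU; [apply: ih => j jN; apply: hA; exact: leqW|exact: hA].
apply/funext => n; apply/seteqP; split => w /=.
  move=> [j]; rewrite ltnS leq_eqVlt => /predU1P[->|jN] Ajw; [by right|left].
  by exists j.
by case=> [[j jN Aj]|AN]; [exists j => //; exact: leqW|exists N].
Qed.

Lemma measurable_bigU (N : nat) (A : nat -> set Omega) :
  (forall j, (j < N)%N -> measurable (A j)) ->
  measurable [set w | exists2 j, (j < N)%N & A j w].
Proof.
elim: N => [_|N ih hA].
  by rewrite (_ : [set _ | _] = set0)//; apply/seteqP; split => w //= -[].
rewrite (_ : [set _ | _] = [set w | exists2 j, (j < N)%N & A j w] `|` A N).
  by apply: measurableU; [apply: ih => j jN; apply: hA; exact: leqW|exact: hA].
apply/seteqP; split => w /=.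
  move=> [j]; rewrite ltnS leq_eqVlt => /predU1P[->|jN] Ajw; [by right|left].
  by exists j.
by case=> [[j jN Aj]|AN]; [exists j => //; exact: leqW|exists N].
Qed.

End vanishing_probability.

(** * Gaps between the Ito integral and its left sums *)

Section ito_partition.
Context {d : measure_display} {Omega : measurableType d} {R : realType}.
Variables (P : probability Omega R) (tau : R) (F : R -> set (set Omega)).
Hypothesis hF : filtration tau F.
Variables (W I J : R -> Omega -> R) (sigma t : R).
Hypotheses (W_ad : adapted tau F W) (I_ad : adapted tau F I) (J_ad : adapted tau F J).
Hypotheses (t0 : 0 < t) (ttau : t <= tau).
Hypothesis J_ito : forall s : R, 0 <= s <= tau ->
  is_ito_integral P (fun s w => sigma * I s w) W s (J s).

Local Notation fg n m k := (finegrid t n m 0 k).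

(** The starting point 0 is left out, as [itv_partition] and [left_sum] expect. *)
Definition fine_partition n j m : seq R := mkseq (fun k => fg n m k.+1) (j * m.+1).

Lemma nth_fine_partition n j m k : (k <= j * m.+1)%N ->
  nth 0 (0 :: fine_partition n j m) k = fg n m k.
Proof.
case: k => [_|k kj] /=; first by rewrite finegrid0 grid0.
by rewrite nth_mkseq.
Qed.

Lemma fine_partition_itv n j m : itv_partition 0 (grid 0 t n j) (fine_partition n j m).
Proof.
split.
  apply/(pathP 0) => k; rewrite size_mkseq => kj.
  rewrite nth_fine_partition ?(ltnW kj)// nth_mkseq//.
  exact: finegrid_lt.
rewrite (last_nth 0) size_mkseq nth_fine_partition//.
by rewrite -(finegrid0 t n m j) /finegrid addn0.
Qed.

Lemma left_sum_fine (H V : R -> Omega -> R) n j m w : left_sum H V (fine_partition n j m) w =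
  \sum_(k < j * m.+1) H (fg n m k) w * (V (fg n m k.+1) w - V (fg n m k) w).
Proof.
rewrite /left_sum size_mkseq; apply: eq_bigr => k _.
by rewrite !nth_fine_partition// ltnW.
Qed.

Lemma mesh_fine_partition n j : (fun m => mesh (fine_partition n j m)) @ \oo --> (0 : R).
Proof.
apply/cvgrPdist_le => e e0.
have := mesh_small 0 t e0; apply: filterS => m; rewrite subr0 => hm.
rewrite sub0r normrN /mesh.
suff /andP[h1 h2] : 0 <= \big[Num.max/0]_(k < size (fine_partition n j m))
    (nth 0 (0 :: fine_partition n j m) k.+1 - nth 0 (0 :: fine_partition n j m) k) <= e.
  by rewrite ger0_norm.
apply: (big_ind (fun x => 0 <= x <= e)).
- by rewrite lexx ltW.
- move=> x y /andP[x0 xe] /andP[y0 ye].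
  by rewrite le_max x0/= ge_max xe.
- move=> k _; have kj : (k < j * m.+1)%N by have := ltn_ord k; rewrite [X in (_ < X)%N -> _]size_mkseq.
  rewrite (nth_fine_partition _ kj) (nth_fine_partition _ (ltnW kj)).
  rewrite subr_ge0 finegrid_le//=.
  rewrite (_ : _ - _ = t / (n.+1 * m.+1)%:R); last first.
    by rewrite /finegrid !mul0n !add0n -natr1; ring.
  apply: le_trans (ltW hm).
  rewrite ler_pM2l// lef_pV2 ?posrE ?ltr0n ?muln_gt0//.
  by rewrite ler_nat leq_pmull.
Qed.

Lemma fine_meas n m j i : (j <= n)%N -> (i <= m.+1)%N ->
  measurable_fun setT (W (finegrid t n m j i)) /\ measurable_fun setT (I (finegrid t n m j i)).
Proof.
move=> jn im; have [_ _ h] := fine_in t0 ttau (jn : (j < n.+1)%N) im.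
by split; apply: (meas_wrt_meas hF h); [exact: W_ad|exact: I_ad].
Qed.

Lemma ito_gap_meas n m j : (j <= n)%N -> measurable_fun setT (fun w => ito_gap W I J sigma t w n m j).
Proof.
move=> jn; have h1 := coarse_in t0 ttau (jn : (j.+1 <= n.+1)%N).
have h2 := coarse_in t0 ttau (leqW jn).
apply: measurable_funB.
  by apply: measurable_funB; [apply: (meas_wrt_meas hF h1)|apply: (meas_wrt_meas hF h2)]; exact: J_ad.
apply: measurable_sum => k.
have [mW mI] := fine_meas jn (ltnW (ltn_ord k)).
have [mW' _] := fine_meas jn (ltn_ord k).
by apply: measurable_funM; [exact: measurable_funM|exact: measurable_funB].
Qed.

(** Convergence of left sums is given only on intervals starting at 0. The partition of [0, s_(j+1)]
    extends that of [0, s_j], so the gap on a cell is the difference of two errors of this kind. *)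
Lemma ito_gap_vanishing n : vanishing P (fun m =>
  [set w | exists2 j, (j < n.+1)%N & (t / n.+1%:R) ^+ 2 <= `|ito_gap W I J sigma t w n m j|]).
Proof.
apply: (vanishing_bigU (A := fun j m => [set w | (t / n.+1%:R) ^+ 2 <= `|ito_gap W I J sigma t w n m j|])).
move=> j jn; set e := (t / n.+1%:R) ^+ 2.
have e0 : 0 < e by rewrite exprn_gt0// divr_gt0// ltr0n.
have e2 : 0 < e / 2 by rewrite divr_gt0.
pose L i m w := left_sum (fun s w => sigma * I s w) W (fine_partition n i m) w.
have mL i m : (i <= n.+1)%N -> measurable_fun setT (L i m).
  move=> iN; rewrite [X in measurable_fun _ X](_ : _ = (fun w =>
    \sum_(k < i * m.+1) sigma * I (fg n m k) w * (W (fg n m k.+1) w - W (fg n m k) w))); last first.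
    by apply/funext => w; rewrite /L left_sum_fine.
  apply: measurable_sum => -[k /= kN].
  have h : forall k', (k' <= n.+1 * m.+1)%N -> 0 <= fg n m k' <= tau.
    move=> k' k'N; have h0 : 0 <= fg n m k' by rewrite -(grid0 0 t n) -(finegrid0 t n m 0) finegrid_le.
    rewrite h0/=; apply: le_trans ttau.
    rewrite -[leRHS](grid_last 0 t n) -(finegrid0 t n m n.+1).
    have h1 : fg n m k' <= fg n m (n.+1 * m.+1) by exact: finegrid_le.
    by move: h1; rewrite /finegrid mul0n !add0n addn0.
  have kN2 : (k < n.+1 * m.+1)%N by apply: leq_trans kN _; rewrite leq_mul2r iN orbT.
  have h1 := h k (ltnW kN2); have h2 := h k.+1 kN2.
  have mI : measurable_fun setT (I (fg n m k)) by apply: (meas_wrt_meas hF h1); exact: I_ad.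
  have mW : measurable_fun setT (W (fg n m k)) by apply: (meas_wrt_meas hF h1); exact: W_ad.
  have mW' : measurable_fun setT (W (fg n m k.+1)) by apply: (meas_wrt_meas hF h2); exact: W_ad.
  by apply: measurable_funM; [exact: measurable_funM|exact: measurable_funB].
have vL i : (i <= n.+1)%N -> vanishing P (fun m => [set w | e / 2 <= `|L i m w - J (grid 0 t n i) w|]).
  move=> iN; have hi := coarse_in t0 ttau iN; split.
    move=> m; apply/measurable_ge_abs/measurable_funB; first exact: mL.
    by apply: (meas_wrt_meas hF hi); exact: J_ad.
  exact: (J_ito hi (fun m => fine_partition_itv n i m) (mesh_fine_partition n i)).
apply: vanishing_sub (vanishingU (vL j.+1 jn) (vL j (ltnW jn))) _.
  by move=> m; apply: measurable_ge_abs; exact: ito_gap_meas.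
move=> m w /= h; have [h1|h1] := leP (e / 2) `|L j.+1 m w - J (grid 0 t n j.+1) w|; [by left|right].
have gE : ito_gap W I J sigma t w n m j =
    (L j m w - J (grid 0 t n j) w) - (L j.+1 m w - J (grid 0 t n j.+1) w).
  rewrite /ito_gap /L !left_sum_fine mulSn addnC big_split_ord/=.
  rewrite (_ : \sum_(k < m.+1) sigma * I (fg n m (j * m.+1 + k)) w *
    (W (fg n m (j * m.+1 + k).+1) w - W (fg n m (j * m.+1 + k)) w) =
    \sum_(k < m.+1) sigma * I (finegrid t n m j k) w *
     (W (finegrid t n m j k.+1) w - W (finegrid t n m j k) w)); first by ring.
  apply: eq_bigr => k _.
  have E i : fg n m (j * m.+1 + i) = finegrid t n m j i by rewrite /finegrid mul0n add0n.
  by rewrite -addnS !E.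
rewrite gE in h.
have := ler_normB (L j m w - J (grid 0 t n j) w) (L j.+1 m w - J (grid 0 t n j.+1) w).
move=> h2; lra.
Qed.

End ito_partition.

(** * Closed form of the index *)

Section geometric_solution.
Context {d : measure_display} {Omega : measurableType d} {R : realType}.
Variables (P : probability Omega R) (tau : R) (F : R -> set (set Omega)).
Hypothesis hF : filtration tau F.
Variables (W I J pi : R -> Omega -> R) (sigma t : R).
Hypotheses (W_ad : adapted tau F W) (I_ad : adapted tau F I)
  (J_ad : adapted tau F J) (pi_ad : adapted tau F pi).
Hypothesis W_inc : gaussian_increments P tau F W.
Hypothesis W_cont : {ae P, forall w, cont_on 0 tau (W ^~ w)}.
Hypotheses (I_cont : forall w, cont_on 0 tau (I ^~ w)) (pi_cont : forall w, cont_on 0 tau (pi ^~ w)).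
Hypothesis I0_gt0 : forall w, 0 < I 0 w.
Hypothesis J_ito : forall s : R, 0 <= s <= tau ->
  is_ito_integral P (fun s w => sigma * I s w) W s (J s).
Hypothesis I_eq : forall s : R, 0 <= s <= tau ->
  {ae P, forall w, I s w = I 0 w + itg (fun s => I s w * pi s w) 0 s + J s w}.
Hypotheses (t0 : 0 < t) (ttau : t <= tau).

Lemma discrete_expE n j w : discrete_exp W sigma t n j w =
  expR (sigma * (W (grid 0 t n j) w - W 0 w) - sigma ^+ 2 * (j%:R * (t / n.+1%:R)) / 2).
Proof.
elim: j => [|j ih].
  by rewrite /discrete_exp big_ord0 grid0 subrr mul0r !mulr0 mul0r subrr expR0.
rewrite /discrete_exp big_ord_recr /= -/(discrete_exp W sigma t n j w) ih /expmart -expRD.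
by rewrite -natr1; congr expR; field.
Qed.

Lemma discrete_exp_last n w : discrete_exp W sigma t n n.+1 w =
  expR (sigma * (W t w - W 0 w) - sigma ^+ 2 * t / 2).
Proof.
rewrite discrete_expE grid_last; congr (expR (_ - sigma ^+ 2 * _ / 2)).
by rewrite mulrCA divff ?mulr1// pnatr_eq0.
Qed.

Lemma discI_last_cvg w : discI I pi t n n.+1 w @[n --> \oo] -->
  I t w * expR (- itg (pi ^~ w) 0 t - ln (I 0 w)).
Proof.
rewrite (_ : (fun n => _) = (fun n => I t w * disc I pi t n n.+1 w)); last first.
  by apply/funext => n; rewrite /discI grid_last.
apply: cvgM; first exact: cvg_cst.
apply: continuous_cvg; first exact: continuous_expR.
apply: cvgB; last exact: cvg_cst.
apply: cvgN.
have := riemann_sum_cvg (ltW t0) (cont_onS (lexx 0) ttau (pi_cont (w := w))).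
by rewrite subr0.
Qed.

(* The limit in probability defining the Ito integral comes without a rate, so m
   has to be chosen in terms of n. *)
Lemma defect_vanishing : exists m : nat -> nat, forall dlt, 0 < dlt ->
  vanishing P (fun n => [set w | exists2 j, (j < n.+1)%N &
     dlt * (t / n.+1%:R) < `|defect W I pi sigma t n (m n) dlt j w|]).
Proof.
pose Rset n m := [set w | exists2 j, (j < n.+1)%N & (t / n.+1%:R) ^+ 2 <= `|ito_gap W I J sigma t w n m j|].
have hR n : vanishing P (Rset n) := ito_gap_vanishing hF W_ad I_ad J_ad t0 ttau J_ito n.
have /choice[m hm] : forall n, exists m, (P (Rset n m) <= (n.+1%:R^-1)%:E)%E.
  move=> n; have [mR cR] := hR n.
  have n0 : (0 : R) < n.+1%:R^-1 by rewrite invr_gt0 ltr0n.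
  by have /filter_ex[m hm] := (vanishingP P mR).1 cR _ n0; exists m.
exists m => dlt d0.
have mR n : measurable (Rset n (m n)) by have [+ _] := hR n; apply.
have vR : vanishing P (fun n => Rset n (m n)).
  split => //; apply/vanishingP => // e e0.
  have := mesh_small 0 1 e0; rewrite subr0; apply: filterS => n hn.
  by apply: le_trans (hm n) _; rewrite lee_fin; move: hn; rewrite mul1r => /ltW.
pose S n := [set w | exists2 j, (j < n.+1)%N &
     dlt * (t / n.+1%:R) < `|defect W I pi sigma t n (m n) dlt j w|].
have mS n : measurable (S n).
  apply: (measurable_bigU (A := fun j => [set w | dlt * (t / n.+1%:R) < `|defect W I pi sigma t n (m n) dlt j w|])).
  move=> j jn; have hj := coarse_in t0 ttau (jn : (j.+1 <= n.+1)%N).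
  have mdef : measurable_fun setT (defect W I pi sigma t n (m n) dlt j).
    apply: (meas_wrt_meas hF hj).
    exact: (defect_meas_wrt hF sigma W_ad I_ad pi_ad W_inc t0 ttau (m n) (ltW d0) (jn : (j <= n)%N)).
  have mn : measurable_fun setT (fun w => `|defect W I pi sigma t n (m n) dlt j w|).
    exact: measurableT_comp.
  rewrite (_ : [set w | _] = setT `&` (fun w => `|defect W I pi sigma t n (m n) dlt j w|) @^-1` `]dlt * (t / n.+1%:R), +oo[%classic).
    exact: mn.
  by apply/seteqP; split => w /=; rewrite in_itv/= andbT; [split|case].
(* Off the event of a large gap, [path_defect] applies, but from an n on that depends on the path;
   the almost sure statement is then converted into one about probabilities. *)
have vSR : vanishing P (fun n => S n `\` Rset n (m n)).
  split; first by move=> n; exact: measurableD.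
  apply: eventually_notin_cvg0; first by move=> n; exact: measurableD.
  have aeI : {ae P, forall w, forall n j, (j <= n.+1)%N -> I (grid 0 t n j) w =
      I 0 w + itg (fun s => I s w * pi s w) 0 (grid 0 t n j) + J (grid 0 t n j) w}.
    apply: ae_foralln => n; apply: ae_foralln => j.
    have [jn|jn] := leqP j n.+1; last by apply: aeW => w.
    by apply: filterS (I_eq (coarse_in t0 ttau jn)) => w.
  apply: filterS2 aeI W_cont => w hI cW.
  have := path_defect sigma t0 (cont_onS (lexx 0) ttau (I_cont (w := w)))
    (cont_onS (lexx 0) ttau (pi_cont (w := w))) (cont_onS (lexx 0) ttau cW) hI d0.
  apply: filterS => n hn [[j jn]]; rewrite ltNge => /negP h nR; apply: h.
  apply: hn => // i iN; rewrite ltNge; apply/negP => h; apply: nR.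
  by exists i.
apply: (vanishing_sub mS (vanishingU vR vSR)) => n w Sw.
have [Rw|nR] := pselect (Rset n (m n) w); first by left.
by right.
Qed.

(** The tolerance e is split in three: the probability that a clamp on a defect acts, and the two
    parts of [euler_err] in Chebyshev's inequality, one made small by dlt and the other by the
    step. *)
Lemma discI_cvg_proba : cvg_in_probability P (fun n w => discI I pi t n n.+1 w)
  (fun w => expR (sigma * (W t w - W 0 w) - sigma ^+ 2 * t / 2)).
Proof.
move=> eta eta0; have [m hm] := defect_vanishing.
have tt := ltW t0.
have tin : 0 <= t <= tau by rewrite tt.
have zin : 0 <= (0 : R) <= tau by rewrite lexx (le_trans tt ttau).
pose Z n w := discI I pi t n n.+1 w - expR (sigma * (W t w - W 0 w) - sigma ^+ 2 * t / 2).
have mWt : measurable_fun setT (W t) by apply: (meas_wrt_meas hF tin); exact: W_ad.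
have mW0 : measurable_fun setT (W 0) by apply: (meas_wrt_meas hF zin); exact: W_ad.
have mZ n : measurable_fun setT (Z n).
  apply: measurable_funB.
    apply: (meas_wrt_meas hF (coarse_in t0 ttau (leqnn n.+1))).
    exact: (discI_meas_wrt hF I_ad pi_ad t0 ttau (leqnn n.+1)).
  apply: measurableT_comp => //; apply: measurable_funB => //.
  by apply: measurable_funM => //; exact: measurable_funB.
have mS n : measurable [set w | eta <= `|Z n w|] by exact: measurable_ge_abs.
apply/(vanishingP P mS) => e e0.
pose K := expR (euler_rate sigma t * t).
have K0 : 0 < K by exact: expR_gt0.
pose c1 := eta ^- 2 * t * (1 + t) * K.
have c10 : 0 < c1 by rewrite !mulr_gt0// ?invr_gt0 ?exprn_gt0// addr_gt0.
have C0 : 0 <= msqC :> R := msqC_ge0.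
(* Chosen so that the part of the Chebyshev bound proportional to dlt^2 is exactly e / 3. *)
pose dlt := Num.sqrt (e / 3 / (c1 * (3 * msqC + 1))).
have dd0 : 0 < e / 3 / (c1 * (3 * msqC + 1)).
  by rewrite !divr_gt0// mulr_gt0// ltr_wpDl// mulr_ge0.
have dlt0 : 0 < dlt by rewrite sqrtr_gt0.
have dlt2 : dlt ^+ 2 = e / 3 / (c1 * (3 * msqC + 1)) by rewrite sqr_sqrtr// ltW.
have [mSn cSn] := hm dlt dlt0.
have e3 : 0 < e / 3 by rewrite divr_gt0.
pose c2 := c1 * (3 * (expR (sigma ^+ 2 * t) * remC sigma t)) + 1.
have c20 : 0 < c2.
  rewrite /c2 ltr_wpDl// mulr_ge0 ?(ltW c10)// mulr_ge0// mulr_ge0 ?expR_ge0//.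
  exact: remC_ge0.
have e4 : 0 < e / 3 / c2 by rewrite divr_gt0.
have /(_ _ e3) h1 := (vanishingP P mSn).1 cSn.
have h2 := mesh_small 0 t e4; rewrite subr0 in h2.
apply: filterS2 h1 h2 => n h1 h2.
have [_ sE E2] := perturbed_euler_close hF sigma W_ad I_ad pi_ad W_inc t0 ttau (m n) (ltW dlt0) (leqnn n.+1).
set E := (fun w => _) in sE E2.
have mA : measurable [set w | eta <= `|E w|] by apply: measurable_ge_abs; exact: sE.1.
apply: (@le_trans _ _ (P ([set w | exists2 j, (j < n.+1)%N &
     dlt * (t / n.+1%:R) < `|defect W I pi sigma t n (m n) dlt j w|] `|` [set w | eta <= `|E w|]))).
  apply: le_measure; rewrite ?inE//; first exact: measurableU.
  move=> w /= hw.
  have [hS|hS] := pselect (exists2 j, (j < n.+1)%N &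
     dlt * (t / n.+1%:R) < `|defect W I pi sigma t n (m n) dlt j w|); [by left|right].
  rewrite /E (perturbed_eulerE (I0_gt0 w)); last first.
    by move=> i iN; rewrite leNgt; apply/negP => h; apply: hS; exists i.
  by rewrite discrete_exp_last.
apply: le_trans (measureU2 _ (mSn n) mA) _.
rewrite (_ : e = e / 3 + (e / 3 + e / 3)); last by field.
rewrite EFinD; apply: leeD => //.
apply: le_trans (chebyshev_meansq eta0 sE) _; rewrite lee_fin.
apply: (@le_trans _ _ (eta ^- 2 * (t * euler_err sigma t dlt (t / n.+1%:R) * K))).
  apply: ler_wpM2l; first by rewrite invr_ge0 exprn_ge0// ltW.
  have n0 : n.+1%:R != 0 :> R by rewrite pnatr_eq0.
  apply: le_trans E2 _; apply: eqr_le.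
  by rewrite (_ : n.+1%:R * (t / n.+1%:R) = t)// mulrCA divff// mulr1.
rewrite (_ : _ * _ = c1 * (3 * (expR (sigma ^+ 2 * t) * remC sigma t)) * (t / n.+1%:R) +
   dlt ^+ 2 * (c1 * (3 * msqC + 1))); last first.
  by rewrite /euler_err /c1; generalize (t / n.+1%:R) => z; ring.
apply: lerD; last first.
  by rewrite dlt2 divfK// gt_eqF// mulr_gt0// ltr_wpDl// mulr_ge0.
have D0 : 0 < t / n.+1%:R by rewrite divr_gt0// ltr0n.
apply: (@le_trans _ _ (c2 * (t / n.+1%:R))).
  by apply: (ler_wpM2r (ltW D0)); rewrite lerDl.
by rewrite mulrC -ler_pdivlMr// ltW.
Qed.

(** The last term of [discI] tends along each path to the discounted index, and in probability to
    the exponential martingale; the two limits agree almost surely. *)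
Lemma geometric_sde_solution : {ae P, forall w,
  I t w = I 0 w * expR (itg (pi ^~ w) 0 t + sigma * (W t w - W 0 w) - sigma ^+ 2 * t / 2)}.
Proof.
have tin : 0 <= t <= tau by rewrite (ltW t0).
have zin : 0 <= (0 : R) <= tau by rewrite lexx (le_trans (ltW t0) ttau).
have mWt : measurable_fun setT (W t) by apply: (meas_wrt_meas hF tin); exact: W_ad.
have mW0 : measurable_fun setT (W 0) by apply: (meas_wrt_meas hF zin); exact: W_ad.
have mD n : measurable_fun setT (discI I pi t n n.+1).
  apply: (meas_wrt_meas hF (coarse_in t0 ttau (leqnn n.+1))).
  exact: (discI_meas_wrt hF I_ad pi_ad t0 ttau (leqnn n.+1)).
have := @cvg_proba_eq _ _ _ P (fun n w => discI I pi t n n.+1 w)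
  (fun w => I t w * expR (- itg (pi ^~ w) 0 t - ln (I 0 w)))
  (fun w => expR (sigma * (W t w - W 0 w) - sigma ^+ 2 * t / 2)) mD.
have hlim : forall w, setT w -> discI I pi t n n.+1 w @[n --> \oo] --> I t w * expR (- itg (pi ^~ w) 0 t - ln (I 0 w)).
  by move=> w _; exact: discI_last_cvg.
move=> /(_ (measurable_fun_cvg mD hlim)).
have mexp : measurable_fun setT (fun w => expR (sigma * (W t w - W 0 w) - sigma ^+ 2 * t / 2)).
  apply: measurableT_comp => //; apply: measurable_funB => //.
  by apply: measurable_funM => //; exact: measurable_funB.
move=> /(_ mexp (aeW _ (fun w => hlim w Logic.I)) discI_cvg_proba).
apply: filterS => w hw.
have -> : itg (pi ^~ w) 0 t + sigma * (W t w - W 0 w) - sigma ^+ 2 * t / 2 =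
   itg (pi ^~ w) 0 t + (sigma * (W t w - W 0 w) - sigma ^+ 2 * t / 2) by ring.
rewrite expRD -hw [X in _ * X]mulrCA -expRD.
rewrite (_ : itg _ _ _ + _ = - ln (I 0 w)); last by ring.
by rewrite expRN lnK ?posrE// mulrCA divff ?mulr1// gt_eqF.
Qed.

End geometric_solution.

(** * Exponentials of Gaussian limits *)

Section uniform_integrability.
Context {d : measure_display} {Omega : measurableType d} {R : realType}.
Variable P : probability Omega R.

(** Since min(Z_n, K) >= Z_n - Z_n^2 / K, truncation at K changes the means by at most C / K,
    uniformly in n. Dominated convergence handles n for fixed K, and monotone convergence handles
    K. *)
Lemma integral_lim_sq_bounded (Z_ : nat -> Omega -> R) (Z : Omega -> R) (a_ : nat -> R) (a C : R) :
  (forall n, sqint P (Z_ n)) -> (forall n w, 0 <= Z_ n w) ->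
  measurable_fun setT Z -> (forall w, 0 <= Z w) ->
  {ae P, forall w, Z_ n w @[n --> \oo] --> Z w} ->
  (forall n, \int[P]_w Z_ n w = a_ n) -> a_ @ \oo --> a ->
  (forall n, meansq P (Z_ n) <= C) ->
  (\int[P]_w (Z w)%:E = a%:E)%E.
Proof.
move=> sZ Z0_ mZ Z0 cZ intZ ca msqZ.
have C0 : 0 <= C by apply: le_trans (msqZ 0); exact: meansq_ge0.
pose mn K (f : Omega -> R) w := Num.min (f w) K.
have mmn (K : R) (f : Omega -> R) : measurable_fun setT f -> measurable_fun setT (mn K f).
  by move=> mf; exact: measurable_minr.
have mnb (K : R) (f : Omega -> R) : 0 < K -> (forall w, 0 <= f w) -> forall w, `|mn K f w| <= K.
  move=> K0 f0 w; rewrite ger0_norm ?ge_min ?lexx ?orbT//.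
  by rewrite le_min f0 ltW.
have L1mn (K : R) (f : Omega -> R) : 0 < K -> measurable_fun setT f -> (forall w, 0 <= f w) -> L1 P (mn K f).
  by move=> K0 mf f0; apply: sqint_L1; exact: sqint_bounded (mmn K f mf) (mnb K f K0 f0).
have lower (K : R) n : 0 < K -> a_ n - C / K <= \int[P]_w mn K (Z_ n) w.
  move=> K0; have sn := sZ n; have LZ := sqint_L1 sn.
  rewrite lerBlDr.
  apply: (@le_trans _ _ (\int[P]_w (mn K (Z_ n) w + K^-1 * Z_ n w ^+ 2))).
    rewrite -intZ; apply: le_Rintegral => //.
      apply: L1D; first exact: L1mn sn.1 (Z0_ n).
      exact: L1Z sn.2.
    move=> w _; rewrite /mn; have z0 := Z0_ n w.
    have [zK|zK] := leP (Z_ n w) K; first by rewrite lerDl mulr_ge0 ?sqr_ge0// invr_ge0 ltW.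
    apply: ler_wpDl; first exact: ltW.
    rewrite mulrC ler_pdivlMr// expr2 ler_wpM2l// ltW//.
  rewrite RintegralD//; [|exact: L1mn sn.1 (Z0_ n)|exact: L1Z sn.2].
  rewrite lerD2l RintegralZl//; last exact: sn.2.
  by rewrite mulrC ler_wpM2r ?invr_ge0 ?(ltW K0)//; exact: msqZ.
have upper (K : R) n : 0 < K -> \int[P]_w mn K (Z_ n) w <= a_ n.
  move=> K0; rewrite -intZ; apply: le_Rintegral => //.
  - exact: L1mn (sZ n).1 (Z0_ n).
  - exact: sqint_L1.
  - by move=> w _; rewrite /mn ge_min lexx.
have cmn (K : R) : 0 < K -> \int[P]_w mn K (Z_ n) w @[n --> \oo] --> \int[P]_w mn K Z w.
  move=> K0.
  have [] := @dominated_convergence _ _ _ P setT measurableT (fun n w => (mn K (Z_ n) w)%:E)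
    (fun w => (mn K Z w)%:E) (fun=> K%:E).
  - by move=> n; apply/measurable_EFinP/mmn; exact: (sZ n).1.
  - exact/measurable_EFinP/mmn.
  - apply: filterS cZ => w hw _; apply: cvg_EFin; first exact: nearW.
    have cmin : continuous (fun x : R => Num.min x K).
      move=> x; apply: (@continuous_min _ _ (id : R -> R^o) (fun=> K : R^o) x).
        exact: cvg_id.
      exact: cvg_cst.
    exact: (cvg_comp _ _ hw (cmin (Z w))).
  - exact: L1_cst.
  - by apply: aeW => w n _; rewrite lee_fin; exact: mnb.
  move=> _ _; rewrite L1_EFin; last exact: L1mn.
  by move=> /fine_cvg.
have bnd (K : R) : 0 < K -> a - C / K <= \int[P]_w mn K Z w <= a.
  move=> K0; apply/andP; split.
    have hc : (a_ n - C / K) @[n --> \oo] --> a - C / K by apply: cvgB => //; exact: cvg_cst.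
    by apply: (ler_cvg_to hc (cmn K K0)); apply: nearW => n; exact: lower.
  by apply: (ler_cvg_to (cmn K K0) ca); apply: nearW => n; exact: upper.
have h1 : (\int[P]_w mn k.+1%:R Z w) @[k --> \oo] --> a.
  apply: (@squeeze_cvgr _ _ _ _ (fun k => a - C / k.+1%:R) (fun=> a)).
  - by apply: nearW => k; apply: bnd; rewrite ltr0n.
  - rewrite -[X in _ --> X]subr0; apply: cvgB; first exact: cvg_cst.
    apply/cvgrPdist_lt => e e0; have := mesh_small 0 C e0.
    rewrite subr0; apply: filterS => k hk; rewrite sub0r normrN ger0_norm//.
    by rewrite divr_ge0.
  - exact: cvg_cst.
have h2 : ((\int[P]_w mn k.+1%:R Z w)%:E @[k --> \oo] --> a%:E)%E.
  by apply: cvg_EFin => //; exact: nearW.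
have h3 : ((\int[P]_w mn k.+1%:R Z w)%:E @[k --> \oo] --> \int[P]_w (Z w)%:E)%E.
  rewrite (_ : (fun k => _) = (fun k => \int[P]_w (mn k.+1%:R Z w)%:E)%E); last first.
    by apply/funext => k; rewrite L1_EFin//; apply: L1mn => //; rewrite ltr0n.
  rewrite (_ : \int[P]_w (Z w)%:E = \int[P]_w (limn (fun k => (mn k.+1%:R Z w)%:E)))%E; last first.
    apply: eq_integral => w _; apply/esym/cvg_lim => //.
    apply: cvg_EFin; first exact: nearW.
    apply: (@cvg_near_cst _ _ _ _ _ _).
    exists (Num.trunc (Z w)) => // k /= hk; rewrite /mn /=; apply: min_l.
    by apply/ltW/(lt_le_trans (truncnS_gt _)); rewrite ler_nat.
  apply: cvg_monotone_convergence => //.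
  - by move=> k; apply/measurable_EFinP/mmn.
  - by move=> k w _; rewrite lee_fin le_min Z0/=.
  - move=> w _ k l kl; rewrite lee_fin /mn le_min !ge_min lexx/=.
    by rewrite ler_nat ltnS kl orbT.
exact: cvg_unique h3 h2.
Qed.

End uniform_integrability.

Section conditional_expectation_unique.
Context {d : measure_display} {Omega : measurableType d} {R : realType}.
Variable P : probability Omega R.

(** Integrability of q is not assumed, so q and y are compared on sets where both are bounded and
    their difference has a fixed sign; such sets are null. The hypothesis asks only for sets on
    which y is bounded, because the Gaussian limit is available for bounded weights. *)
Lemma ae_eq_of_integrals (G : set (set Omega)) (q y : Omega -> R) :
  sigma_algebra setT G -> G `<=` measurable ->
  measurable_wrt G q -> measurable_wrt G y ->
  (forall A N, G A -> (forall w, A w -> `|y w| <= N) ->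
     (\int[P]_(w in A) (q w)%:E = \int[P]_(w in A) (y w)%:E)%E) ->
  {ae P, forall w, q w = y w}.
Proof.
move=> sG Gm mq my hqy.
have mqG : measurable_fun [set: g_sigma_algebraType G] q by apply/measurable_wrtP.
have myG : measurable_fun [set: g_sigma_algebraType G] y by apply/measurable_wrtP.
have mq' := sub_measurable_fun sG Gm mq; have my' := sub_measurable_fun sG Gm my.
have GI A B : G A -> G B -> G (A `&` B).
  have := @measurableI _ (g_sigma_algebraType G) A B.
  by rewrite measurable_g_measurableTypeE.
have key (s : R) : s = 1 \/ s = -1 -> {ae P, forall w, s * (y w - q w) <= 0}.
  move=> hs.
  pose f w := s * (y w - q w).
  have mf : measurable_wrt G f.
    apply/measurable_wrtP => //; apply: measurable_funM => //; exact: measurable_funB.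
  have mf' := sub_measurable_fun sG Gm mf.
  pose A (N : nat) := q @^-1` `[- N%:R, N%:R] `&` y @^-1` `[- N%:R, N%:R] `&` f @^-1` `]0, +oo[.
  have GA N : G (A N).
    have Gq : G (q @^-1` `[- N%:R, N%:R]) by exact: mq.
    have Gy : G (y @^-1` `[- N%:R, N%:R]) by exact: my.
    have Gf : G (f @^-1` `]0, +oo[) by exact: mf.
    exact: (GI _ _ (GI _ _ Gq Gy) Gf).
  have notA N : {ae P, forall w, ~ A N w}.
    have mA := Gm _ (GA N).
    have intA (g : Omega -> R) : measurable_fun setT g -> (forall w, A N w -> `|g w| <= N%:R) ->
        P.-integrable (A N) (EFin \o g).
      move=> mg gN; apply: (@le_integrable _ _ _ _ _ mA _ (EFin \o cst N%:R)) => //.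
      - exact/measurable_EFinP/measurable_funTS.
      - by move=> w Aw; rewrite /= lee_fin [leRHS]ger0_norm//; exact: gN.
      - exact: (integrableS measurableT mA (@subsetT _ _) (L1_cst P N%:R)).
    have qN w : A N w -> `|q w| <= N%:R.
      by move=> [[+ _] _]; rewrite /= in_itv/= ler_norml.
    have yN w : A N w -> `|y w| <= N%:R.
      by move=> [[_ +] _]; rewrite /= in_itv/= ler_norml.
    have iq := intA q mq' qN; have iy := intA y my' yN.
    have E0 : (\int[P]_(w in A N) `|(EFin \o f) w| = 0)%E.
      transitivity (\int[P]_(w in A N) (s * (y w - q w))%:E)%E.
        apply: eq_integral => w; rewrite inE => -[_]; rewrite /= in_itv/= andbT => f0.
        by rewrite gtr0_norm.
      under eq_integral do rewrite EFinM.
      rewrite integralZl//; last exact: (integrableB mA iy iq).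
      by rewrite integralB_EFin// (hqy _ _ (GA N) yN) subee ?mule0//; exact: integrable_fin_num.
    have mfA : measurable_fun (A N) (EFin \o f) by apply/measurable_EFinP/measurable_funTS.
    have := (ae_eq_integral_abs P mA mfA).1 E0.
    apply: filterS => w h Aw; have := h Aw; have [_] := Aw.
    by rewrite /= in_itv/= andbT => f0 [f00]; rewrite f00 ltxx in f0.
  apply: filterS (ae_foralln notA) => w hw.
  rewrite leNgt; apply/negP => f0.
  pose N := (Num.trunc (`|q w| + `|y w|)).+1.
  have hN : `|q w| + `|y w| <= N%:R by exact/ltW/truncnS_gt.
  apply: (hw N); split; last by rewrite /= in_itv/= andbT.
  split; rewrite /= in_itv/= -ler_norml; apply: le_trans hN.
    by rewrite lerDl.
  by rewrite lerDr.
have k1 := key 1 (or_introl erefl); have k2 := key (-1) (or_intror erefl).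
apply: filterS2 k1 k2 => w h1 h2; apply: le_anti; apply/andP; split; lra.
Qed.

End conditional_expectation_unique.

(** * Exponential moments of sums of Brownian increments *)

Section gaussian_sums.
Context {d : measure_display} {Omega : measurableType d} {R : realType}.
Variables (P : probability Omega R) (tau : R) (F : R -> set (set Omega)).
Hypothesis hF : filtration tau F.
Variables (rho : R) (Wr WI Wp : R -> Omega -> R).
Hypothesis hW : brownian_motion3 P tau F rho Wr WI Wp.

Definition lincomb (ur uI up s t : R) (w : Omega) : R :=
  ur * (Wr t w - Wr s w) + uI * (WI t w - WI s w) + up * (Wp t w - Wp s w).

Definition lincomb_var (ur uI up : R) : R :=
  ur ^+ 2 + uI ^+ 2 + up ^+ 2 + 2 * rho * ur * up.

Section increment.
Variables (ur uI up s t : R) (s0 : 0 <= s) (st : s < t) (tT : t <= tau).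

Let hs : 0 <= s <= tau. Proof. by rewrite s0 (le_trans (ltW st)). Qed.
Let ht : 0 <= t <= tau. Proof. by rewrite (le_trans s0 (ltW st)). Qed.

Lemma lincomb_meas_wrt : measurable_wrt (F t) (lincomb ur uI up s t).
Proof.
have [[ar aI ap] _ _ _ _] := hW.
have inc V u : adapted tau F V -> measurable_wrt (F t) (fun w => u * (V t w - V s w)).
  move=> aV; apply: (meas_wrtM hF ht); first exact: (meas_wrt_cst hF ht).
  apply: (meas_wrtB hF ht); first exact: aV.
  by apply: (meas_wrt_le hF s0 (ltW st) tT); exact: aV.
by apply: (meas_wrtD hF ht); [apply: (meas_wrtD hF ht)|]; exact: inc.
Qed.

Lemma lincomb_indep : indep_of P (F s) (lincomb ur uI up s t).
Proof.
have [_ _ _ hind _] := hW => A B FA mB.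
pose f (x : R * R * R) : R := ur * x.1.1 + uI * x.1.2 + up * x.2.
have mf : measurable_fun setT f.
  have m1 : measurable_fun setT (fun x : R * R * R => x.1.1) by exact: measurableT_comp measurable_fst measurable_fst.
  have m2 : measurable_fun setT (fun x : R * R * R => x.1.2) by exact: measurableT_comp measurable_snd measurable_fst.
  have m3 : measurable_fun setT (fun x : R * R * R => x.2) by exact: measurable_snd.
  apply: measurable_funD; first apply: measurable_funD.
  - exact: measurable_funM.
  - exact: measurable_funM.
  - exact: measurable_funM.
have mfB : measurable (f @^-1` B) by rewrite -[X in measurable X]setTI; exact: mf.
exact: hind s t s0 st tT A (f @^-1` B) FA mfB.
Qed.

Lemma lincomb_sym_gaussian : sym_gaussian P (lincomb ur uI up s t) ((t - s) * lincomb_var ur uI up).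
Proof.
have [_ _ _ _ hg] := hW; split.
- by apply: (meas_wrt_meas hF ht); exact: lincomb_meas_wrt.
- exact: hg s t s0 st tT ur uI up.
- have := hg s t s0 st tT (- ur) (- uI) (- up).
  rewrite (_ : (fun w => _) = (fun w => - lincomb ur uI up s t w)); last first.
    by apply/funext => w; rewrite /lincomb; ring.
  rewrite [X in centered_gaussian _ _ (_ * X)](_ : _ = lincomb_var ur uI up)//.
  by rewrite /lincomb_var; ring.
Qed.

End increment.

(** Induction that splits off the last increment: it is independent of the past, to which [Y] and
    the earlier increments belong. The weight [Y] carries the conditioning on the initial time. *)
Lemma gaussian_sum_expR (u : nat -> R) (m : nat) (ar aI ap : nat -> R) (Y : Omega -> R) :
  0 <= u 0 -> (forall i, (i < m)%N -> u i < u i.+1) -> u m <= tau ->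
  measurable_wrt (F (u 0)) Y -> (forall w, 0 <= Y w) ->
  let G w := \sum_(i < m) lincomb (ar i) (aI i) (ap i) (u i) (u i.+1) w in
  measurable_wrt (F (u m)) G /\
  (\int[P]_w (Y w * expR (G w))%:E = (\int[P]_w (Y w)%:E) *
    (expR ((\sum_(i < m) (u i.+1 - u i) * lincomb_var (ar i) (aI i) (ap i)) / 2))%:E)%E.
Proof.
move=> u0 lu um mY Y0.
have main : forall k, (k <= m)%N -> [/\ u 0 <= u k, u k <= tau,
    measurable_wrt (F (u k)) (fun w => \sum_(i < k) lincomb (ar i) (aI i) (ap i) (u i) (u i.+1) w) &
  (\int[P]_w (Y w * expR (\sum_(i < k) lincomb (ar i) (aI i) (ap i) (u i) (u i.+1) w))%:E = (\int[P]_w (Y w)%:E) *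
    (expR ((\sum_(i < k) (u i.+1 - u i) * lincomb_var (ar i) (aI i) (ap i)) / 2))%:E)%E].
  have utau : forall k, (k <= m)%N -> u k <= tau.
    (* Descending induction, because the bound by tau is given at the last point. *)
    have h : forall k, (k <= m)%N -> u (m - k)%N <= tau.
      elim=> [|k ih] km; first by rewrite subn0.
      apply: le_trans (ih (ltnW km)); apply/ltW.
      have -> : (m - k)%N = (m - k.+1).+1 by rewrite subnSK.
      by apply: lu; rewrite subnSK// leq_subr.
    by move=> k km; rewrite -(subKn km); exact/h/leq_subr.
  elim=> [_|k ih km].
    have h0 : 0 <= u 0 <= tau by rewrite u0 utau.
    split; [exact: lexx|exact: utau| |].
      by under eq_fun do rewrite big_ord0; exact: (meas_wrt_cst hF h0).
    rewrite big_ord0 mul0r expR0 mule1.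
    by apply: eq_integral => w _; rewrite big_ord0 expR0 mulr1.
  have [h1 h2 mS ES] := ih (ltnW km).
  have uk0 : 0 <= u k by exact: le_trans h1.
  have ukh : 0 <= u k <= tau by rewrite uk0.
  have luk := lu k km; have uSt := utau _ km.
  have uSh : 0 <= u k.+1 <= tau by rewrite (le_trans uk0 (ltW luk)).
  split => //.
  - exact: le_trans h1 (ltW luk).
  - under eq_fun do rewrite big_ord_recr/=.
    apply: (meas_wrtD hF uSh); last exact: lincomb_meas_wrt.
    exact: (meas_wrt_le hF uk0 (ltW luk) uSt mS).
  have [mX gX _] := lincomb_sym_gaussian (ar k) (aI k) (ap k) uk0 luk uSt.
  under eq_integral => w _ do rewrite big_ord_recr/= expRD mulrA.
  have mYk : measurable_wrt (F (u k)) Y by apply: (meas_wrt_le hF u0 h1 h2).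
  rewrite (@indep_ge0_integralM _ _ _ P (F (u k)) (lincomb (ar k) (aI k) (ap k) (u k) (u k.+1))
    (fun w => Y w * expR (\sum_(i < k) lincomb (ar i) (aI i) (ap i) (u i) (u i.+1) w)) expR
    (filtration_sigma hF ukh) (filtration_meas hF ukh) mX)//.
  - rewrite ES big_ord_recr/= mulrDl expRD EFinM muleA; congr (_ * _)%E.
    have := gaussian_expR 1 mX gX; under eq_integral => w _ do rewrite mul1r.
    by move=> ->; rewrite expr1n mul1r.
  - exact: lincomb_indep.
  - apply: (meas_wrtM hF ukh) => //.
    exact: (meas_wrt_comp hF ukh (@measurable_expR R) mS).
  - by move=> w; rewrite mulr_ge0 ?expR_ge0.
by have [_ _ mS ES] := main m (leqnn m).
Qed.

End gaussian_sums.

(** * Psi, Upsilon and Lambda as integrals *)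

Section calculus.
Context {R : realType}.
Implicit Types (f g : R -> R) (x y z a b k c t T : R).

Lemma derD x f g df dg : is_derive x 1 f df -> is_derive x 1 g dg ->
  is_derive x 1 (fun y => f y + g y) (df + dg).
Proof. by move=> hf hg; exact: is_deriveD. Qed.

Lemma derZ c x f df : is_derive x 1 f df -> is_derive x 1 (fun y => c * f y) (c * df).
Proof. by move=> hf; exact: is_deriveZ. Qed.

Lemma derM x f g df dg : is_derive x 1 f df -> is_derive x 1 g dg ->
  is_derive x 1 (fun y => f y * g y) (f x * dg + g x * df).
Proof. by move=> hf hg; exact: is_deriveM. Qed.

Lemma der_cst c x : is_derive x 1 (fun=> c) 0.
Proof. exact: is_derive_cst. Qed.

Lemma der_id x : is_derive x 1 (fun y : R => y) 1.
Proof. exact: is_derive_id. Qed.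

Lemma der_eq x f g df df' : is_derive x 1 f df -> (forall y, f y = g y) -> df = df' ->
  is_derive x 1 g df'.
Proof. by move=> h fg <-; rewrite -(funext fg). Qed.

Lemma der_comp x f g df dg : is_derive (g x) 1 f df -> is_derive x 1 g dg ->
  is_derive x 1 (fun y => f (g y)) (df * dg).
Proof. by move=> hf hg; exact: is_derive1_comp. Qed.

Lemma der_expR c x : is_derive x 1 (fun y => expR (- (c * y))) (- (c * expR (- (c * x)))).
Proof.
have h := der_comp (is_derive_expR _) (derZ (- c) (der_id x)).
apply: (der_eq h) => [y|]; rewrite mulNr//; ring.
Qed.

Lemma der_Psi k x : is_derive x 1 (Psi k) (expR (- (k * x))).
Proof.
have [k0|k0] := eqVneq k 0.
  apply: (der_eq (der_id x)) => [y|]; first by rewrite /Psi k0 eqxx.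
  by rewrite k0 mul0r oppr0 expR0.
have h := derZ k^-1 (derD (der_cst 1 x) (derZ (-1) (der_expR k x))).
apply: (der_eq h) => [y|]; first by rewrite /Psi (negbTE k0) mulN1r.
by field.
Qed.

Lemma Psi0 k : Psi k 0 = 0.
Proof. by rewrite /Psi; case: ifP => // _; rewrite mulr0 oppr0 expR0 subrr mulr0. Qed.

(** The definition without division, valid at k = 0 too; it spares later computations the case
    distinction. *)
Lemma Psi_expR k x : k * Psi k x = 1 - expR (- (k * x)).
Proof.
rewrite /Psi; have [->|k0] := eqVneq k 0; first by rewrite !mul0r oppr0 expR0 subrr.
by rewrite mulrA mulfV// mul1r.
Qed.

Lemma der_Lambda a k x : is_derive x 1 (Lambda a k) (Psi a x * Psi k x).
Proof.
have dsq : is_derive x 1 (fun y : R => y ^+ 2) (2 * x).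
  by apply: (der_eq (derM (der_id x) (der_id x))) => [y|]; [rewrite expr2|ring].
have dcub : is_derive x 1 (fun y : R => y ^+ 3) (3 * x ^+ 2).
  apply: (der_eq (derM (der_id x) dsq)) => [y|]; [by rewrite exprS|ring].
(* By symmetry this serves both cases in which exactly one parameter vanishes. *)
have dhalf b : b != 0 -> is_derive x 1 (fun t => (2 * b ^+ 3)^-1 *
     (- 2 + t ^+ 2 * b ^+ 2 + 2 * expR (- (b * t)) + 2 * b * t * expR (- (b * t))))
     (x * Psi b x).
  move=> b0.
  have h := derZ (2 * b ^+ 3)^-1 (derD (derD (derD (der_cst (-2) x)
    (derZ (b ^+ 2) dsq)) (derZ 2 (der_expR b x))) (derZ (2 * b) (derM (der_id x) (der_expR b x)))).
  apply: (der_eq h) => [y|].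
    by rewrite [y ^+ 2 * _]mulrC -[2 * b * y * _]mulrA.
  by rewrite /Psi (negbTE b0); field.
have [a0|a0] := eqVneq a 0; have [k0|k0] := eqVneq k 0.
- apply: (der_eq (derZ 3^-1 dcub)) => [y|].
    by rewrite /Lambda a0 k0 eqxx mulrC.
  by rewrite /Psi a0 k0 eqxx; field.
- apply: (der_eq (dhalf k k0)) => [y|]; first by rewrite /Lambda a0 eqxx (negbTE k0).
  by rewrite [Psi a x]/Psi a0 eqxx.
- apply: (der_eq (dhalf a a0)) => [y|]; first by rewrite /Lambda k0 eqxx (negbTE a0).
  by rewrite [Psi k x]/Psi k0 eqxx mulrC.
(* [der_Psi] holds for every parameter, so this branch includes k + a = 0. *)
- have h := derZ (k * a)^-1 (derD (derD (derD (der_Psi (k + a) x)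
    (derZ (-1) (der_Psi k x))) (derZ (-1) (der_Psi a x))) (der_id x)).
  apply: (der_eq h) => [y|].
    by rewrite /Lambda (negbTE a0) (negbTE k0) !mulN1r.
  rewrite [Psi a x]/Psi [Psi k x]/Psi (negbTE a0) (negbTE k0).
  by rewrite [(k + a) * x]mulrDl opprD expRD; field; rewrite ?a0 ?k0.
Qed.

Lemma der_Upsilon k x : is_derive x 1 (Upsilon k) (Psi k x ^+ 2).
Proof.
have dsq : is_derive x 1 (fun y : R => y ^+ 2) (2 * x).
  by apply: (der_eq (derM (der_id x) (der_id x))) => [y|]; [rewrite expr2|ring].
have dcub : is_derive x 1 (fun y : R => y ^+ 3) (3 * x ^+ 2).
  apply: (der_eq (derM (der_id x) dsq)) => [y|]; [by rewrite exprS|ring].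
have [k0|k0] := eqVneq k 0.
  apply: (der_eq (derZ 3^-1 dcub)) => [y|].
    by rewrite /Upsilon k0 eqxx mulrC.
  by rewrite /Psi k0 eqxx; field.
have h := derZ (2 * k ^+ 3)^-1 (derD (derD (derD (der_cst (-3) x)
    (derZ (2 * k) (der_id x))) (derZ 4 (der_expR k x))) (derZ (-1) (der_expR (2 * k) x))).
apply: (der_eq h) => [y|].
  by rewrite /Upsilon (negbTE k0) mulN1r.
rewrite /Psi (negbTE k0) (_ : - (2 * k * x) = 2 * - (k * x)); last by ring.
by rewrite expRM_natl; field.
Qed.

Lemma Lambda0 a k : Lambda a k 0 = 0.
Proof.
by rewrite /Lambda; case: ifP => _; case: ifP => _; rewrite ?Psi0 ?mulr0 ?oppr0 ?expR0; ring.
Qed.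

Lemma Upsilon0 k : Upsilon k 0 = 0.
Proof.
by rewrite /Upsilon; case: ifP => _; rewrite ?mulr0 ?oppr0 ?expR0; ring.
Qed.

Lemma is_derive_continuous f df : (forall x, is_derive x 1 f (df x)) -> continuous f.
Proof.
move=> dF x; apply/differentiable_continuous/derivable1_diffP.
by have := dF x; move=> [].
Qed.

Lemma continuous_Psi k : continuous (Psi k).
Proof. exact: is_derive_continuous (der_Psi k). Qed.

Lemma continuous_subl f T : continuous f -> continuous (fun s => f (T - s)).
Proof.
move=> cf x; apply: (@continuous_comp _ _ _ (fun s => T - s) f).
  by apply: cvgB; [exact: cvg_cst|exact: cvg_id].
exact: cf.
Qed.

Lemma itg_subl f df T x y : x <= y -> (forall z, is_derive z 1 f (df z)) -> continuous df ->
  itg (fun s => df (T - s)) x y = f (T - x) - f (T - y).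
Proof.
move=> xy hf cdf.
have h z : is_derive z 1 (fun s => - 1 * f (T - s)) (df (T - z)).
  have dT : is_derive z 1 (fun s => T - s) (-1).
    by apply: (der_eq (derD (der_cst T z) (derZ (-1) (der_id z)))) => [s|]; [rewrite mulN1r|ring].
  apply: (der_eq (derZ (-1) (@der_comp z f (fun s => T - s) _ _ (hf (T - z)) dT))) => // ; ring.
by rewrite (itg_FTC2 xy h (continuous_subl cdf)); ring.
Qed.

Lemma continuous_expRN c : continuous (fun s : R => expR (- (c * s))).
Proof. exact: is_derive_continuous (der_expR c). Qed.

Lemma abel_sum (p x : nat -> R) N :
  \sum_(i < N) p i * (x i.+1 - x i) =
  p N * x N - p 0 * x 0 + \sum_(i < N) x i.+1 * (p i - p i.+1).
Proof.
elim: N => [|N ih]; first by rewrite !big_ord0 subrr addr0.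
by rewrite !big_ord_recr/= ih; ring.
Qed.

(* Summation by parts, the weight s |-> Psi a (T - s) having the derivative
   - (1 - a Psi a (T - s)). *)
Lemma mean_reverting_sum_cvg a b t T (X Z : R -> R) : t < T -> cont_on t T X ->
  (forall n i, (i <= n)%N -> X (grid t T n i.+1) - X (grid t T n i) =
     itg (fun s => a * (b - X s)) (grid t T n i) (grid t T n i.+1) +
     (Z (grid t T n i.+1) - Z (grid t T n i))) ->
  (\sum_(i < n.+1) Psi a (T - grid t T n i) * (Z (grid t T n i.+1) - Z (grid t T n i)))
   @[n --> \oo] --> itg X t T - b * (T - t) - Psi a (T - t) * (X t - b).
Proof.
move=> tT cX hX; have tT' := ltW tT.
have cE : cont_on t T (fun s => expR (- (a * (T - s)))).
  apply: cont_on_continuous; exact: (@continuous_subl (fun s => expR (- (a * s))) T (@continuous_expRN a)).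
have cP : cont_on t T (fun s => Psi a (T - s)).
  apply: cont_on_continuous; exact: (@continuous_subl (Psi a) T (@continuous_Psi a)).
have cD : cont_on t T (fun s => a * (b - X s)).
  have ca := @cont_on_cst R t T a; have cb := @cont_on_cst R t T b; have cm := @cont_on_cst R t T (-1).
  have := cont_onM ca (cont_onD cb (cont_onM cm cX)).
  rewrite (_ : (fun s => _) = (fun s => a * (b - X s)))//.
  by apply/funext => s; rewrite mulN1r.
have lims := stieltjes_sum_cvg (xi := fun n i => grid t T n i) tT' cP cD _.
have {lims} h2 := lims (fun n i _ => introT andP (conj (lexx _) (grid_le n tT' (leqnSn i)))).
(* Right tags here: summation by parts leaves X at the right endpoint of each cell. *)
have lims := stieltjes_sum_cvg (xi := fun n i => grid t T n i.+1) tT' cX cE _.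
have {lims} h1 := lims (fun n i _ => introT andP (conj (grid_le n tT' (leqnSn i)) (lexx _))).
have sumE n : \sum_(i < n.+1) Psi a (T - grid t T n i) * (Z (grid t T n i.+1) - Z (grid t T n i)) =
   - (Psi a (T - t) * X t) +
   (\sum_(i < n.+1) X (grid t T n i.+1) * itg (fun s => expR (- (a * (T - s)))) (grid t T n i) (grid t T n i.+1)) -
   \sum_(i < n.+1) Psi a (T - grid t T n i) * itg (fun s => a * (b - X s)) (grid t T n i) (grid t T n i.+1).
  rewrite -[LHS](addrK (\sum_(i < n.+1) Psi a (T - grid t T n i) * itg (fun s => a * (b - X s)) (grid t T n i) (grid t T n i.+1))).
  congr (_ - _); rewrite -big_split/=.
  under eq_bigr => i _.
    rewrite -mulrDr [_ - _ + _]addrC -hX; last exact: (ltn_ord i : (i <= n)%N).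
    over.
  rewrite (abel_sum (fun i => Psi a (T - grid t T n i)) (fun i => X (grid t T n i))).
  (* The boundary term at T vanishes because Psi a 0 = 0, so the unknown value of X at T does not
     appear. *)
  rewrite grid_last subrr Psi0 mul0r sub0r grid0; congr (_ + _).
  apply: eq_bigr => i _; congr (_ * _).
  by rewrite (itg_subl T (grid_le n tT' (leqnSn i)) (der_Psi a) (@continuous_expRN a)).
rewrite (_ : (fun n => _) = (fun n => - (Psi a (T - t) * X t) +
   (\sum_(i < n.+1) X (grid t T n i.+1) * itg (fun s => expR (- (a * (T - s)))) (grid t T n i) (grid t T n i.+1)) -
   \sum_(i < n.+1) Psi a (T - grid t T n i) * itg (fun s => a * (b - X s)) (grid t T n i) (grid t T n i.+1))); last first.
  by apply/funext => n; exact: sumE.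
rewrite (_ : itg X t T - _ - _ = - (Psi a (T - t) * X t) + itg (fun s => X s * expR (- (a * (T - s)))) t T -
   itg (fun s => Psi a (T - s) * (a * (b - X s))) t T).
  by apply: cvgB => //; apply: cvgD => //; exact: cvg_cst.
have e1 : itg (fun s => expR (- (a * (T - s)))) t T = Psi a (T - t).
  by rewrite (itg_subl T tT' (der_Psi a) (@continuous_expRN a)) subrr Psi0 subr0.
have c1 := @cont_on_cst R t T b; have cXE := cont_onM cX cE.
(* As a Psi a = 1 - exp, the integrand contains the bare X whose integral is wanted, and an
   exponential term in X that cancels the Stieltjes integral above. *)
have -> : itg (fun s => Psi a (T - s) * (a * (b - X s))) t T =
    itg (fun s => b + ((-1) * X s + ((- b) * expR (- (a * (T - s))) + X s * expR (- (a * (T - s)))))) t T.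
  by apply: eq_itg => s _; rewrite mulrA [Psi _ _ * a]mulrC Psi_expR; ring.
have cm1 c (f : R -> R) : cont_on t T f -> cont_on t T (fun s => c * f s).
  by move=> cf; exact: (cont_onM (@cont_on_cst R t T c) cf).
rewrite (itgD c1 (cont_onD (cm1 (-1) _ cX) (cont_onD (cm1 (- b) _ cE) cXE)))//.
rewrite (itgD (cm1 (-1) _ cX) (cont_onD (cm1 (- b) _ cE) cXE))//.
rewrite (itgD (cm1 (- b) _ cE) cXE)// (itgZ (-1) cX)// (itgZ (- b) cE)// itg_cst// e1.
by ring.
Qed.

End calculus.

(** * Conditional expectation of the exponential of a Gaussian limit *)

Section gaussian_limit.
Context {d : measure_display} {Omega : measurableType d} {R : realType}.
Variables (P : probability Omega R) (tau : R) (F : R -> set (set Omega)).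
Hypothesis hF : filtration tau F.
Variables (rho : R) (Wr WI Wp : R -> Omega -> R).
Hypothesis hW : brownian_motion3 P tau F rho Wr WI Wp.
Variables (t T : R) (ht : 0 <= t) (htT : t < T) (hT : T <= tau).
Variables (cr cI cp : R -> R).
Hypotheses (ccr : cont_on t T cr) (ccI : cont_on t T cI) (ccp : cont_on t T cp).

Let tin : 0 <= t <= tau. Proof. by rewrite ht (le_trans (ltW htT)). Qed.

Definition gaussian_sum n w : R := \sum_(i < n.+1)
  lincomb Wr WI Wp (cr (grid t T n i)) (cI (grid t T n i)) (cp (grid t T n i))
    (grid t T n i) (grid t T n i.+1) w.

Let var s := lincomb_var rho (cr s) (cI s) (cp s).

Let cvar : cont_on t T var.
Proof.
have sq f : cont_on t T f -> cont_on t T (fun s => f s ^+ 2).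
  by move=> cf; exact: (cont_onM cf cf).
have := cont_onD (cont_onD (cont_onD (sq _ ccr) (sq _ ccI)) (sq _ ccp))
  (cont_onM (cont_onM (@cont_on_cst R t T (2 * rho)) ccr) ccp).
by [].
Qed.

Let v n := \sum_(i < n.+1) (grid t T n i.+1 - grid t T n i) * var (grid t T n i).

Let cvg_v : v n @[n --> \oo] --> itg var t T.
Proof.
have := riemann_sum_cvg (ltW htT) cvar.
rewrite (_ : (fun n => _) = v)//; apply/funext => n; apply: eq_bigr => i _.
by rewrite gridS mulrC.
Qed.

(** The factor c is 1 for the expectations and 2 for the second moments. *)
Lemma gaussian_sum_expect n c (Y : Omega -> R) : measurable_wrt (F t) Y -> (forall w, 0 <= Y w) ->
  measurable_fun setT (gaussian_sum n) /\
  (\int[P]_w (Y w * expR (c * gaussian_sum n w))%:E =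
     (\int[P]_w (Y w)%:E) * (expR (c ^+ 2 * v n / 2))%:E)%E.
Proof.
move=> mY Y0.
have lu i : (i < n.+1)%N -> grid t T n i < grid t T n i.+1 by move=> _; exact: grid_lt.
have key (e : R) := @gaussian_sum_expR _ _ _ P tau F hF rho Wr WI Wp hW (grid t T n) n.+1
  (fun i => e * cr (grid t T n i)) (fun i => e * cI (grid t T n i)) (fun i => e * cp (grid t T n i)) Y.
rewrite grid0 grid_last in key.
have [m1 _] := key 1 ht lu hT mY Y0; have [_ e1] := key c ht lu hT mY Y0.
have scal (e : R) w : \sum_(i < n.+1) lincomb Wr WI Wp (e * cr (grid t T n i)) (e * cI (grid t T n i))
    (e * cp (grid t T n i)) (grid t T n i) (grid t T n i.+1) w = e * gaussian_sum n w.
  by rewrite mulr_sumr; apply: eq_bigr => i _; rewrite /lincomb; ring.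
split.
  have Tin : 0 <= T <= tau by rewrite (le_trans ht (ltW htT)).
  apply: (meas_wrt_meas hF Tin); move: m1.
  by rewrite (_ : (fun w => _) = gaussian_sum n)//; apply/funext => w; rewrite scal mul1r.
under eq_integral => w _ do rewrite -scal.
rewrite e1; congr (_ * (expR (_ / 2))%:E)%E.
rewrite /v mulr_sumr; apply: eq_bigr => i _.
by rewrite /var /lincomb_var; ring.
Qed.

(* The second moments of the exponentials are bounded, so the expectations pass
   to the limit. *)
Lemma gaussian_sum_limit (N : R) (Y G : Omega -> R) :
  measurable_wrt (F t) Y -> (forall w, 0 <= Y w <= N) -> measurable_fun setT G ->
  {ae P, forall w, gaussian_sum n w @[n --> \oo] --> G w} ->
  (\int[P]_w (Y w * expR (G w))%:E =
    (\int[P]_w (Y w)%:E) * (expR (itg var t T / 2))%:E)%E.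
Proof.
move=> mY YN mG cG.
have Y0 w : 0 <= Y w by have /andP[] := YN w.
have mY' : measurable_fun setT Y by apply: (meas_wrt_meas hF tin).
(* Evaluated at the default point of [Omega]. *)
have N0 : 0 <= N by have /andP[h1 h2] := YN point; exact: le_trans h2.
have YbN w : `|Y w| <= N by rewrite ger0_norm//; have /andP[] := YN w.
have LY : L1 P Y by apply: sqint_L1; exact: (sqint_bounded P mY' YbN).
have mY2 : measurable_wrt (F t) (fun w => Y w ^+ 2) by exact: (meas_wrtM hF tin mY mY).
have mG_ n : measurable_fun setT (gaussian_sum n) by have [] := gaussian_sum_expect n 1 mY Y0.
have E1 n : (\int[P]_w (Y w * expR (gaussian_sum n w))%:E =
    (\int[P]_w Y w)%R%:E * (expR (v n / 2))%:E)%E.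
  have [_] := gaussian_sum_expect n 1 mY Y0; rewrite expr1n mul1r (L1_EFin LY) => <-.
  by apply: eq_integral => w _; rewrite mul1r.
have E2 n : (\int[P]_w (Y w ^+ 2 * expR (2 * gaussian_sum n w))%:E =
    (\int[P]_w (Y w ^+ 2))%R%:E * (expR (2 ^+ 2 * v n / 2))%:E)%E.
  have [_ ->] := gaussian_sum_expect n 2 mY2 (fun w => sqr_ge0 _).
  by rewrite (@L1_EFin _ _ _ P (fun w => Y w ^+ 2)); last by have [] := sqint_bounded P mY' YbN.
pose Z n w := Y w * expR (gaussian_sum n w).
have mZ n : measurable_fun setT (Z n).
  by apply: measurable_funM => //; exact: measurableT_comp.
have Zsq n w : Z n w ^+ 2 = Y w ^+ 2 * expR (2 * gaussian_sum n w).
  by rewrite exprMn -expRM_natl.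
have sZ n : sqint P (Z n).
  split => //; apply: L1_ge0; first exact: measurable_funX.
    by move=> w; exact: sqr_ge0.
  by under eq_integral => w _ do rewrite Zsq; rewrite E2 -EFinM ltry.
have [M vM] : exists M, forall n, `|v n| <= M.
  have /cvg_seq_bounded : cvgn v by apply/cvg_ex; eexists; exact: cvg_v.
  rewrite /bounded_near => /pinfty_ex_gt0[M M0 hM]; exists M => n; exact: hM.
rewrite (L1_EFin LY) -EFinM.
apply: (@integral_lim_sq_bounded _ _ _ P Z (fun w => Y w * expR (G w))
  (fun n => \int[P]_w Y w * expR (v n / 2)) _ (N ^+ 2 * expR (2 * M))) => //.
- by move=> n w; rewrite mulr_ge0 ?expR_ge0.
- by apply: measurable_funM => //; exact: measurableT_comp.
- by move=> w; rewrite mulr_ge0 ?expR_ge0.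
- apply: filterS cG => w hw; apply: cvgM; first exact: cvg_cst.
  by apply: continuous_cvg => //; exact: continuous_expR.
- by move=> n; rewrite /Rintegral E1 -EFinM.
- apply: cvgM; first exact: cvg_cst.
  apply: continuous_cvg; first exact: continuous_expR.
  by apply: cvgM => //; exact: cvg_cst.
- move=> n; rewrite /meansq; under eq_Rintegral do rewrite Zsq.
  rewrite /Rintegral E2 -EFinM /=.
  apply: ler_pM => //.
  + by apply: Rintegral_ge0 => w _; exact: sqr_ge0.
  + exact: (meansq_bounded P mY' YbN).
  + rewrite ler_expR (_ : 2 ^+ 2 * v n / 2 = 2 * v n); last by field.
    by rewrite ler_wpM2l//; apply: le_trans (vM n); exact: ler_norm.
Qed.

(* The price of a payoff Y exp(K + G), with Y and K known at time t and G a
   Gaussian variable independent of the past. *)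
Lemma gaussian_cond_exp (X Y K G p : Omega -> R) :
  is_cond_exp P (F t) X p -> measurable_fun setT X ->
  measurable_wrt (F t) Y -> (forall w, 0 <= Y w) -> measurable_wrt (F t) K ->
  measurable_fun setT G ->
  {ae P, forall w, X w = Y w * expR (K w + G w)} ->
  {ae P, forall w, gaussian_sum n w @[n --> \oo] --> G w} ->
  {ae P, forall w, p w = Y w * expR (K w) * expR (itg var t T / 2)}.
Proof.
move=> [mp hp] mX mY Y0 mK mG XE cG.
have sG := filtration_sigma hF tin; have Gm := filtration_meas hF tin.
have mYK : measurable_wrt (F t) (fun w => Y w * expR (K w)).
  apply: (meas_wrtM hF tin) => //; exact: (meas_wrt_comp hF tin (@measurable_expR R) mK).
apply: (ae_eq_of_integrals sG Gm mp).
  by apply: (meas_wrtM hF tin) => //; exact: (meas_wrt_cst hF tin).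
move=> A N FA hN; rewrite hp//.
set e := expR (itg var t T / 2) in hN *.
have e0 : 0 < e by exact: expR_gt0.
have mA := Gm _ FA.
pose YA w := \1_A w * (Y w * expR (K w)).
have mYA : measurable_wrt (F t) YA.
  apply: (meas_wrtM hF tin) => //.
  apply/(measurable_wrtP _ sG); apply: measurable_indic.
  by rewrite measurable_g_measurableTypeE.
(* On A the candidate price, which is Y exp K times e, is bounded by N. The absolute value is there
   because N may be negative when A is empty. *)
have YAN w : 0 <= YA w <= `|N| / e.
  rewrite /YA indicE; have [Aw|nAw] := boolP (w \in A).
    rewrite mul1r mulr_ge0 ?expR_ge0//=.
    rewrite ler_pdivlMr//; apply: le_trans (ler_norm _) (le_trans (hN w _) (ler_norm _)).
    by move: Aw; rewrite inE.
  by rewrite mul0r lexx/= divr_ge0// ltW.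
have := gaussian_sum_limit mYA YAN mG cG; rewrite -/e => EE.
transitivity (\int[P]_w (YA w * expR (G w))%:E)%E.
  rewrite integral_mkcond/=; apply: ae_eq_integral => //.
  - apply/(measurable_restrictT _ mA); apply: measurable_funTS; exact/measurable_EFinP.
  - apply/measurable_EFinP; apply: measurable_funM; first by apply: (meas_wrt_meas hF tin).
    exact: measurableT_comp.
  - apply: filterS XE => w hw _; rewrite patchE /YA indicE.
    by case: ifPn => Aw; rewrite ?mul0r// mul1r hw expRD mulrA.
rewrite EE -ge0_integralZr//; last 3 first.
- by apply/measurable_EFinP; apply: (meas_wrt_meas hF tin).
- by move=> w _; rewrite lee_fin; have /andP[] := YAN w.
- by rewrite lee_fin ltW.
rewrite [RHS]integral_mkcond/=; apply: eq_integral => w _.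
rewrite patchE /YA indicE -EFinM.
by case: ifPn => Aw; rewrite ?mul0r// mul1r.
Qed.

End gaussian_limit.

(** * Change of measure and the break-even rate *)

Lemma null_dominates_ae {d : measure_display} {Omega : measurableType d} {R : realType}
  (P Q : probability Omega R) (A : Omega -> Prop) : Q `<< P ->
  {ae P, forall w, A w} -> {ae Q, forall w, A w}.
Proof.
move=> QP [N [mN N0 hN]]; exists N; split => //.
exact: ((null_content_dominatesP Q P).1 QP N mN N0).
Qed.

Lemma brownian_motion3_increments {d : measure_display} {Omega : measurableType d} {R : realType}
  (P : probability Omega R) (tau rho : R) (F : R -> set (set Omega)) (Wr WI Wp : R -> Omega -> R) :
  filtration tau F -> brownian_motion3 P tau F rho Wr WI Wp -> gaussian_increments P tau F WI.
Proof.
move=> hF hW s t s0 st tT.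
have lE : lincomb Wr WI Wp 0 1 0 s t = fun w => WI t w - WI s w.
  by apply/funext => w; rewrite /lincomb; ring.
have vE : (t - s) * lincomb_var rho 0 1 0 = t - s by rewrite /lincomb_var; ring.
have := lincomb_indep hW 0 1 0 s0 st tT; rewrite lE => h1.
by have := lincomb_sym_gaussian hF hW 0 1 0 s0 st tT; rewrite lE vE => h2.
Qed.

Section mean_reversion.
Context {R : realType}.

Lemma itg_affine (tau : R) (x : R -> R) (c1 c2 s s' : R) : cont_on 0 tau x ->
  0 <= s -> s <= s' -> s' <= tau ->
  itg (fun u => c1 * x u + c2) s s' = c1 * itg x s s' + c2 * (s' - s).
Proof.
move=> cx s0 ss st.
have c1x := cont_onM (@cont_on_cst R 0 tau c1) cx.
by rewrite (itgD c1x (@cont_on_cst R 0 tau c2))// (itgZ c1 cx)// itg_cst.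
Qed.

(** The drift added to W, times sigma, is exactly the difference of the drifts with parameters
    (kappa, m) and (a, b). The equation is needed at s and s' only, since it is given almost surely
    at each single time. *)
Lemma mean_reverting_shift (tau kappa m a b sigma : R) (x W : R -> R) (s s' : R) :
  cont_on 0 tau x -> 0 <= s -> s <= s' -> s' <= tau -> sigma != 0 ->
  x s = x 0 + itg (fun u => kappa * (m - x u)) 0 s + sigma * W s ->
  x s' = x 0 + itg (fun u => kappa * (m - x u)) 0 s' + sigma * W s' ->
  let B u := W u + itg (fun v => ((a - kappa) * x v + kappa * m - a * b) / sigma) 0 u in
  x s' - x s = itg (fun u => a * (b - x u)) s s' + (sigma * B s' - sigma * B s).
Proof.
move=> cx s0 ss st sg hs hs' B.
have s'0 : 0 <= s' by exact: le_trans ss.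
have stau : s <= tau by exact: le_trans st.
have e1 u : 0 <= u -> u <= tau -> itg (fun u => kappa * (m - x u)) 0 u = - kappa * itg x 0 u + kappa * m * u.
  move=> u0 ut; have := itg_affine (- kappa) (kappa * m) cx (lexx 0) u0 ut; rewrite subr0 => <-.
  by apply: eq_itg => v _; ring.
have e2 u : 0 <= u -> u <= tau -> itg (fun v => ((a - kappa) * x v + kappa * m - a * b) / sigma) 0 u =
    (a - kappa) / sigma * itg x 0 u + (kappa * m - a * b) / sigma * u.
  move=> u0 ut; have := itg_affine ((a - kappa) / sigma) ((kappa * m - a * b) / sigma) cx (lexx 0) u0 ut; rewrite subr0 => <-.
  by apply: eq_itg => v _; field.
have e3 : itg (fun u => a * (b - x u)) s s' = - a * itg x s s' + a * b * (s' - s).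
  by rewrite -(itg_affine _ _ cx s0 ss st); apply: eq_itg => v _; ring.
rewrite hs hs' /B !e1// !e2// e3 (itg_split cx (lexx 0) s0 ss st).
by field.
Qed.

End mean_reversion.

(** For an adapted process with continuous paths, the integral is a pointwise limit of Riemann sums,
    each of them measurable. *)
Lemma itg_measurable {d : measure_display} {Omega : measurableType d} {R : realType}
  (tau t T : R) (F : R -> set (set Omega)) (X : R -> Omega -> R) :
  filtration tau F -> adapted tau F X -> (forall w, cont_on 0 tau (X ^~ w)) ->
  0 <= t -> t <= T -> T <= tau ->
  measurable_fun setT (fun w => itg (X ^~ w) t T).
Proof.
move=> hF aX cX t0 tT Tt.
apply: (measurable_fun_cvg (h := fun n w => \sum_(i < n.+1) X (grid t T n i) w * ((T - t) / n.+1%:R))).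
  move=> n; apply: measurable_sum => i; apply: measurable_funM => //.
  have h : 0 <= grid t T n i <= tau.
    rewrite (le_trans t0 (grid_ge _ _ tT))/=; apply: le_trans Tt.
    by apply: grid_leb => //; exact: ltnW.
  by apply: (meas_wrt_meas hF h); exact: aX.
by move=> w _; apply: riemann_sum_cvg => //; exact: (cont_onS t0 Tt (cX w)).
Qed.

(** Quotient of the closed forms at T and t, both expressed from time 0, where the Ito integral
    starts. *)
Lemma geometric_sde_ratio {d : measure_display} {Omega : measurableType d} {R : realType}
  (P : probability Omega R) (tau t T sigma : R) (F : R -> set (set Omega)) (W I mu : R -> Omega -> R) :
  filtration tau F -> adapted tau F W -> gaussian_increments P tau F W ->
  {ae P, forall w, cont_on 0 tau (W ^~ w)} ->
  adapted tau F I -> (forall w, cont_on 0 tau (I ^~ w)) ->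
  adapted tau F mu -> (forall w, cont_on 0 tau (mu ^~ w)) ->
  (forall w, 0 < I 0 w) -> geometric_sde P tau F mu sigma W I ->
  0 <= t -> t < T -> T <= tau ->
  {ae P, forall w, 0 < I t w /\
    I T w = I t w * expR (itg (mu ^~ w) t T + sigma * (W T w - W t w) - sigma ^+ 2 * (T - t) / 2)}.
Proof.
move=> hF aW Winc cW aI cI amu cmu I0 [J [aJ hJ]] t0 tT Tt.
have sol s : 0 <= s -> s <= tau -> {ae P, forall w, I s w = I 0 w *
    expR (itg (mu ^~ w) 0 s + sigma * (W s w - W 0 w) - sigma ^+ 2 * s / 2)}.
  rewrite le_eqVlt => /predU1P[<- _|s0 st].
    by apply: aeW => w; rewrite itgxx subrr !mulr0 mul0r addr0 subr0 expR0 mulr1.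
  apply: (geometric_sde_solution hF aW aI aJ amu Winc cW cI cmu I0 _ _ s0 st) => u hu.
    exact: (hJ u hu).1.
  exact: (hJ u hu).2.
have T0 : 0 <= T by exact: le_trans (ltW tT).
have ttau : t <= tau by exact: le_trans (ltW tT) Tt.
apply: filterS2 (sol t t0 ttau) (sol T T0 Tt) => w -> ->; split.
  by rewrite mulr_gt0 ?expR_gt0.
rewrite -[RHS]mulrA -expRD (itg_split (cmu w) (lexx 0) t0 (ltW tT) Tt).
by congr (_ * expR _); field.
Qed.

Theorem mainTheorem6 (R : realType) (d : measure_display)
    (Omega : measurableType d) (P Q : probability Omega R)
    (tau : R) (F : R -> set (set Omega))
    (kappa beta rbar pibar sigma_r sigma_I sigma_pi rho a b h k l : R)
    (Wr WI Wpi r I pi : R -> Omega -> R)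
    (hsr : 0 < sigma_r) (hsI : 0 < sigma_I) (hspi : 0 < sigma_pi)
    (hF : filtration tau F)
    (hWP : brownian_motion3 P tau F rho Wr WI Wpi)
    (r_adapted : adapted tau F r) (r_cont : continuous_paths tau r)
    (I_adapted : adapted tau F I) (I_cont : continuous_paths tau I)
    (pi_adapted : adapted tau F pi) (pi_cont : continuous_paths tau pi)
    (I0_gt0 : forall w, 0 < I 0 w)
    (r_sde : mean_reverting_sde P tau kappa rbar sigma_r Wr r)
    (I_sde : geometric_sde P tau F pi sigma_I WI I)
    (pi_sde : mean_reverting_sde P tau beta pibar sigma_pi Wpi pi)
    (hQP : Q `<< P) (hPQ : P `<< Q)
    (hWQ :
       let lambda_r t w :=
         ((a - kappa) * r t w + kappa * rbar - a * b) / sigma_r in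
       let lambda_I (t : R) (w : Omega) := h / sigma_I in
       let lambda_pi t w :=
         ((k - beta) * pi t w + beta * pibar - k * l) / sigma_pi in
       brownian_motion3 Q tau F rho
         (drifted Wr lambda_r) (drifted WI lambda_I) (drifted Wpi lambda_pi))
    (t T : R) (ht : 0 <= t) (htT : t < T) (hT : T <= tau)
    (p q i : Omega -> R)
    (hp : is_cond_exp Q (F t) (discount r t T) p)
    (hq : is_cond_exp Q (F t) (fun w => discount r t T w * I T w) q)
    (hi : {ae Q, forall w, q w / I t w = p w * expR ((T - t) * i w)}) :
  let Delta := T - t in
  {ae Q, forall w,
     i w = l - h + Psi k Delta / Delta * (pi t w - l)
           + sigma_pi ^+ 2 / 2 * (Upsilon k Delta / Delta)
           - sigma_r * sigma_pi * rho * (Lambda a k Delta / Delta)}.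
Proof.
move=> Delta.
have tT := ltW htT; have T0 := le_trans ht tT.
have tin : 0 <= t <= tau by rewrite ht (le_trans tT).
have Tin : 0 <= T <= tau by rewrite T0.
pose lambda_r s w := ((a - kappa) * r s w + kappa * rbar - a * b) / sigma_r.
pose lambda_I (s : R) (w : Omega) := h / sigma_I.
pose lambda_pi s w := ((k - beta) * pi s w + beta * pibar - k * l) / sigma_pi.
pose Br := drifted Wr lambda_r; pose BI := drifted WI lambda_I; pose Bp := drifted Wpi lambda_pi.
have hB : brownian_motion3 Q tau F rho Br BI Bp := hWQ.
have [[_ aWI _] _ cW _ _] := hWP.
have cWI : {ae P, forall w, cont_on 0 tau (WI ^~ w)} by apply: filterS cW => w [].
(* Established under P, where WI has centred increments, then carried over to Q. *)
have Iratio := null_dominates_ae hQP (geometric_sde_ratio hF aWI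
  (brownian_motion3_increments hF hWP) cWI I_adapted I_cont pi_adapted pi_cont I0_gt0 I_sde ht htT hT).
have gin n j : (j <= n.+1)%N -> 0 <= grid t T n j /\ grid t T n j <= tau.
  move=> jn; split; first exact: le_trans ht (grid_ge _ _ tT).
  by apply: le_trans hT; exact: grid_leb.
(* The grids for all n form a countable set of times, so a single null set serves for all
   increments. *)
have incr (speed level sigma a' b' : R) (W X : R -> Omega -> R) : 0 < sigma ->
    continuous_paths tau X -> mean_reverting_sde P tau speed level sigma W X ->
    {ae Q, forall w, forall n j, (j <= n)%N ->
      X (grid t T n j.+1) w - X (grid t T n j) w =
      itg (fun s => a' * (b' - X s w)) (grid t T n j) (grid t T n j.+1) +
      (sigma * drifted W (fun s w => ((a' - speed) * X s w + speed * level - a' * b') / sigma) (grid t T n j.+1) w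
     - sigma * drifted W (fun s w => ((a' - speed) * X s w + speed * level - a' * b') / sigma) (grid t T n j) w)}.
  move=> sg cX hX; apply: (null_dominates_ae hQP).
  apply: ae_foralln => n; apply: ae_foralln => j.
  have [jn|jn] := leqP j n; last by apply: aeW => w.
  have [g0 g1] := gin n j (leqW jn); have [g2 g3] := gin n j.+1 jn.
  have h0 : 0 <= grid t T n j <= tau by rewrite g0.
  have h1 : 0 <= grid t T n j.+1 <= tau by rewrite g2.
  apply: filterS2 (hX _ h0) (hX _ h1) => w E0 E1 _.
  have gg : grid t T n j <= grid t T n j.+1 by exact: grid_le.
  have s0 := lt0r_neq0 sg.
  have := @mean_reverting_shift R tau speed level a' b' sigma (X ^~ w) (W ^~ w) _ _ (cX w) g0 gg g3 s0 E0 E1.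
  exact.
have r_lim : {ae Q, forall w, \sum_(j < n.+1) Psi a (T - grid t T n j) *
    (sigma_r * Br (grid t T n j.+1) w - sigma_r * Br (grid t T n j) w) @[n --> \oo] -->
    itg (r ^~ w) t T - b * (T - t) - Psi a (T - t) * (r t w - b)}.
  apply: filterS (incr _ _ _ a b _ _ hsr r_cont r_sde) => w hw.
  apply: (mean_reverting_sum_cvg (Z := fun s => sigma_r * Br s w) htT _ hw).
  exact: (cont_onS ht hT (r_cont w)).
have pi_lim : {ae Q, forall w, \sum_(j < n.+1) Psi k (T - grid t T n j) *
    (sigma_pi * Bp (grid t T n j.+1) w - sigma_pi * Bp (grid t T n j) w) @[n --> \oo] -->
    itg (pi ^~ w) t T - l * (T - t) - Psi k (T - t) * (pi t w - l)}.
  apply: filterS (incr _ _ _ k l _ _ hspi pi_cont pi_sde) => w hw.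
  apply: (mean_reverting_sum_cvg (Z := fun s => sigma_pi * Bp s w) htT _ hw).
  exact: (cont_onS ht hT (pi_cont w)).
have cPsi (c : R) : cont_on t T (fun s => Psi c (T - s)).
  exact: (cont_on_continuous (a := t) (b := T) (continuous_subl (T := T) (@continuous_Psi R c))).
have cst (c : R) := @cont_on_cst R t T c.
have c_r := cont_onM (cst (- sigma_r)) (cPsi a).
have c_p := cont_onM (cst sigma_pi) (cPsi k).
have m_r := itg_measurable hF r_adapted r_cont ht tT hT.
have m_pi := itg_measurable hF pi_adapted pi_cont ht tT hT.
have mr : measurable_wrt (F t) (r t) by exact: r_adapted.
have mpi : measurable_wrt (F t) (pi t) by exact: pi_adapted.
have mIt : measurable_wrt (F t) (I t) by exact: I_adapted.
have mIT : measurable_fun setT (I T) by apply: (meas_wrt_meas hF Tin); exact: I_adapted.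
have mWIt : measurable_fun setT (WI t) by apply: (meas_wrt_meas hF tin); exact: aWI.
have mWIT : measurable_fun setT (WI T) by apply: (meas_wrt_meas hF Tin); exact: aWI.
have mdisc : measurable_fun setT (discount r t T).
  by apply: measurableT_comp => //; exact: (measurableT_comp _ m_r).
have affine (c1 c2 c3 : R) (X : Omega -> R) : measurable_wrt (F t) X ->
    measurable_wrt (F t) (fun w => c1 + c2 * (X w - c3)).
  move=> mX; apply: (meas_wrtD hF tin); first exact: (meas_wrt_cst hF tin).
  apply: (meas_wrtM hF tin); first exact: (meas_wrt_cst hF tin).
  by apply: (meas_wrtB hF tin) => //; exact: (meas_wrt_cst hF tin).
(* [Kp] and [Kpi] collect what is known at time t: the terms left by summation by parts, the drift
   -h Delta from sigma_I dW^I = sigma_I dWbar^I - h dt, and the correction -sigma_I^2 Delta / 2 of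
   the index. *)
pose Kp w := - (b * Delta) + (- Psi a Delta) * (r t w - b).
pose Kpi w := (l - h) * Delta - sigma_I ^+ 2 * Delta / 2 + Psi k Delta * (pi t w - l).
have mKp : measurable_wrt (F t) Kp by exact: affine.
have mKpi : measurable_wrt (F t) Kpi by exact: affine.
have mKq : measurable_wrt (F t) (fun w => Kp w + Kpi w) by exact: (meas_wrtD hF tin).
(* [Gp] and [Gq] are defined as remainders, so the payoffs have the required form by algebra; that
   they are limits of Gaussian sums is proved afterwards. *)
pose Gp w := - itg (r ^~ w) t T - Kp w.
pose Gq w := Gp w + (itg (pi ^~ w) t T + sigma_I * (WI T w - WI t w) - sigma_I ^+ 2 * Delta / 2 - Kpi w).
have mGp : measurable_fun setT Gp.
  by apply: measurable_funB; [exact: measurableT_comp|apply: (meas_wrt_meas hF tin)].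
have mGq : measurable_fun setT Gq.
  apply: measurable_funD => //; apply: measurable_funB; last by apply: (meas_wrt_meas hF tin).
  apply: measurable_funB => //; apply: measurable_funD => //; apply: measurable_funM => //.
  exact: measurable_funB.
have pE : {ae Q, forall w, p w = 1 * expR (Kp w) *
    expR (itg (fun s => lincomb_var rho (- sigma_r * Psi a (T - s)) 0 0) t T / 2)}.
  apply: (gaussian_cond_exp hF hB ht htT hT c_r (cst 0) (cst 0) (X := discount r t T)
    (Y := fun=> 1) (K := Kp) (G := Gp)) => //.
  - exact: (meas_wrt_cst hF tin).
  - by apply: aeW => w; rewrite mul1r /Gp addrC subrK.
  - apply: filterS r_lim => w hw.
    rewrite (_ : Gp w = - (itg (r ^~ w) t T - b * (T - t) - Psi a (T - t) * (r t w - b))); last first.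
      by rewrite /Gp /Kp /Delta; ring.
    have e n : gaussian_sum Br BI Bp t T
        (fun s => - sigma_r * Psi a (T - s)) (fun=> 0) (fun=> 0) n w =
        - \sum_(j < n.+1) Psi a (T - grid t T n j) *
          (sigma_r * Br (grid t T n j.+1) w - sigma_r * Br (grid t T n j) w).
      by rewrite -sumrN; apply: eq_bigr => j _; rewrite /lincomb; ring.
    rewrite (eq_cvg _ _ e); exact: cvgN.
(* The weight has to be nonnegative everywhere, whereas I_t is known to be positive only almost
   surely; hence the absolute value. *)
have qE : {ae Q, forall w, q w = `|I t w| * expR (Kp w + Kpi w) *
    expR (itg (fun s => lincomb_var rho (- sigma_r * Psi a (T - s)) sigma_I (sigma_pi * Psi k (T - s))) t T / 2)}.
  apply: (gaussian_cond_exp hF hB ht htT hT c_r (cst sigma_I) c_p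
    (X := fun w => discount r t T w * I T w)
    (Y := fun w => `|I t w|) (K := fun w => Kp w + Kpi w) (G := Gq)) => //.
  - exact: measurable_funM.
  - exact: (meas_wrt_comp hF tin (@normr_measurable R setT) mIt).
  - apply: filterS Iratio => w [It0 ->].
    rewrite gtr0_norm// mulrCA /discount -expRD; congr (_ * expR _).
    by rewrite -/(itg _ t T) /Gq /Gp /Delta; ring.
  - apply: filterS2 r_lim pi_lim => w hr hpi.
    rewrite (_ : Gq w = - (itg (r ^~ w) t T - b * (T - t) - Psi a (T - t) * (r t w - b)) +
      (itg (pi ^~ w) t T - l * (T - t) - Psi k (T - t) * (pi t w - l)) + sigma_I * (BI T w - BI t w)); last first.
      rewrite /BI /drifted /time_integral -!/(itg _ 0 _) !itg_cst// /Gq /Gp /Kp /Kpi /Delta.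
      by field; exact: lt0r_neq0.
    have e n : gaussian_sum Br BI Bp t T
        (fun s => - sigma_r * Psi a (T - s)) (fun=> sigma_I) (fun s => sigma_pi * Psi k (T - s)) n w =
        - (\sum_(j < n.+1) Psi a (T - grid t T n j) *
          (sigma_r * Br (grid t T n j.+1) w - sigma_r * Br (grid t T n j) w)) +
        \sum_(j < n.+1) Psi k (T - grid t T n j) *
          (sigma_pi * Bp (grid t T n j.+1) w - sigma_pi * Bp (grid t T n j) w) +
        sigma_I * (BI T w - BI t w).
      (* With the constant coefficient sigma_I the sum telescopes, so this part is equal to its
         limit for every n. *)
      have -> : BI T w - BI t w = \sum_(j < n.+1) (BI (grid t T n j.+1) w - BI (grid t T n j) w).
        rewrite -(big_mkord xpredT (fun j => BI (grid t T n j.+1) w - BI (grid t T n j) w)).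
        by rewrite (telescope_sumr (fun j => BI (grid t T n j) w))// grid_last grid0.
      rewrite mulr_sumr -sumrN -!big_split/=; apply: eq_bigr => j _.
      by rewrite /lincomb; ring.
    rewrite (eq_cvg _ _ e); apply: cvgD; last exact: cvg_cst.
    by apply: cvgD => //; exact: cvgN.
(* The variance due to r alone occurs in both prices and is left unevaluated; the cross term is
   negative because r enters with coefficient -sigma_r. *)
have varE : itg (fun s => lincomb_var rho (- sigma_r * Psi a (T - s)) sigma_I (sigma_pi * Psi k (T - s))) t T =
    itg (fun s => lincomb_var rho (- sigma_r * Psi a (T - s)) 0 0) t T +
    (sigma_I ^+ 2 * Delta + sigma_pi ^+ 2 * Upsilon k Delta
      - 2 * rho * sigma_r * sigma_pi * Lambda a k Delta).
  have cc (c c' : R) : cont_on t T (fun s => Psi c (T - s) * Psi c' (T - s)) by exact: cont_onM.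
  have csq : cont_on t T (fun s => Psi k (T - s) ^+ 2) by exact: cc.
  have c0 : cont_on t T (fun s => lincomb_var rho (- sigma_r * Psi a (T - s)) 0 0).
    have := cont_onM (cst (sigma_r ^+ 2)) (cc a a).
    rewrite (_ : (fun s => _) = (fun s => lincomb_var rho (- sigma_r * Psi a (T - s)) 0 0))//.
    by apply/funext => s; rewrite /lincomb_var; ring.
  have c1 := cont_onM (cst (sigma_pi ^+ 2)) csq.
  have c2 := cont_onM (cst (- (2 * rho * sigma_r * sigma_pi))) (cc a k).
  transitivity (itg (fun s => lincomb_var rho (- sigma_r * Psi a (T - s)) 0 0 +
      (sigma_I ^+ 2 + (sigma_pi ^+ 2 * Psi k (T - s) ^+ 2 +
       - (2 * rho * sigma_r * sigma_pi) * (Psi a (T - s) * Psi k (T - s))))) t T).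
    by apply: eq_itg => s _; rewrite /lincomb_var; ring.
  rewrite (itgD c0 (cont_onD (cst _) (cont_onD c1 c2)))// (itgD (cst _) (cont_onD c1 c2))//.
  rewrite (itgD c1 c2)// (itgZ _ csq)// (itgZ _ (cc a k))// itg_cst//.
  have dsq : continuous (fun x => Psi k x ^+ 2).
    by move=> x; apply: cvgM; exact: continuous_Psi.
  have dab : continuous (fun x => Psi a x * Psi k x).
    by move=> x; apply: cvgM; exact: continuous_Psi.
  rewrite (itg_subl T tT (der_Upsilon k) dsq) (itg_subl T tT (der_Lambda a k) dab).
  rewrite subrr Upsilon0 Lambda0 -/Delta; ring.
have D0 : Delta != 0 by rewrite subr_eq0 gt_eqF.
apply: filterS2 (filterI pE qE) (filterI hi Iratio) => w [pw qw] [hw [It0 _]].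
have I0' : I t w != 0 := lt0r_neq0 It0.
have hw2 : expR (Kp w + Kpi w + itg (fun s => lincomb_var rho (- sigma_r * Psi a (T - s)) sigma_I (sigma_pi * Psi k (T - s))) t T / 2)
  = expR (Kp w + itg (fun s => lincomb_var rho (- sigma_r * Psi a (T - s)) 0 0) t T / 2 + Delta * i w).
  rewrite [LHS]expRD [RHS]expRD [in RHS]expRD -[X in _ = X * _ * _]mul1r -pw -hw qw (gtr0_norm It0).
  by field.
move: hw2 => /expR_inj; rewrite varE.
set Vp := itg _ _ _ => hw3.
(* Half of sigma_I^2 Delta here cancels the correction in [Kpi], which removes sigma_I from the
   result. *)
have key : Delta * i w = Kpi w + (sigma_I ^+ 2 * Delta + sigma_pi ^+ 2 * Upsilon k Delta
      - 2 * rho * sigma_r * sigma_pi * Lambda a k Delta) / 2 by lra.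
rewrite -[i w](mulKf D0) key /Kpi.
by field.
Qed.
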